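(* Let $\alpha\in(1/3,1/2)$, $T>0$, let $\mathcal M$ be a compact foliated space and let $V_0,\dots,V_d$ be leafwise $C^3$ vector fields on $\mathcal M$. Let $\Phi$ and $\check\Phi$ be the Lyons–Itô maps associated with the coefficients $[V_1,\dots,V_d;V_0]$ and $[V_1,\dots,V_d;-V_0]$ respectively. Then for every $S\in[0,T]$ and $\mathbf w\in G\Omega_\alpha([0,T],\mathbb R^d)$ the map $m\mapsto\Phi(m,\mathbf w)_S$ is a leaf preserving homeomorphism of $\mathcal M$ and its inverse is $m\mapsto\check\Phi(m,\mathcal R_S\mathbf w)_S$. Moreover, the map $$G\Omega_\alpha([0,T],\mathbb R^d)\ni\mathbf w\mapsto\big[t\in[0,T]\mapsto\Phi(\bullet,\mathbf w)_t\big]\in C([0,T],\mathrm{Homeo}_L(\mathcal M))$$ is (well defined and) continuous.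
   Context: **Leafwise regularity.** Let $W_1,W_2$ be topological spaces and $U\subset\mathbb R^p\times W_1$ open, with points $(y,z)$. A function $f:U\to\mathbb R^d$ is of class $C_L^k$ if $f(\cdot,z)$ is $C^k$ for each $z$ and all $\partial_y^\beta f$ with $|\beta|\le k$ are continuous on $U$. A map $f:U\to V$, $V\subset\mathbb R^d\times W_2$ open, is of class $C_L^k$ if it is locally of the form $f(y,z)=(f_1(y,z),f_2(z))$ with $f_1$ of class $C_L^k$ and $f_2$ continuous; leafwise smooth means of class $C_L^k$ for all $k$. **Foliated spaces.** Let $\mathcal M,\mathcal Z$ be locally compact, separable, metrizable spaces. $\mathcal M$ is a $p$-dimensional foliated space (modelled transversely on $\mathcal Z$) if it has an open cover $\{U_\alpha\}$ and homeomorphisms $\varphi_\alpha:U_\alpha\to B_{\alpha,1}\times B_{\alpha,2}$, $B_{\alpha,1}\subset\mathbb R^p$ connected open, $B_{\alpha,2}\subset\mathcal Z$ open, with leafwise smooth transition maps. The $(U_\alpha,\varphi_\alpha)$ are foliated charts; sets $\varphi_\alpha^{-1}(B_{\alpha,1}\times\{z\})$ are plaques. The atlas is assumed regular: locally finite; each $\overline{U_\alpha}$ is a compact subset of a foliated chart $(W_\alpha,\psi_\alpha)$ with $\varphi_\alpha=\psi_\alpha|_{U_\alpha}$; each plaque of $U_\alpha$ meets at most one plaque of $\overline{U_\beta}$. The leaf $\mathcal L_m$ through $m$ is the set of $x$ for which there are plaques $P_1,\dots,P_n$ with $m\in P_1$, $x\in P_n$, $P_i\cap P_{i+1}\ne\emptyset$;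 leaves are smooth $p$-manifolds. A leafwise $C^k$ vector field is a map $V:m\mapsto V(m)\in T_m(\mathcal L_m)$ whose components with respect to $\partial/\partial y^1,\dots,\partial/\partial y^p$ are of class $C_L^k$ in every foliated chart. A leafwise $C^k$-function is a real function on $\mathcal M$ of class $C_L^k$ in every chart. **Homeomorphisms.** $f:\mathcal M\to\mathcal M$ is leaf preserving if $f(m)\in\mathcal L_m$ for all $m$, foliation preserving if it maps each leaf into a leaf. $\mathrm{Homeo}_L(\mathcal M)$ is the set of homeomorphisms $f$ of $\mathcal M$ with $f,f^{-1}$ foliation preserving, with metric $\mathrm{dist}(f,g)=\sup_m\mathrm d_{\mathcal M}(f(m),g(m))+\sup_m\mathrm d_{\mathcal M}(f^{-1}(m),g^{-1}(m))$, $\mathrm d_{\mathcal M}$ any metric inducing the topology of $\mathcal M$. $C([0,T],E)$ has the topology of uniform convergence. **Rough paths.** $\Omega_\alpha([0,T],\mathbb R^d)$ is the set of continuous maps $\mathbf w=(\mathbf w^1,\mathbf w^2)$ from $\triangle_T=\{0\le s\le t\le T\}$ to $\mathbb R^d\oplus(\mathbb R^d\otimes\mathbb R^d)$ with $\mathbf w^1_{s,t}=\mathbf w^1_{s,u}+\mathbf w^1_{u,t}$, $\mathbf w^2_{s,t}=\mathbf w^2_{s,u}+\mathbf w^2_{u,t}+\mathbf w^1_{s,u}\otimes\mathbf w^1_{u,t}$ for $s\le u\le t$ and $\|\mathbf w^i\|_{i\alpha}=\sup_{s<t}|\mathbf w^i_{s,t}|/(t-s)^{i\alpha}<\infty$,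 $i=1,2$; metric $\mathrm d_\alpha(\mathbf w,\hat{\mathbf w})=\max_{i=1,2}\|\mathbf w^i-\hat{\mathbf w}^i\|_{i\alpha}$. For a Lipschitz path $w$ with $w_0=0$ the natural lift $\mathbf L(w)$ is $\mathbf w^1_{s,t}=w_t-w_s$, $\mathbf w^2_{s,t}=\int_s^t(w_u-w_s)\otimes dw_u$. $G\Omega_\alpha([0,T],\mathbb R^d)$ is the $\mathrm d_\alpha$-closure of the set of such lifts. Components are written $\mathbf w^{1,i}$, $\mathbf w^{2,jk}$. Time reversal: for $S\in[0,T]$, $\mathcal R_S\mathbf w$ is the rough path on $[0,S]$ given by $(\mathcal R_S\mathbf w)^{1,i}_{s,t}=-\mathbf w^{1,i}_{S-t,S-s}$, $(\mathcal R_S\mathbf w)^{2,ij}_{s,t}=\mathbf w^{2,ji}_{S-t,S-s}$, $0\le s\le t\le S$. **RDE and Lyons–Itô map.** $x\in C([a,b],\mathcal M)$ solves the RDE $dx_t=\sum_{i=1}^dV_i(x_t)dw^i_t+V_0(x_t)dt$ with initial condition $m$ if $x_a=m$ and for every leafwise $C^3$-function $f$ there is a constant $C$ (independent of $(s,t)$) such that for all $a\le s\le t\le b$ $$\Big|f(x_t)-f(x_s)-\sum_{i}V_if(x_s)\mathbf w^{1,i}_{s,t}-\sum_{j,k}V_jV_kf(x_s)\mathbf w^{2,jk}_{s,t}-V_0f(x_s)(t-s)\Big|\le C|t-s|^{3\alpha}.$$ For leafwise $C^3$ vector fields on compact $\mathcal M$ a unique solution exists for every $m$ and $\mathbf w$.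 $\Phi(m,\mathbf w)_t$ denotes the solution on $[0,T]$ with $x_0=m$; $\check\Phi$ is the same with $V_0$ replaced by $-V_0$. $\check\Phi(m,\mathcal R_S\mathbf w)_S$ is the time-$S$ value of the solution on $[0,S]$ driven by $\mathcal R_S\mathbf w$ (equal to $m$ if $S=0$). *)

(* Defs.v *)
From HB Require Import structures.
From mathcomp Require Import all_boot all_order all_algebra.
From mathcomp Require Import all_classical all_reals all_analysis.

Set Implicit Arguments.
Unset Strict Implicit.
Unset Printing Implicit Defensive.

Import Order.TTheory GRing.Theory Num.Theory.
Import numFieldNormedType.Exports.

Local Open Scope classical_set_scope.
Local Open Scope ring_scope.

Section LeafwiseRegularity.
Context {R : realType} {p : nat}.

Definition pder {W : Type} {V : normedModType R} (i : 'I_p)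
    (f : 'rV[R]_p * W -> V) : 'rV[R]_p * W -> V :=
  fun q => derive (fun y : 'rV[R]_p => f (y, q.2)) q.1 (delta_mx 0 i).

(** [f] is of class C_L^k on the open set [U]: all iterated partial derivatives
    of order at most [k] in the first variable exist on [U] and are (jointly)
    continuous there. *)
Fixpoint CL {W : topologicalType} {V : normedModType R} (k : nat)
    (U : set ('rV[R]_p * W)) (f : 'rV[R]_p * W -> V) : Prop :=
  {within U, continuous f} /\
  if k is k'.+1 then
    forall i : 'I_p,
      (forall q, U q ->
         derivable (fun y : 'rV[R]_p => f (y, q.2)) q.1 (delta_mx 0 i)) /\
      CL k' U (pder i f)
  else True.

Definition CL_map {W1 W2 : topologicalType} {d : nat} (k : nat)
    (U : set ('rV[R]_p * W1)) (f : 'rV[R]_p * W1 -> 'rV[R]_d * W2) : Prop :=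
  forall q, U q -> exists N : set ('rV[R]_p * W1),
    [/\ open N, N q, N `<=` U &
     exists (f1 : 'rV[R]_p * W1 -> 'rV[R]_d) (f2 : W1 -> W2),
       [/\ CL k N f1, {within snd @` N, continuous f2} &
        forall r, N r -> f r = (f1 r, f2 r.2)]].

End LeafwiseRegularity.

Definition separable_space (X : topologicalType) : Prop :=
  exists2 D : set X, countable D & dense D.

Section FoliatedSpaces.
Context {R : realType} (p : nat) (M Z : metricType R).

Record chart := Chart {
  chart_dom : set M ;
  chart_base : set 'rV[R]_p ;
  chart_trans : set Z ;
  chart_map : M -> 'rV[R]_p * Z ;
  chart_inv : 'rV[R]_p * Z -> M ;
  chart_dom_open : open chart_dom ;
  chart_base_open : open chart_base ;
  chart_base_connected : connected chart_base ;
  chart_trans_open : open chart_trans ;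
  chart_map_box : forall m, chart_dom m ->
    (chart_base `*` chart_trans) (chart_map m) ;
  chart_inv_dom : forall q, (chart_base `*` chart_trans) q ->
    chart_dom (chart_inv q) ;
  chart_mapK : forall m, chart_dom m -> chart_inv (chart_map m) = m ;
  chart_invK : forall q, (chart_base `*` chart_trans) q ->
    chart_map (chart_inv q) = q ;
  chart_map_continuous : {within chart_dom, continuous chart_map} ;
  chart_inv_continuous :
    {within chart_base `*` chart_trans, continuous chart_inv} }.

Definition chart_box (c : chart) : set ('rV[R]_p * Z) :=
  chart_base c `*` chart_trans c.

Definition smooth_transition (c c' : chart) : Prop :=
  forall k, CL_map k
    [set q | chart_box c q /\ chart_dom c' (chart_inv c q)]
    (chart_map c' \o chart_inv c).

Definition chart_plaque (c : chart) (z : Z) : set M :=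
  [set m | chart_dom c m /\ (chart_map c m).2 = z].

(** [fol_big a] is the larger chart (W_a, psi_a) of a regular atlas. In
    [fol_plaques] a plaque of the closure of U_b is a slice of this closure
    along a plaque of W_b. *)
Record foliated_space := FoliatedSpace {
  fol_locally_compact : locally_compact [set: M] ;
  fol_separable : separable_space M ;
  fol_trans_locally_compact : locally_compact [set: Z] ;
  fol_trans_separable : separable_space Z ;
  fol_index : Type ;
  fol_chart : fol_index -> chart ;
  fol_cover : forall m, exists a, chart_dom (fol_chart a) m ;
  fol_transition : forall a b,
    smooth_transition (fol_chart a) (fol_chart b) ;
  fol_locally_finite : forall m, exists2 N : set M, open_nbhs m N &
    finite_set [set a | (chart_dom (fol_chart a) `&` N) !=set0] ;
  fol_big : fol_index -> chart ;
  fol_big_compatible : forall a b,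
    smooth_transition (fol_big a) (fol_chart b) /\
    smooth_transition (fol_chart b) (fol_big a) ;
  fol_closure_compact : forall a, compact (closure (chart_dom (fol_chart a))) ;
  fol_closure_sub : forall a,
    closure (chart_dom (fol_chart a)) `<=` chart_dom (fol_big a) ;
  fol_big_restrict : forall a m, chart_dom (fol_chart a) m ->
    chart_map (fol_chart a) m = chart_map (fol_big a) m ;
  fol_plaques : forall a b z z1 z2,
    let P := chart_plaque (fol_chart a) z in
    let Q z' := closure (chart_dom (fol_chart b)) `&`
                chart_plaque (fol_big b) z' in
    (P `&` Q z1) !=set0 -> (P `&` Q z2) !=set0 -> z1 = z2 }.

Context (F : foliated_space).

Definition plaque (P : set M) : Prop :=
  exists (a : fol_index F) (z : Z), chart_trans (fol_chart a) z /\
    P = chart_inv (fol_chart a) @` (chart_base (fol_chart a) `*` [set z]).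

Definition leaf (m : M) : set M :=
  [set x | exists (n : nat) (P : nat -> set M),
    [/\ forall i, (i <= n)%N -> plaque (P i), P 0%N m, P n x &
        forall i, (i < n)%N -> (P i `&` P i.+1) !=set0]].

Definition leafwise_function (k : nat) (f : M -> R) : Prop :=
  forall a : fol_index F, CL k (chart_box (fol_chart a)) (f \o chart_inv (fol_chart a)).

(** A field of leaf tangent vectors is given by its components
    [V a m 0 i] along d/dy^i in the chart [a] at [m] (relevant only for [m] in
    the domain of that chart), subject to the change of coordinates rule. *)
Definition vfield := fol_index F -> M -> 'rV[R]_p.

Definition tangent (V : vfield) : Prop :=
  forall (a b : fol_index F) m,
    chart_dom (fol_chart a) m -> chart_dom (fol_chart b) m ->
    V b m = \sum_(i < p) V a m 0 i *:
      pder i (fun q => (chart_map (fol_chart b)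
                          (chart_inv (fol_chart a) q)).1)
        (chart_map (fol_chart a) m).

Definition leafwise_vfield (k : nat) (V : vfield) : Prop :=
  tangent V /\
  forall a : fol_index F, CL k (chart_box (fol_chart a))
    (fun q => V a (chart_inv (fol_chart a) q)).

Definition chart_at (m : M) : fol_index F := projT1 (cid (fol_cover F m)).

(** The derivative V f, computed at [m] in a chosen chart around [m]; by
    [tangent] the value does not depend on the chart. *)
Definition vf_app (V : vfield) (f : M -> R) : M -> R := fun m =>
  let c := fol_chart (chart_at m) in
  \sum_(i < p) V (chart_at m) m 0 i *
    (pder i (f \o chart_inv c) (chart_map c m) : R).

Definition vf_opp (V : vfield) : vfield := fun a m => - V a m.

Definition leaf_preserving (f : M -> M) : Prop := forall m, leaf m (f m).

Definition foliation_preserving (f : M -> M) : Prop :=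
  forall m, exists m', f @` leaf m `<=` leaf m'.

Record homeoL := HomeoL {
  homeoL_fun :> M -> M ;
  homeoL_inv : M -> M ;
  homeoL_funK : cancel homeoL_fun homeoL_inv ;
  homeoL_invK : cancel homeoL_inv homeoL_fun ;
  homeoL_fun_continuous : continuous homeoL_fun ;
  homeoL_inv_continuous : continuous homeoL_inv ;
  homeoL_fun_foliation : foliation_preserving homeoL_fun ;
  homeoL_inv_foliation : foliation_preserving homeoL_inv }.

(** Meant for compact [M], where the suprema are those of bounded sets. *)
Definition homeoL_dist (f g : homeoL) : R :=
  sup [set mdist (f m) (g m) | m in [set: M]] +
  sup [set mdist (homeoL_inv f m) (homeoL_inv g m) | m in [set: M]].

End FoliatedSpaces.

Section RoughPaths.
Context {R : realType} {d : nat}.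

(** A pair (w^1, w^2), with w^{2,jk} the (j, k) entry of the matrix. Only the
    values on [triangle T] matter; norms are the max norms of the entries. *)
Record two_param := TwoParam {
  rp1 : R -> R -> 'rV[R]_d ;
  rp2 : R -> R -> 'M[R]_d }.

Definition triangle (T : R) : set (R * R) :=
  [set st | 0 <= st.1 /\ st.1 <= st.2 /\ st.2 <= T].

Definition holder_quotients {V : normedModType R} (T beta : R)
    (f : R -> R -> V) : set R :=
  [set r | exists s t, [/\ 0 <= s, s < t, t <= T &
                           r = `|f s t| / (t - s) `^ beta]].

Definition holder_norm {V : normedModType R} (T beta : R)
    (f : R -> R -> V) : R := sup (holder_quotients T beta f).

Definition rough_path (alpha T : R) (w : two_param) : Prop :=
  [/\ {within triangle T, continuous (fun st => rp1 w st.1 st.2)},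
      {within triangle T, continuous (fun st => rp2 w st.1 st.2)},
      forall s u t, 0 <= s -> s <= u -> u <= t -> t <= T ->
        rp1 w s t = rp1 w s u + rp1 w u t,
      forall s u t, 0 <= s -> s <= u -> u <= t -> t <= T ->
        rp2 w s t = rp2 w s u + rp2 w u t + (rp1 w s u)^T *m rp1 w u t &
      has_ubound (holder_quotients T alpha (rp1 w)) /\
      has_ubound (holder_quotients T (2 * alpha) (rp2 w))].

Definition rough_dist (alpha T : R) (w w' : two_param) : R :=
  Num.max (holder_norm T alpha (fun s t => rp1 w s t - rp1 w' s t))
          (holder_norm T (2 * alpha) (fun s t => rp2 w s t - rp2 w' s t)).

(** [I] is the Riemann-Stieltjes integral of [f] against [g] over [[a, b]]:
    the limit of the tagged sums as the mesh goes to [0]. *)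
Definition RS_integral (f g : R -> R) (a b I : R) : Prop :=
  forall eps : R, 0 < eps -> exists2 delta : R, 0 < delta &
    forall (s : seq R) (xi : nat -> R),
      itv_partition a b s ->
      (forall i, (i < size s)%N ->
        let l := nth b (a :: s) i in let r := nth b (a :: s) i.+1 in
        r - l < delta /\ l <= xi i <= r) ->
      `|\sum_(i < size s)
           f (xi i) * (g (nth b (a :: s) i.+1) - g (nth b (a :: s) i)) - I|
        < eps.

Definition lipschitz_path (T : R) (w : R -> 'rV[R]_d) : Prop :=
  w 0 = 0 /\
  exists K : R, forall s t, 0 <= s <= T -> 0 <= t <= T ->
    `|w s - w t| <= K * `|s - t|.

Definition natural_lift (T : R) (w : R -> 'rV[R]_d) (W : two_param) : Prop :=
  forall s t, 0 <= s -> s <= t -> t <= T ->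
    rp1 W s t = w t - w s /\
    forall j k : 'I_d,
      RS_integral (fun u => w u 0 j - w s 0 j) (fun u => w u 0 k) s t
        (rp2 W s t j k).

Definition geometric_rough_path (alpha T : R) (w : two_param) : Prop :=
  rough_path alpha T w /\
  forall eps : R, 0 < eps ->
    exists (v : R -> 'rV[R]_d) (L : two_param),
      [/\ lipschitz_path T v, natural_lift T v L &
          rough_dist alpha T w L < eps].

Definition time_reversal (S : R) (w : two_param) : two_param :=
  {| rp1 := fun s t => - rp1 w (S - t) (S - s) ;
     rp2 := fun s t => (rp2 w (S - t) (S - s))^T |}.

End RoughPaths.

Arguments two_param R d : clear implicits.

Section RDE.
Context {R : realType} {p d : nat} {M Z : metricType R}.
Context (F : foliated_space p M Z).

Definition RDE_solution (alpha a b : R) (V : 'I_d -> vfield F) (V0 : vfield F)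
    (w : two_param R d) (m : M) (x : R -> M) : Prop :=
  [/\ {within `[a, b], continuous x}, x a = m &
   forall f : M -> R, leafwise_function F 3 f ->
   exists C : R, forall s t, a <= s -> s <= t -> t <= b ->
     `|f (x t) - f (x s)
       - \sum_(i < d) vf_app (V i) f (x s) * rp1 w s t 0 i
       - \sum_(j < d) \sum_(k < d)
           vf_app (V j) (vf_app (V k) f) (x s) * rp2 w s t j k
       - vf_app V0 f (x s) * (t - s)| <= C * (t - s) `^ (3 * alpha)].

(** [Phi m w] is a solution for each [m] and [w]; solutions being unique, this
    determines [Phi m w] on [0, T]. *)
Definition lyons_ito_map (alpha T : R) (V : 'I_d -> vfield F) (V0 : vfield F)
    (Phi : M -> two_param R d -> R -> M) : Prop :=
  forall m w, geometric_rough_path alpha T w ->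
    RDE_solution alpha 0 T V V0 w m (Phi m w).

End RDE.

(* Main.v *)
Require Import Defs.
From HB Require Import structures.
From mathcomp Require Import all_boot all_order all_algebra.
From mathcomp Require Import all_classical all_reals all_analysis.
From mathcomp Require Import ring lra.
Import Order.TTheory GRing.Theory Num.Theory.
Import numFieldNormedType.Exports.
Local Open Scope classical_set_scope.
Local Open Scope ring_scope.

(** Testing a solution against functions of the transverse coordinate, whose
    leafwise derivatives vanish, shows that in a foliated chart the transverse
    coordinate of a solution is locally constant. A solution is therefore
    locally a solution of a rough differential equation in [R^p] in the sense
    of Davie: [y t - y s] agrees with its second order expansion up to
    [O((t - s)^(3 alpha))]. Davie's a priori bound turns an arbitrary constant
    in this [O] into one which depends only on the fields and on the size of
    the driver; with the compactness of [M] it makes the solutions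
    equicontinuous, and lets the equation pass to pointwise limits. As
    solutions are unique, limits along ultrafilters show that the flow is
    jointly continuous in the initial point, the time and the driver.
    For a geometric driver the symmetric part of the second level is determined
    by the first level, so that a time-reversed solution solves the reversed
    equation; by uniqueness the two Lyons-Ito maps are inverse to each other.
    The uniform statements about flows and inverse flows follow from joint
    continuity, injectivity and the compactness of [M] and [[0, T]]. *)

(** The constant in the definition of an RDE solution depends on the path and on the test function,
    so the definition does not pass to limits by itself; hence the need for an a priori bound. That
    bound rests on halving intervals: as 3 * [al] > 1, a cubic error shrinks under halving by the
    factor [halving_ratio], and any constant is driven to the fixed point of an affine contraction
    that involves only the fields and the driver. Solutions are tested only against functions
    defined on all of [M], so chart coordinates and transverse distances must be cut off and
    extended by zero; since test functions of class C_L^3 are allowed, powers of positive parts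
    serve as cutoffs. The inverse flow at time t is driven by a reversed path that changes with t,
    on an interval that changes with t. Its continuity is not obtained by comparing reversed
    equations but by inverting the forward flow: if the images of two points under close data are
    close, the ultrafilter limits of the points have the same image, so they agree by
    injectivity. *)

Set Implicit Arguments.
Unset Strict Implicit.
Unset Printing Implicit Defensive.

(** * Identities in Z-modules *)

Inductive zexp := ZVar of nat | ZAdd of zexp & zexp | ZOpp of zexp | ZZero.

Fixpoint zeval {V : zmodType} (env : seq V) (e : zexp) : V :=
  match e with
  | ZVar i => nth 0 env i
  | ZAdd x y => zeval env x + zeval env y
  | ZOpp x => - zeval env x
  | ZZero => 0
  end.

Fixpoint zcoef (i : nat) (e : zexp) : int :=
  match e with
  | ZVar j => if i == j then 1 else 0
  | ZAdd x y => zcoef i x + zcoef i y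
  | ZOpp x => - zcoef i x
  | ZZero => 0
  end.

(** The value depends only on the integer multiplicity of each atom, so equality of expressions
    reduces to a computation on integers. *)
Lemma zeval_coef {V : zmodType} (env : seq V) (e : zexp) :
  zeval env e = \sum_(i < size env) env`_i *~ zcoef i e.
Proof.
elim: e => [j|x ihx y ihy|x ihx|] /=; rewrite ?ihx ?ihy.
(* An index beyond [env] evaluates to the default 0 of [nth] and matches no index of the sum. *)
- have [js|js] := ltnP j (size env); last first.
    rewrite nth_default// big1// => i _; case: eqP => [ij|]; last by rewrite mulr0z.
    by have := ltn_ord i; rewrite ij ltnNge js.
  rewrite (bigD1 (Ordinal js)) //= eqxx mulr1z big1 ?addr0// => i ij.
  by rewrite ifF ?mulr0z//; apply/negbTE; rewrite -val_eqE in ij.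
- by rewrite -big_split; apply: eq_bigr => i _; rewrite /= mulrzDr.
- by rewrite -sumrN; apply: eq_bigr => i _; rewrite mulrNz.
- by rewrite big1// => i _; rewrite mulr0z.
Qed.

Lemma zeval_eq {V : zmodType} (env : seq V) (e1 e2 : zexp) :
  all (fun i => zcoef i e1 == zcoef i e2) (iota 0 (size env)) ->
  zeval env e1 = zeval env e2.
Proof.
move=> /allP h; rewrite !zeval_coef; apply: eq_bigr => i _.
by congr (_ *~ _); apply/eqP/h; rewrite mem_iota add0n ltn_ord.
Qed.

Ltac zmod_mem x l :=
  lazymatch l with
  | nil => constr:(false)
  | cons x _ => constr:(true)
  | cons _ ?l' => zmod_mem x l'
  end.

Ltac zmod_atoms l e :=
  lazymatch e with
  | (?x + ?y)%R => let l1 := zmod_atoms l x in zmod_atoms l1 y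
  | (- ?x)%R => zmod_atoms l x
  | 0%R => l
  | _ => lazymatch zmod_mem e l with
         | true => l
         | false => constr:(cons e l)
         end
  end.

Ltac zmod_index x l :=
  lazymatch l with
  | cons x _ => constr:(O)
  | cons _ ?l' => let n := zmod_index x l' in constr:(S n)
  end.

Ltac zmod_quote l e :=
  lazymatch e with
  | (?x + ?y)%R =>
      let x' := zmod_quote l x in let y' := zmod_quote l y in
      constr:(ZAdd x' y')
  | (- ?x)%R => let x' := zmod_quote l x in constr:(ZOpp x')
  | 0%R => constr:(ZZero)
  | _ => let n := zmod_index e l in constr:(ZVar n)
  end.

(* Decides equalities between integer combinations in a Z-module, which [ring] does not handle. *)
Ltac zmod :=
  lazymatch goal with
  | |- @eq ?T ?x ?y =>
    let l0 := zmod_atoms (@nil T) x in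
    let l := zmod_atoms l0 y in
    let x' := zmod_quote l x in
    let y' := zmod_quote l y in
    refine (@zeval_eq _ l x' y' _); exact: erefl
  end.

(** * Davie's estimates *)

Section PowerControl.
Context {R : realType}.
Variable al : R.
Hypothesis al_gt : 3^-1 < al.
Implicit Types s t : R.

Definition halving_ratio : R := 2 `^ (1 - 3 * al).

Lemma halving_ratio_gt0 : 0 < halving_ratio.
Proof. by apply: powR_gt0. Qed.

Lemma halving_ratio_lt1 : halving_ratio < 1.
Proof.
rewrite /halving_ratio /powR pnatr_eq0 /= -[ltRHS]expR0 ltr_expR.
have : 0 < ln (2 : R) by apply: ln_gt0; rewrite ltr1n.
have h : 1 - 3 * al < 0 by move: al_gt; lra.
by move=> ln2; rewrite nmulr_rlt0.
Qed.

Lemma al_gt0 : 0 < al. Proof. by apply: lt_trans al_gt; rewrite invr_gt0. Qed.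

Lemma powR_al_le s t : 0 <= s -> s <= t -> s `^ al <= t `^ al.
Proof.
move=> s0 st; apply: ge0_ler_powR => //; first exact/ltW/al_gt0.
by rewrite nnegrE (le_trans s0).
Qed.

Lemma powR_al_le1 t : 0 <= t -> t <= 1 -> t `^ al <= 1.
Proof.
by move=> t0 t1; apply: le_trans (powR_al_le t0 t1) _; rewrite powR1.
Qed.

Lemma powR_half t : 0 <= t ->
  2 * ((t / 2) `^ al) ^+ 3 = halving_ratio * (t `^ al) ^+ 3.
Proof.
move=> t0; rewrite powRM ?invr_ge0// exprMn mulrCA mulrC; congr (_ * _).
rewrite /halving_ratio powRD; last by rewrite pnatr_eq0 implybT.
rewrite powRr1//; congr (_ * _).
rewrite -powR_inv1// -powRrM -powR_mulrn ?powR_ge0// -powRrM.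
by congr (_ `^ _); ring.
Qed.

Lemma powR_al_small (e : R) : 0 < e -> exists2 h : R, 0 < h & forall t, 0 <= t -> t <= h -> t `^ al <= e.
Proof.
move=> e0; exists (e `^ al^-1); first exact: powR_gt0.
move=> t t0 th; apply: le_trans (powR_al_le t0 th) _.
have al0 : al != 0 := lt0r_neq0 al_gt0.
by rewrite -powRrM mulVf // powRr1 // ltW.
Qed.

End PowerControl.

(** Let n tend to infinity. The halving arguments below all end here: they improve a bound step by
    step, and the initial constant [B] disappears in the limit. *)
Lemma contraction_bound {R : realType} (x K B q : R) : 0 <= q -> q < 1 ->
  (forall n, x <= K + q ^+ n * B) -> x <= K.
Proof.
move=> q0 q1 h.
have cv : (fun n => K + q ^+ n * B) @ \oo --> K + 0 * B.
  apply: cvgD; first exact: cvg_cst.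
  by apply: cvgMr_tmp; apply: cvg_expr; rewrite ger0_norm.
by rewrite -[K]addr0 -[0](mul0r B); apply: (cvgr_to_ge cv); apply: nearW.
Qed.

(** * Second order expansions and their failure of additivity *)

Section DavieSystem.
Context {R : realType} {E : normedModType R}.
Implicit Types (s t u : R) (x y : E).

Definition davie_defect (cA cB : R -> R -> E -> E) (y : R -> E) s t : E :=
  y t - y s - cA s t (y s) - cB s t (y s).

(* [cA s t x] and [cB s t x] are the first and second order terms of the
   expansion from [x] over [[s, t]]; [cG s t x] is the derivative of [cA s t]
   at [x]. *)
Record davie_system (al L a b : R) (D : set E)
    (cA cB : R -> R -> E -> E) (cG : R -> R -> E -> E -> E) : Prop := {
  ds_L : 1 <= L ;
  ds_length : b - a <= 1 ;
  ds_A_additive : forall s u t x, a <= s -> s <= u -> u <= t -> t <= b ->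
    cA s t x = cA s u x + cA u t x ;
  ds_B_chen : forall s u t x, a <= s -> s <= u -> u <= t -> t <= b ->
    cB s t x = cB s u x + cB u t x + cG u t x (cA s u x) ;
  ds_G_additive : forall s t x v w, cG s t x (v + w) = cG s t x v + cG s t x w ;
  ds_A_bound : forall s t x, a <= s -> s <= t -> t <= b -> D x ->
    `|cA s t x| <= L * (t - s) `^ al ;
  ds_B_bound : forall s t x, a <= s -> s <= t -> t <= b -> D x ->
    `|cB s t x| <= L * (t - s) `^ al ^+ 2 ;
  ds_G_bound : forall s t x v, a <= s -> s <= t -> t <= b -> D x ->
    `|cG s t x v| <= L * (t - s) `^ al * `|v| ;
  ds_A_lipschitz : forall s t x x', a <= s -> s <= t -> t <= b -> D x -> D x' ->
    `|cA s t x - cA s t x'| <= L * (t - s) `^ al * `|x - x'| ;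
  ds_B_lipschitz : forall s t x x', a <= s -> s <= t -> t <= b -> D x -> D x' ->
    `|cB s t x - cB s t x'| <= L * (t - s) `^ al ^+ 2 * `|x - x'| ;
  ds_G_lipschitz : forall s t x x' v, a <= s -> s <= t -> t <= b ->
    D x -> D x' ->
    `|cG s t x v - cG s t x' v| <= L * (t - s) `^ al * (`|x - x'| * `|v|) ;
  ds_A_taylor : forall s t x y x' y', a <= s -> s <= t -> t <= b ->
    D x -> D y -> D x' -> D y' ->
    `|(cA s t y - cA s t x - cG s t x (y - x))
      - (cA s t y' - cA s t x' - cG s t x' (y' - x'))| <=
    L * (t - s) `^ al * (`|x - x'| * `|y - x| ^+ 2
      + `|(y - x) - (y' - x')| * (`|y - x| + `|y' - x'|)) ;
  ds_B_taylor : forall s t x y x' y', a <= s -> s <= t -> t <= b ->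
    D x -> D y -> D x' -> D y' ->
    `|(cB s t y - cB s t x) - (cB s t y' - cB s t x')| <=
    L * (t - s) `^ al ^+ 2 * (`|(y - x) - (y' - x')| + `|x - x'| * `|y - x|) }.

Variables (al L a b : R) (D : set E).
Variables (cA cB : R -> R -> E -> E) (cG : R -> R -> E -> E -> E).
Hypothesis al_gt : 3^-1 < al.
Hypothesis sys : davie_system al L a b D cA cB cG.

Let om t := t `^ al.
Let q := halving_ratio al.
Let Gam := davie_defect cA cB.

Let L1 : 1 <= L := ds_L sys.

Let om_ge0 t : 0 <= om t. Proof. exact: powR_ge0. Qed.

Let om_le s u t v : s <= u -> u <= t -> t <= v -> om (t - u) <= om (v - s).
Proof. by move=> su ut tv; apply: powR_al_le => //; lra. Qed.

Let om_le1 s t : a <= s -> s <= t -> t <= b -> om (t - s) <= 1.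
Proof.
by move=> as_ st tb; apply: powR_al_le1 => //; have := ds_length sys; lra.
Qed.

(** The first order part of [cG u t (y s) (y u - y s)] is the cross term of [ds_B_chen] and cancels
    it. What is left is a Taylor remainder of [cA], [cG] applied to a second order increment, and a
    variation of [cB]: three terms of third order. *)
Lemma davie_defect_split (y : R -> E) s u t :
  a <= s -> s <= u -> u <= t -> t <= b ->
  Gam y s t = Gam y s u + Gam y u t
    + ((cA u t (y u) - cA u t (y s) - cG u t (y s) (y u - y s))
       + cG u t (y s) (cB s u (y s) + Gam y s u)
       + (cB u t (y u) - cB u t (y s))).
Proof.
move=> as_ su ut tb.
have -> : y u - y s = cA s u (y s) + (cB s u (y s) + Gam y s u).
  by rewrite /Gam /davie_defect; zmod.
rewrite (ds_G_additive sys).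
rewrite /Gam /davie_defect (ds_A_additive sys (y s) as_ su ut tb).
rewrite (ds_B_chen sys (y s) as_ su ut tb).
rewrite opprD.
zmod.
Qed.


Let cG0 s t x : cG s t x 0 = 0.
Proof.
by apply: (@addrI _ (cG s t x 0)); rewrite -(ds_G_additive sys) !addr0.
Qed.

Let cGB s t x v w : cG s t x (v - w) = cG s t x v - cG s t x w.
Proof. by apply/eqP; rewrite -subr_eq opprK -(ds_G_additive sys) subrK. Qed.

Lemma davie_increment (y : R -> E) (N : R) s t : a <= s -> s <= t -> t <= b ->
  D (y s) -> `|Gam y s t| <= N * om (t - s) ->
  `|y t - y s| <= (2 * L + N) * om (t - s).
Proof.
move=> as_ st tb Ds; have o1 := om_le1 as_ st tb; have o0 := om_ge0 (t - s).
move: (ds_A_bound sys as_ st tb Ds) (ds_B_bound sys as_ st tb Ds).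
have -> : y t - y s = cA s t (y s) + (cB s t (y s) + Gam y s t).
  by rewrite /Gam /davie_defect; zmod.
rewrite -/(om _); set o := om _ in o1 o0 *.
move=> hA hB hG; have := ler_normD (cA s t (y s)) (cB s t (y s) + Gam y s t).
have := ler_normD (cB s t (y s)) (Gam y s t).
have o2 : o ^+ 2 <= o by rewrite expr2 ler_piMl.
have L0 : 0 <= L by move: L1; lra.
have := ler_wpM2l L0 o2; lra.
Qed.

(** In the constant, [M ^+ 2] comes from the Taylor remainder, [L + N] from the second order part of
    the increment inside [cG], and the last [M] from the variation of [cB]. *)
Lemma davie_remainder_bound (y : R -> E) s u t (M N : R) :
  a <= s -> s <= u -> u <= t -> t <= b -> D (y s) -> D (y u) -> 0 <= M ->
  `|y u - y s| <= M * om (t - s) -> 0 <= N ->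
  `|Gam y s u| <= N * om (t - s) ^+ 2 ->
  `|(cA u t (y u) - cA u t (y s) - cG u t (y s) (y u - y s))
       + cG u t (y s) (cB s u (y s) + Gam y s u)
       + (cB u t (y u) - cB u t (y s))|
  <= L * (M ^+ 2 + L + N + M) * om (t - s) ^+ 3.
Proof.
move=> as_ su ut tb Ds Du M0 hv N0 hr.
have au : a <= u by lra.
have ub : u <= b by lra.
have L0 : 0 <= L by move: L1; lra.
have st : s <= t by lra.
have o0 := om_ge0 (t - s); have o20 := om_ge0 (t - u).
have o2o : om (t - u) <= om (t - s) by apply: om_le.
have o1o : om (u - s) <= om (t - s) by apply: om_le.
(* With the second pair of points equal, the two-point estimate becomes the usual Taylor bound,
   quadratic in the increment. *)
have := ds_A_taylor sys au ut tb Ds Du Ds Ds.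
rewrite !subrr cG0 !subr0 normr0 mul0r add0r addr0.
have := ds_G_bound sys (cB s u (y s) + Gam y s u) au ut tb Ds.
have := ds_B_lipschitz sys au ut tb Du Ds.
have := ds_B_bound sys as_ su ub Ds.
rewrite -!/(om _); set o := om (t - s) in o2o o1o hv hr o0 *.
move=> hB1 hB hG hA.
have hr' : `|cB s u (y s) + Gam y s u| <= (L + N) * o ^+ 2.
  apply: le_trans (ler_normD _ _) _; rewrite mulrDl lerD//.
  by apply: le_trans hB1 _; rewrite ler_wpM2l// lerXn2r ?nnegrE.
have h1 : L * om (t - u) * (`|y u - y s| * `|y u - y s|) <= L * o * (M * o * (M * o)).
  by rewrite ler_pM ?mulr_ge0// ?ler_wpM2l// ler_pM.
have h2 : L * om (t - u) * `|cB s u (y s) + Gam y s u| <= L * o * ((L + N) * o ^+ 2).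
  by rewrite ler_pM ?mulr_ge0// ler_wpM2l.
have h3 : L * om (t - u) ^+ 2 * `|y u - y s| <= L * o ^+ 2 * (M * o).
  by rewrite ler_pM ?mulr_ge0// ?exprn_ge0// ler_wpM2l// lerXn2r ?nnegrE.
apply: le_trans (ler_normD _ _) _.
have := ler_normD (cA u t (y u) - cA u t (y s) - cG u t (y s) (y u - y s))
  (cG u t (y s) (cB s u (y s) + Gam y s u)).
move: hA hG hB h1 h2 h3; set n1 := `|_|; set n2 := `|cG _ _ _ _|; set n3 := `|_ - _|.
set n4 := `|_ + _| => *.
have -> : L * (M ^+ 2 + L + N + M) * o ^+ 3 = L * o * (M * o * (M * o)) +
   L * o * ((L + N) * o ^+ 2) + L * o ^+ 2 * (M * o) by ring.
lra.
Qed.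

(** The fixed point of [C |-> q * C + 14 * L ^+ 3], the map by which the constant of a defect bound
    changes when the scale is doubled. *)
Definition davie_constant : R := 14 * L ^+ 3 / (1 - q).

Let davie_constant_fix : q * davie_constant + 14 * L ^+ 3 = davie_constant.
Proof.
rewrite /davie_constant; have := halving_ratio_lt1 al_gt; rewrite -/q => q1.
by field; rewrite subr_eq0 gt_eqF.
Qed.

Lemma davie_constant_ge0 : 0 <= davie_constant.
Proof.
rewrite /davie_constant divr_ge0//.
  by rewrite mulr_ge0// exprn_ge0//; move: L1; lra.
by have := halving_ratio_lt1 al_gt; rewrite -/q; lra.
Qed.

(** * The a priori bound on the defect *)

Section APriori.
Variable y : R -> E.
Hypothesis yD : forall s, a <= s -> s <= b -> D (y s).

Let bounded_defect (h C : R) := forall s t, a <= s -> s <= t -> t <= b -> t - s <= h ->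
  `|Gam y s t| <= C * om (t - s) ^+ 3.

(** Cut the interval at its midpoint: the two halves contribute [q * C], the failure of additivity
    the rest. The hypothesis [C * om h <= 1] keeps the latter independent of [C]. *)
Let bounded_defect_double (h C : R) : 0 <= C -> 0 <= h -> C * om h <= 1 ->
  bounded_defect h C -> bounded_defect (2 * h) (q * C + 14 * L ^+ 3).
Proof.
move=> C0 h0 Ch hC s t as_ st tb th.
set u := (s + t) / 2.
have su : s <= u by rewrite /u; lra.
have ut : u <= t by rewrite /u; lra.
have au : a <= u by lra.
have ub : u <= b by lra.
have sb : s <= b by lra.
have us : u - s = (t - s) / 2 by rewrite /u; lra.
have tu : t - u = (t - s) / 2 by rewrite /u; lra.
have ush : u - s <= h by lra.
have tuh : t - u <= h by lra.
have hsu := hC _ _ as_ su ub ush; have hut := hC _ _ au ut tb tuh.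
rewrite (davie_defect_split y as_ su ut tb).
have o1o : om (u - s) <= om (t - s) by apply: om_le.
have o1h : om (u - s) <= om h by apply: powR_al_le => //; lra.
have Co1 : C * om (u - s) <= 1 by apply: le_trans Ch; rewrite ler_wpM2l.
have o11 := om_le1 as_ su ub; have o10 := om_ge0 (u - s).
have L0 : 0 <= L by move: L1; lra.
(* One factor of the control absorbs [C]: the cubic bound becomes a quadratic one with constant
   1. *)
have hsu2 : `|Gam y s u| <= om (u - s) ^+ 2.
  apply: le_trans hsu _; rewrite exprS mulrA ler_piMl// exprn_ge0//.
have hv : `|y u - y s| <= 3 * L * om (t - s).
  have /(davie_increment as_ su ub (yD as_ sb)) : `|Gam y s u| <= 1 * om (u - s).
    by apply: le_trans hsu2 _; rewrite mul1r expr2 ler_piMl.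
  move=> /le_trans; apply; apply: ler_pM => //; by move: L1; lra.
have hr : `|Gam y s u| <= 1 * om (t - s) ^+ 2.
  by rewrite mul1r (le_trans hsu2)// lerXn2r ?nnegrE.
have := davie_remainder_bound as_ su ut tb (yD as_ sb) (yD au ub) _ hv ler01 hr.
have L30 : 0 <= 3 * L by lra.
move=> /(_ L30); set rem := (X in `|X| <= _) => hrem.
have := ler_normD (Gam y s u + Gam y u t) rem.
have := ler_normD (Gam y s u) (Gam y u t).
have : C * om (u - s) ^+ 3 + C * om (t - u) ^+ 3 = q * C * om (t - s) ^+ 3.
  have := powR_half al (_ : 0 <= t - s).
  rewrite subr_ge0 => /(_ st) /esym => hh.
  by rewrite us tu mulrAC -[q]/(halving_ratio al) hh; rewrite -/(om _); ring.
(* Here [M] is 3 * L and [N] is 1 in [davie_remainder_bound]; as 1 <= L, each lower power of L is at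
   most L ^ 2, and 9 + 1 + 1 + 3 = 14. *)
have : L * ((3 * L) ^+ 2 + L + 1 + 3 * L) * om (t - s) ^+ 3 <= 14 * L ^+ 3 * om (t - s) ^+ 3.
  rewrite ler_wpM2r ?exprn_ge0//.
  have -> : 14 * L ^+ 3 = L * (14 * L ^+ 2) by ring.
  by rewrite ler_wpM2l//; move: L1 => LL; nra.
move: hsu hut hrem; lra.
Qed.

Let bounded_defect_mono (h C h' C' : R) : h' <= h -> C <= C' ->
  bounded_defect h C -> bounded_defect h' C'.
Proof.
move=> hh CC hC s t as_ st tb th.
apply: le_trans (hC s t as_ st tb (le_trans th hh)) _.
by rewrite ler_wpM2r ?exprn_ge0.
Qed.

(** The constant [C] may be arbitrarily large. At a scale so small that even [C] is harmless,
    repeated doubling steps contract it to [davie_constant]; from there the scale is doubled up to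
    [h] while the constant, being a fixed point, stays. *)
Lemma davie_apriori (C h : R) :
  (forall s t, a <= s -> s <= t -> t <= b ->
     `|Gam y s t| <= C * om (t - s) ^+ 3) ->
  davie_constant * om h <= 1 ->
  forall s t, a <= s -> s <= t -> t <= b -> t - s <= h ->
    `|Gam y s t| <= davie_constant * om (t - s) ^+ 3.
Proof.
move=> hC Kh; set K := davie_constant in Kh *.
have K0 : 0 <= K := davie_constant_ge0.
have q0 : 0 < q := halving_ratio_gt0 al.
have q1 : q < 1 := halving_ratio_lt1 al_gt.
pose B := `|C|.
have KB : 0 < K + B + 1 by rewrite /B; have := normr_ge0 C; lra.
have [|h0 h00 hh0] := powR_al_small al_gt (e := (K + B + 1)^-1).
  by rewrite invr_gt0.
have N_h0 (N : R) : N <= K + B -> N * om h0 <= 1.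
  move=> NKB; have := hh0 _ (ltW h00) (lexx _); rewrite -/(om _) => ho.
  apply: (@le_trans _ _ ((K + B + 1) * (K + B + 1)^-1)); last by rewrite mulfV ?gt_eqF.
  apply: (@le_trans _ _ ((K + B + 1) * om h0)); first by rewrite ler_wpM2r//; lra.
  by rewrite ler_wpM2l// ltW.
have B0 : 0 <= B := normr_ge0 C.
(* All these constants are at most [K + B], so the choice of [h0] meets the smallness condition at
   every step. The gain in scale is discarded; only the contraction of the constant is kept. *)
have S1 n : bounded_defect h0 (K + q ^+ n * B).
  elim: n => [|n ih].
    move=> s t as_ st tb _; apply: le_trans (hC s t as_ st tb) _.
    by rewrite ler_wpM2r ?exprn_ge0// expr0 mul1r; have := ler_norm C; rewrite /B; lra.
  have qB : 0 <= q ^+ n * B by rewrite mulr_ge0// exprn_ge0// ltW.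
  have qBB : q ^+ n * B <= B by rewrite ler_piMl// exprn_ile1// ltW.
  have := bounded_defect_double _ (ltW h00) (N_h0 _ _) ih.
  move=> /(_ ltac:(lra) ltac:(lra)); apply: bounded_defect_mono; first by lra.
  have -> : q * (K + q ^+ n * B) + 14 * L ^+ 3 = (q * K + 14 * L ^+ 3) + q ^+ n.+1 * B.
    by rewrite (exprS q n); ring.
  by rewrite davie_constant_fix.
have S2 : bounded_defect h0 K.
  move=> s t as_ st tb th.
  apply: (@contraction_bound _ _ _ (B * om (t - s) ^+ 3) q) => //; first exact: ltW.
  by move=> n; have := S1 n s t as_ st tb th; rewrite mulrDl -mulrA.
move=> s t as_ st tb th; have h_ge0 : 0 <= h by lra.
(* Now the constant is kept and the scale grows; the minimum with [h] preserves the smallness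
   condition. *)
have S3 n : bounded_defect (Num.min h (h0 * 2 ^+ n)) K.
  elim: n => [|n ih].
    by apply: bounded_defect_mono S2 => //; rewrite expr0 mulr1 ge_min lexx orbT.
  have m0 : 0 <= Num.min h (h0 * 2 ^+ n) by rewrite le_min h_ge0 mulr_ge0 ?exprn_ge0// ltW.
  have := bounded_defect_double K0 m0 _ ih; rewrite davie_constant_fix.
  have Km : K * om (Num.min h (h0 * 2 ^+ n)) <= 1.
    by apply: le_trans Kh; rewrite ler_wpM2l// powR_al_le// ge_min lexx.
  move=> /(_ Km); apply: bounded_defect_mono => //.
  rewrite exprS mulrCA; case: (leP h (h0 * 2 ^+ n)) => hh.
    by rewrite ge_min; apply/orP; left; lra.
  by rewrite ge_min lexx orbT.
have [n hn] : exists n, h <= h0 * 2 ^+ n.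
  exists (Num.bound (h / h0)); rewrite -ler_pdivrMl// mulrC.
  apply: le_trans (ltW (archi_boundP _)) _; first by rewrite divr_ge0// ltW.
  by rewrite -natrX ler_nat ltnW// ltn_expl.
by apply: (S3 n) => //; rewrite le_min th (le_trans th).
Qed.

End APriori.

(** * Uniqueness on a short interval *)

Section Uniqueness.
Variables y y' : R -> E.
Hypothesis yD : forall s, a <= s -> s <= b -> D (y s).
Hypothesis yD' : forall s, a <= s -> s <= b -> D (y' s).
Hypothesis ab : a <= b.
Variable P : R.
Hypothesis P0 : 0 <= P.
Hypothesis hG : forall s t, a <= s -> s <= t -> t <= b ->
  `|Gam y s t| <= P * om (t - s) ^+ 3.
Hypothesis hG' : forall s t, a <= s -> s <= t -> t <= b ->
  `|Gam y' s t| <= P * om (t - s) ^+ 3.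
Hypothesis P_short : P * om (b - a) <= 1.
Hypothesis L_short : 120 * L ^+ 3 * om (b - a) <= 1 - q.

Let Del s := y s - y' s.
Let Dif s t := Gam y s t - Gam y' s t.

Let L0 : 0 <= L. Proof. by move: L1; lra. Qed.

Let diff_increment e N s t : a <= s -> s <= t -> t <= b -> 0 <= e ->
  `|Del s| <= e -> `|Dif s t| <= N * om (t - s) ^+ 3 ->
  `|Del t - Del s| <= 2 * L * e * om (t - s) + N * om (t - s) ^+ 3.
Proof.
move=> as_ st tb e0 es hD; have o1 := om_le1 as_ st tb; have o0 := om_ge0 (t - s).
have sb : s <= b by lra.
have := ds_A_lipschitz sys as_ st tb (yD as_ sb) (yD' as_ sb).
have := ds_B_lipschitz sys as_ st tb (yD as_ sb) (yD' as_ sb).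
rewrite -!/(om _) -!/(Del _).
have -> : Del t - Del s = (cA s t (y s) - cA s t (y' s)) + ((cB s t (y s) - cB s t (y' s)) + Dif s t).
  by rewrite /Del /Dif /Gam /davie_defect; zmod.
move: hD o1 o0; set o := om (t - s) => hD o1 o0 hB hA.
have := ler_normD (cA s t (y s) - cA s t (y' s)) ((cB s t (y s) - cB s t (y' s)) + Dif s t).
have := ler_normD (cB s t (y s) - cB s t (y' s)) (Dif s t).
have hA' : L * o * `|Del s| <= L * o * e by rewrite ler_wpM2l ?mulr_ge0.
have hB' : L * o ^+ 2 * `|Del s| <= L * o * e.
  apply: ler_pM; rewrite ?mulr_ge0 ?exprn_ge0// ler_wpM2l// expr2 ler_piMl//.
lra.
Qed.

Let om_ab s t : a <= s -> s <= t -> t <= b -> om (t - s) <= om (b - a).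
Proof. by move=> *; apply: om_le. Qed.

(** As [P * om (b - a) <= 1], one factor of the control absorbs [P], and the increments are bounded
    in terms of [L] alone. *)
Let rough_increment s t (z : R -> E) (zD : forall s, a <= s -> s <= b -> D (z s))
  (hz : forall s t, a <= s -> s <= t -> t <= b ->
     `|Gam z s t| <= P * om (t - s) ^+ 3) :
  a <= s -> s <= t -> t <= b ->
  `|Gam z s t| <= om (t - s) ^+ 2 /\ `|z t - z s| <= 3 * L * om (t - s).
Proof.
move=> as_ st tb; have o1 := om_le1 as_ st tb; have o0 := om_ge0 (t - s).
have g2 : `|Gam z s t| <= om (t - s) ^+ 2.
  apply: le_trans (hz _ _ as_ st tb) _; rewrite exprS mulrA ler_piMl ?exprn_ge0//.
  by apply: le_trans P_short; rewrite ler_wpM2l// om_ab.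
split=> //; have /(davie_increment as_ st tb) : `|Gam z s t| <= 1 * om (t - s).
  by apply: le_trans g2 _; rewrite mul1r expr2 ler_piMl.
move=> /(_ (zD _ as_ (le_trans st tb))) /le_trans; apply.
by rewrite ler_wpM2r//; move: L1; lra.
Qed.

(** The difference of two instances of [davie_defect_split]. The terms proportional to [e] add up to
    (21 L^3 + 8 L^2) e, those proportional to [N] to (6 L^2 + 2 L) N and carry an extra power of the
    control. *)
Let diff_split e N s u t : a <= s -> s <= u -> u <= t -> t <= b -> 0 <= e -> 0 <= N ->
  `|Del s| <= e -> `|Dif s u| <= N * om (t - s) ^+ 3 ->
  `|Del u - Del s| <= 2 * L * e * om (t - s) + N * om (t - s) ^+ 3 ->
  `|Dif s t - (Dif s u + Dif u t)| <=
    29 * L ^+ 3 * e * om (t - s) ^+ 3 + 8 * L ^+ 2 * N * om (t - s) ^+ 4.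
Proof.
move=> as_ su ut tb e0 N0 es hD hdel.
have au : a <= u by lra.
have ub : u <= b by lra.
have st : s <= t by lra.
have sb : s <= b by lra.
have o0 := om_ge0 (t - s); have o20 := om_ge0 (t - u); have o10 := om_ge0 (u - s).
have o1 := om_le1 as_ st tb.
have o2o : om (t - u) <= om (t - s) by apply: om_le.
have o1o : om (u - s) <= om (t - s) by apply: om_le.
have [g v] := rough_increment yD hG as_ su ub.
have [g' v'] := rough_increment yD' hG' as_ su ub.
have ys := yD as_ sb; have ys' := yD' as_ sb; have yu := yD au ub; have yu' := yD' au ub.
have TA := ds_A_taylor sys au ut tb ys yu ys' yu'.
have TB := ds_B_taylor sys au ut tb ys yu ys' yu'.
have dv : (y u - y s) - (y' u - y' s) = Del u - Del s by rewrite /Del; zmod.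
rewrite dv -!/(om _) -/(Del s) in TA TB.
(* The increments of [y] and [y'] over [s, u] beyond first order. *)
pose r := cB s u (y s) + Gam y s u; pose r' := cB s u (y' s) + Gam y' s u.
have Gl := ds_G_lipschitz sys r au ut tb ys ys'.
have Gb := ds_G_bound sys (r - r') au ut tb ys'.
have Bb := ds_B_bound sys as_ su ub ys.
have Bl := ds_B_lipschitz sys as_ su ub ys ys'.
rewrite -!/(om _) -?/(Del s) in Gl Gb Bb Bl.
move: hD hdel o2o o1o o1 g v g' v' TA TB Gl Gb Bb Bl o0 o10 o20.
set o := om (t - s); set o1 := om (u - s); set o2 := om (t - u).
move=> hD hdel o2o o1o ole1 g v g' v' TA TB Gl Gb Bb Bl o0 o10 o20.
have o1sq : o1 ^+ 2 <= o ^+ 2 by rewrite lerXn2r ?nnegrE.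
have o2sq : o2 ^+ 2 <= o ^+ 2 by rewrite lerXn2r ?nnegrE.
have vb : `|y u - y s| <= 3 * L * o by apply: le_trans v _; rewrite ler_wpM2l ?mulr_ge0.
have vb' : `|y' u - y' s| <= 3 * L * o by apply: le_trans v' _; rewrite ler_wpM2l ?mulr_ge0.
have rb : `|r| <= 2 * L * o ^+ 2.
  apply: le_trans (ler_normD _ _) _.
  have : L * o1 ^+ 2 <= L * o ^+ 2 by rewrite ler_wpM2l.
  have : 1 * o ^+ 2 <= L * o ^+ 2 by rewrite ler_wpM2r ?exprn_ge0.
  by move: Bb g; lra.
have rrb : `|r - r'| <= L * o ^+ 2 * e + N * o ^+ 3.
  have -> : r - r' = (cB s u (y s) - cB s u (y' s)) + Dif s u by rewrite /r /r' /Dif; zmod.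
  apply: le_trans (ler_normD _ _) _; apply: lerD => //.
  by apply: le_trans Bl _; apply: ler_pM; rewrite ?mulr_ge0 ?exprn_ge0// ler_wpM2l.
have e1 : L * o2 * (`|Del s| * `|y u - y s| ^+ 2 + `|Del u - Del s| * (`|y u - y s| + `|y' u - y' s|)) <=
   L * o * (e * (3 * L * o) ^+ 2 + (2 * L * e * o + N * o ^+ 3) * (3 * L * o + 3 * L * o)).
  apply: ler_pM; rewrite ?mulr_ge0 ?addr_ge0 ?mulr_ge0 ?addr_ge0 ?exprn_ge0 ?ler_wpM2l//.
  apply: lerD; apply: ler_pM; rewrite ?addr_ge0 ?exprn_ge0 ?lerD// lerXn2r ?nnegrE//.
  by rewrite ?mulr_ge0.
have e2 : L * o2 ^+ 2 * (`|Del u - Del s| + `|Del s| * `|y u - y s|) <=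
   L * o ^+ 2 * ((2 * L * e * o + N * o ^+ 3) + e * (3 * L * o)).
  apply: ler_pM; rewrite ?mulr_ge0 ?addr_ge0 ?mulr_ge0 ?exprn_ge0 ?ler_wpM2l//.
  by apply: lerD => //; apply: ler_pM.
have e3 : L * o2 * (`|Del s| * `|r|) <= L * o * (e * (2 * L * o ^+ 2)).
  by apply: ler_pM; rewrite ?mulr_ge0 ?ler_wpM2l//; apply: ler_pM.
have e4 : L * o2 * `|r - r'| <= L * o * (L * o ^+ 2 * e + N * o ^+ 3).
  by apply: ler_pM; rewrite ?mulr_ge0 ?ler_wpM2l.
have : Dif s t - (Dif s u + Dif u t) =
  ((cA u t (y u) - cA u t (y s) - cG u t (y s) (y u - y s))
    - (cA u t (y' u) - cA u t (y' s) - cG u t (y' s) (y' u - y' s)))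
  + ((cG u t (y s) r - cG u t (y' s) r) + cG u t (y' s) (r - r'))
  + ((cB u t (y u) - cB u t (y s)) - (cB u t (y' u) - cB u t (y' s))).
  rewrite {1}/Dif (davie_defect_split y as_ su ut tb) (davie_defect_split y' as_ su ut tb).
  by rewrite (cGB u t (y' s) r r') /Dif /r /r'; zmod.
set X1 := (X in _ = X + _ + _ -> _); set X2 := (X in _ = _ + (X + _) + _ -> _).
set X3 := (X in _ = _ + (_ + X) + _ -> _); set X4 := (X in _ = _ + _ + X -> _) => ->.
have := ler_normD (X1 + (X2 + X3)) X4; have := ler_normD X1 (X2 + X3).
have := ler_normD X2 X3.
have o34 : o ^+ 4 <= o ^+ 3 by rewrite exprS ler_piMl ?exprn_ge0.
have o35 : o ^+ 5 <= o ^+ 4 by rewrite exprS ler_piMl ?exprn_ge0.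
have LL : L <= L ^+ 2 by rewrite expr2 ler_peMl.
have LLL : L ^+ 2 <= L ^+ 3 by rewrite [leRHS]exprS ler_peMl ?exprn_ge0.
have f1 : 8 * L ^+ 2 * (e * o ^+ 3) <= 8 * L ^+ 3 * (e * o ^+ 3).
  by rewrite ler_wpM2r ?mulr_ge0 ?exprn_ge0//; lra.
have f2 : 6 * L ^+ 2 * (N * o ^+ 5) <= 6 * L ^+ 2 * (N * o ^+ 4).
  by rewrite ler_wpM2l ?mulr_ge0 ?exprn_ge0// ler_wpM2l.
have f3 : L * (N * o ^+ 5) <= L ^+ 2 * (N * o ^+ 4).
  by apply: ler_pM; rewrite ?mulr_ge0 ?exprn_ge0// ler_wpM2l.
have f4 : L * (N * o ^+ 4) <= L ^+ 2 * (N * o ^+ 4).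
  by rewrite ler_wpM2r ?mulr_ge0 ?exprn_ge0.
move: TA TB Gl Gb e1 e2 e3 e4 f1 f2 f3 f4; rewrite -/X1 -/X2 -/X3 -/X4; lra.
Qed.

(** A uniform bound [e] on the distance of the paths controls the difference of their defects, by
    halving as in the a priori bound. The starting constant is 2 * P, one [P] for each path. *)
Let unif_Del e : 0 <= e -> (forall s, a <= s -> s <= b -> `|Del s| <= e) ->
  forall s t, a <= s -> s <= t -> t <= b ->
  `|Dif s t| <= 58 * L ^+ 3 * e / (1 - q) * om (t - s) ^+ 3.
Proof.
move=> e0 he s t as_ st tb.
have q0 : 0 < q := halving_ratio_gt0 al.
have q1 : q < 1 := halving_ratio_lt1 al_gt.
set K := 58 * L ^+ 3 * e / (1 - q).
have K0 : 0 <= K by rewrite /K divr_ge0 ?mulr_ge0 ?exprn_ge0//; lra.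
(* Half of the gap between q and 1 is given away to absorb the term of fourth order of [diff_split];
   this turns 29 into 58 in the fixed point. *)
pose q' := (1 + q) / 2.
have Kfix : q' * K + 29 * L ^+ 3 * e = K.
  by rewrite /K /q'; field; rewrite subr_eq0 gt_eqF.
have : forall n s t, a <= s -> s <= t -> t <= b ->
  `|Dif s t| <= (K + q' ^+ n * (2 * P)) * om (t - s) ^+ 3.
  elim=> {as_ st tb}[|n ih] {}s {}t as_ st tb.
    rewrite expr0 mul1r mulrDl; have := hG as_ st tb; have := hG' as_ st tb.
    have : 0 <= K * om (t - s) ^+ 3 by rewrite mulr_ge0 ?exprn_ge0.
    by have := ler_normB (Gam y s t) (Gam y' s t); rewrite -/(Dif s t); lra.
  set N := K + q' ^+ n * (2 * P) in ih.
  have q'0 : 0 <= q' by rewrite /q'; lra.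
  have N0 : 0 <= N by apply: addr_ge0 => //; rewrite !mulr_ge0 ?exprn_ge0.
  set u := (s + t) / 2.
  have su : s <= u by rewrite /u; lra.
  have ut : u <= t by rewrite /u; lra.
  have au : a <= u by lra.
  have ub : u <= b by lra.
  have sb : s <= b by lra.
  have us : u - s = (t - s) / 2 by rewrite /u; lra.
  have tu : t - u = (t - s) / 2 by rewrite /u; lra.
  have hsu := ih _ _ as_ su ub; have hut := ih _ _ au ut tb.
  have o0 := om_ge0 (t - s); have o10 := om_ge0 (u - s).
  have o1o : om (u - s) <= om (t - s) by apply: om_le.
  have o13 : om (u - s) ^+ 3 <= om (t - s) ^+ 3 by rewrite lerXn2r ?nnegrE.
  have hsu' : `|Dif s u| <= N * om (t - s) ^+ 3.
    by apply: le_trans hsu _; rewrite ler_wpM2l.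
  have hdel : `|Del u - Del s| <= 2 * L * e * om (t - s) + N * om (t - s) ^+ 3.
    apply: le_trans (diff_increment as_ su ub e0 (he _ as_ sb) hsu) _.
    by apply: lerD; rewrite ler_wpM2l ?mulr_ge0.
  have := diff_split as_ su ut tb e0 N0 (he _ as_ sb) hsu' hdel.
  have hh : N * om (u - s) ^+ 3 + N * om (t - u) ^+ 3 = q * N * om (t - s) ^+ 3.
    have := powR_half al (_ : 0 <= t - s).
    rewrite subr_ge0 => /(_ st) /esym => hh.
    by rewrite us tu mulrAC -[q]/(halving_ratio al) hh; rewrite -/(om _); ring.
  have small : 8 * L ^+ 2 * N * om (t - s) ^+ 4 <= (1 - q) / 2 * N * om (t - s) ^+ 3.
    have := L_short; have oab := om_ab as_ st tb.
    have LL : L ^+ 2 <= L ^+ 3 by rewrite [leRHS]exprS ler_peMl ?exprn_ge0.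
    have : L ^+ 2 * om (t - s) <= L ^+ 3 * om (b - a).
      by apply: ler_pM; rewrite ?exprn_ge0.
    have h0 : 0 <= L ^+ 3 * om (b - a) by rewrite mulr_ge0 ?exprn_ge0.
    move=> h1 h2; have h3 : 8 * (L ^+ 2 * om (t - s)) <= (1 - q) / 2 by lra.
    have := @ler_wpM2l _ (N * om (t - s) ^+ 3) _ _ _ h3.
    by rewrite mulr_ge0 ?exprn_ge0// => /(_ isT); lra.
  have := ler_normD (Dif s t - (Dif s u + Dif u t)) (Dif s u + Dif u t).
  rewrite subrK.
  have := ler_normD (Dif s u) (Dif u t).
  have -> : (K + q' ^+ n.+1 * (2 * P)) = q' * N + 29 * L ^+ 3 * e.
    by rewrite exprS -[X in X + _ = _]Kfix /N; ring.
  have -> : (q' * N + 29 * L ^+ 3 * e) * om (t - s) ^+ 3 = q * N * om (t - s) ^+ 3 + (1 - q) / 2 * N * om (t - s) ^+ 3 + 29 * L ^+ 3 * e * om (t - s) ^+ 3.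
    by rewrite /q'; field.
  lra.
move=> hn.
apply: (@contraction_bound _ _ _ (2 * P * om (t - s) ^+ 3) q'); rewrite /q'; [lra|lra|].
by move=> n; have := hn n s t as_ st tb; rewrite mulrDl -mulrA.
Qed.

(** If the paths are within [e] of each other, they are within [e / 2]: the increment of their
    difference is at most (2 + 58) L^3 e om(b - a) / (1 - q), and 120 = 2 * 60 in [L_short] makes
    this at most e / 2. The initial bound 6 * L comes from two increments of at most 3 * L. *)
Lemma davie_unique : y a = y' a -> forall t, a <= t -> t <= b -> y t = y' t.
Proof.
move=> yya.
have q0 : 0 < q := halving_ratio_gt0 al.
have q1 : q < 1 := halving_ratio_lt1 al_gt.
have Da : Del a = 0 by rewrite /Del yya subrr.
have oab1 := om_le1 (lexx a) ab (lexx b).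
have H n : forall t, a <= t -> t <= b -> `|Del t| <= 2^-1 ^+ n * (6 * L).
  elim: n => [|n ih] t at_ tb.
    rewrite expr0 mul1r.
    have [_ v] := rough_increment yD hG (lexx a) at_ tb.
    have [_ v'] := rough_increment yD' hG' (lexx a) at_ tb.
    have -> : Del t = (y t - y a) - (y' t - y' a) by rewrite /Del yya; zmod.
    apply: le_trans (ler_normB _ _) _.
    have : 3 * L * om (t - a) <= 3 * L * 1.
      by rewrite ler_wpM2l ?mulr_ge0// om_le1.
    lra.
  set e := _ * (6 * L) in ih.
  have e0 : 0 <= e by rewrite /e mulr_ge0 ?mulr_ge0 ?exprn_ge0 ?invr_ge0.
  have := diff_increment (lexx a) at_ tb e0 _ (unif_Del e0 ih (lexx a) at_ tb).
  rewrite Da normr0 subr0 => /(_ e0) /le_trans; apply.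
  have -> : 2^-1 ^+ n.+1 * (6 * L) = 2^-1 * e by rewrite /e [2^-1 ^+ n.+1]exprS -mulrA.
  have o0 := om_ge0 (t - a).
  have o1 := om_le1 (lexx a) at_ tb.
  have o3 : om (t - a) ^+ 3 <= om (t - a) by rewrite exprS ler_piMr// exprn_ile1.
  have oab := om_ab (lexx a) at_ tb.
  have L31 : L <= L ^+ 3 by rewrite exprS ler_peMr// exprn_ege1.
  have qi : 1 <= (1 - q)^-1 by rewrite -invr1 lef_pV2 ?posrE//; lra.
  set Q := (1 - q)^-1 in qi *.
  have Q0 : 0 <= Q by lra.
  have L30 : 0 <= L ^+ 3 by rewrite exprn_ge0.
  have h1 : 2 * L * e * om (t - a) <= 2 * (L ^+ 3 * Q) * e * om (b - a).
    apply: ler_pM; rewrite ?mulr_ge0// ler_wpM2r// ler_wpM2l//.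
    by apply: le_trans L31 _; rewrite ler_peMr.
  have h2 : 58 * L ^+ 3 * e * Q * om (t - a) ^+ 3 <= 58 * (L ^+ 3 * Q) * e * om (b - a).
    have -> : 58 * (L ^+ 3 * Q) * e = 58 * L ^+ 3 * e * Q by ring.
    by rewrite ler_wpM2l ?mulr_ge0// (le_trans o3).
  have h3 : 120 * (L ^+ 3 * Q) * om (b - a) <= 1.
    have -> : 120 * (L ^+ 3 * Q) * om (b - a) = (120 * L ^+ 3 * om (b - a)) / (1 - q) by rewrite /Q; ring.
    by rewrite ler_pdivrMr ?mul1r//; lra.
  have := ler_wpM2r e0 h3; lra.
move=> t at_ tb; apply/eqP; rewrite -subr_eq0 -normr_le0.
apply: (@contraction_bound _ _ _ (6 * L) 2^-1); [by []|lra|].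
by move=> n; rewrite add0r; exact: H.
Qed.

End Uniqueness.

(** The same expansion read backwards, from the right end point. Moving the base point of [cA] from
    [y u] to [y v] costs [cG] applied to the increment, so the second order term of the reversed
    expansion is [cG (cA) - cB]. *)
Lemma davie_reverse (y : R -> E) C :
  (forall s, a <= s -> s <= b -> D (y s)) ->
  (forall s t, a <= s -> s <= t -> t <= b ->
    `|Gam y s t| <= C * om (t - s) ^+ 3) ->
  exists C', forall u v, a <= u -> u <= v -> v <= b ->
    `|y u - y v + cA u v (y v) - (cG u v (y v) (cA u v (y v)) - cB u v (y v))|
      <= C' * om (v - u) ^+ 3.
Proof.
move=> yD hC; pose N := `|C|; pose M := 2 * L + N.
(* The defect gives N, the remainder terms of the forward expansion the second summand, and the last
   two come from moving the base point of [cG] and of its argument. *)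
exists (N + L * (M ^+ 2 + L + N + M) + L * M * L + L * (L * M)) => u v au uv vb.
have L0 : 0 <= L by move: L1; lra.
have N0 : 0 <= N := normr_ge0 C.
have M0 : 0 <= M by rewrite /M; lra.
have ub : u <= b by lra.
have av : a <= v by lra.
have o0 := om_ge0 (v - u); have o1 := om_le1 au uv vb.
have hN : `|Gam y u v| <= N * om (v - u) ^+ 3.
  by apply: le_trans (hC _ _ au uv vb) _; rewrite ler_wpM2r ?exprn_ge0// ler_norm.
have hN2 : `|Gam y u v| <= N * om (v - u) ^+ 2.
  by apply: le_trans hN _; rewrite ler_wpM2l// exprS ler_piMl// exprn_ge0.
have hN1 : `|Gam y u v| <= N * om (v - u).
  by apply: le_trans hN2 _; rewrite ler_wpM2l// expr2 ler_piMl.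
have yu := yD _ au ub; have yv := yD _ av vb.
have hM := davie_increment au uv vb yu hN1; rewrite -/M in hM.
have TA := ds_A_taylor sys au uv vb yu yv yu yu.
rewrite !subrr cG0 !subr0 normr0 mul0r add0r addr0 in TA.
have Gb := ds_G_bound sys (cB u v (y u) + Gam y u v) au uv vb yu.
have Bb := ds_B_bound sys au uv vb yu.
have Ab := ds_A_bound sys au uv vb yu.
have Al := ds_A_lipschitz sys au uv vb yu yv.
have Bl := ds_B_lipschitz sys au uv vb yv yu.
have Gl := ds_G_lipschitz sys (cA u v (y u)) au uv vb yu yv.
have Gb' := ds_G_bound sys (cA u v (y u) - cA u v (y v)) au uv vb yv.
rewrite (distrC (y u)) in Al Gl.
move: hN hN2 hM TA Gb Bb Ab Al Bl Gl Gb'; rewrite -!/(om _).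
move: o0 o1; set o := om (v - u); move=> o0 o1 hN hN2 hM TA Gb Bb Ab Al Bl Gl Gb'.
have -> : y u - y v + cA u v (y v) - (cG u v (y v) (cA u v (y v)) - cB u v (y v)) =
  - Gam y u v + (cA u v (y v) - cA u v (y u) - cG u v (y u) (y v - y u))
  + cG u v (y u) (cB u v (y u) + Gam y u v)
  + ((cG u v (y u) (cA u v (y u)) - cG u v (y v) (cA u v (y u)))
      + cG u v (y v) (cA u v (y u) - cA u v (y v)))
  + (cB u v (y v) - cB u v (y u)).
  have -> : cG u v (y u) (y v - y u) = cG u v (y u) (cA u v (y u)) + cG u v (y u) (cB u v (y u) + Gam y u v).
    by rewrite -(ds_G_additive sys); congr cG; rewrite /Gam /davie_defect; zmod.
  by rewrite (cGB _ _ _ (cA u v (y u))) /Gam /davie_defect; zmod.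
have e1 : L * o * (`|y v - y u| * `|y v - y u|) <= L * o * (M * o * (M * o)).
  by rewrite ler_wpM2l ?mulr_ge0// ler_pM.
have e2 : L * o * `|cB u v (y u) + Gam y u v| <= L * o * (L * o ^+ 2 + N * o ^+ 2).
  by rewrite ler_wpM2l ?mulr_ge0// (le_trans (ler_normD _ _))// lerD.
have e3 : L * o * (`|y v - y u| * `|cA u v (y u)|) <= L * o * (M * o * (L * o)).
  by rewrite ler_wpM2l ?mulr_ge0// ler_pM.
have e4 : L * o * `|cA u v (y u) - cA u v (y v)| <= L * o * (L * o * (M * o)).
  rewrite ler_wpM2l ?mulr_ge0//; apply: le_trans Al _.
  by rewrite ler_wpM2l ?mulr_ge0.
have e5 : L * o ^+ 2 * `|y v - y u| <= L * o ^+ 2 * (M * o).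
  by rewrite ler_wpM2l ?mulr_ge0 ?exprn_ge0.
set X2 := cA u v (y v) - cA u v (y u) - _; set X3 := cG u v (y u) (_ + _).
set X4 := cG u v (y u) _ - _; set X5 := cG u v (y v) (_ - _); set X6 := cB u v (y v) - _.
have := ler_normD (- Gam y u v + X2 + X3 + (X4 + X5)) X6.
have := ler_normD (- Gam y u v + X2 + X3) (X4 + X5).
have := ler_normD (- Gam y u v + X2) X3; have := ler_normD (- Gam y u v) X2.
rewrite normrN; have := ler_normD X4 X5.
move: hN TA Gb Bl Gl Gb' e1 e2 e3 e4 e5; rewrite -/X2 -/X3 -/X4 -/X5 -/X6; lra.
Qed.

End DavieSystem.

(** * Leafwise calculus *)

Lemma coord_le_norm {R : realType} {m n : nat} (v : 'M[R]_(m, n)) i j : `|v i j| <= `|v|.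
Proof.
rewrite [leRHS]/Num.Def.normr/= mx_normrE.
exact: (le_bigmax _ (fun ij : 'I_m * 'I_n => `|v ij.1 ij.2|) (i, j)).
Qed.

Lemma norm_le_coord {R : realType} {m n : nat} (v : 'M[R]_(m, n)) (c : R) :
  0 <= c -> (forall i j, `|v i j| <= c) -> `|v| <= c.
Proof.
move=> c0 h; rewrite [leLHS]/Num.Def.normr/= mx_normrE.
by apply: bigmax_le => // -[i j] _; exact: h.
Qed.

Lemma continuous_pair {X Y Z : topologicalType} (f : X -> Y) (g : X -> Z) x :
  {for x, continuous f} -> {for x, continuous g} ->
  {for x, continuous (fun x => (f x, g x))}.
Proof.
move=> cf cg A [[B C] /= [nB nC] sub]; have nB' := cf _ nB; have nC' := cg _ nC.
by near=> y; apply: sub; split => /=; [near: y; exact: nB'|near: y; exact: nC'].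
Unshelve. all: by end_near. Qed.

Lemma cvg_fin_sum {R : realType} {T : Type} {F : set_system T} {FF : Filter F}
    (I : finType) (V : normedModType R) (f : I -> T -> V) (l : I -> V) :
  (forall i, f i x @[x --> F] --> l i) -> \sum_i f i x @[x --> F] --> \sum_i l i.
Proof.
move=> fl; rewrite /index_enum; elim: (Finite.enum I) => [|i s ih].
  rewrite big_nil (_ : (fun x => \sum_(i <- [::]) f i x) = cst 0); first exact: cvg_cst.
  by apply/funext => x; rewrite big_nil.
rewrite big_cons (_ : (fun x => \sum_(i <- i :: s) f i x) = (fun x => f i x + \sum_(i <- s) f i x)).
  exact: cvgD.
by apply/funext => x; rewrite big_cons.
Qed.

(** * Functions of class C_L^k: closure properties and the chain rule along a leaf *)

Section ContinuousLeafwise.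
Context {R : realType} {p : nat} {W : topologicalType}.
Implicit Types (U N : set ('rV[R]_p * W)) (q : 'rV[R]_p * W).

Lemma within_openP {V : topologicalType} U (f : 'rV[R]_p * W -> V) : open U ->
  {within U, continuous f} <-> (forall q, U q -> {for q, continuous f}).
Proof.
by move=> oU; rewrite continuous_open_subspace// in_setP.
Qed.

(** Derivatives in the first variable see only the slice through [q]; this transfers openness from
    the product to the slice. *)
Lemma slice_near U q : open U -> U q -> \forall y \near q.1, U (y, q.2).
Proof.
move=> oU Uq; have : nbhs q U by exact: open_nbhs_nbhs.
case: q Uq => y z Uq /= -[[A B] /= [nA nB] sub].
by near=> x; apply: sub; split => /=; [near: x; exact: nA|exact: nbhs_singleton].
Unshelve. all: by end_near. Qed.

Lemma slice_continuous {V : topologicalType} (f : 'rV[R]_p * W -> V) q :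
  {for q, continuous f} -> {for q.1, continuous (fun y => f (y, q.2))}.
Proof.
case: q => y z cf; apply: (@continuous_comp _ _ _ (fun y => (y, z)) f) => //.
rewrite /prop_for /continuous_at /=.
move=> A [[B C] /= [nB nC] sub]; apply: filterS nB => x Bx.
by apply: sub; split => //; exact: nbhs_singleton.
Qed.

Lemma pder_near_eq {V : normedModType R} U (f g : 'rV[R]_p * W -> V) i q :
  open U -> (forall r, U r -> f r = g r) -> U q -> pder i f q = pder i g q.
Proof.
move=> oU fg Uq; apply: near_eq_derive.
by apply: filterS (slice_near oU Uq) => y; exact: fg.
Qed.

Lemma pder_derivable_near_eq {V : normedModType R} U (f g : 'rV[R]_p * W -> V) i q :
  open U -> (forall r, U r -> f r = g r) -> U q ->
  derivable (fun y => f (y, q.2)) q.1 (delta_mx 0 i) ->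
  derivable (fun y => g (y, q.2)) q.1 (delta_mx 0 i).
Proof.
move=> oU fg Uq; apply: near_eq_derivable.
by apply: filterS (slice_near oU Uq) => y; exact: fg.
Qed.

Lemma CL_continuous {V : normedModType R} k U (f : 'rV[R]_p * W -> V) q :
  open U -> CL k U f -> U q -> {for q, continuous f}.
Proof.
by case: k => [|k] oU [/(within_openP _ oU) + _]; exact.
Qed.

Lemma CL_sub {V : normedModType R} k U N (f : 'rV[R]_p * W -> V) :
  N `<=` U -> CL k U f -> CL k N f.
Proof.
move=> NU; elim: k f => [|k ih] f [cf df]; split=> //;
  try exact: (continuous_subspaceW NU).
move=> i; have [d1 d2] := df i; split; last exact: ih.
by move=> q /NU; exact: d1.
Qed.

Lemma CL_local {V : normedModType R} k U (f : 'rV[R]_p * W -> V) : open U ->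
  (forall q, U q -> exists N, [/\ open N, N q & CL k N f]) -> CL k U f.
Proof.
move=> oU; elim: k f => [|k ih] f h; split=> //.
- by apply/(within_openP _ oU) => q /h[N [oN Nq]] /CL_continuous; exact.
- by apply/(within_openP _ oU) => q /h[N [oN Nq]] /CL_continuous; exact.
- move=> i; split=> [q /h[N [oN Nq [_ /(_ i)[+ _]]]]|]; first exact.
  apply: ih => q /h[N [oN Nq [_ /(_ i)[_ cN]]]].
  by exists N.
Qed.

Lemma CL_eq {V : normedModType R} k U (f g : 'rV[R]_p * W -> V) : open U ->
  (forall q, U q -> f q = g q) -> CL k U f -> CL k U g.
Proof.
move=> oU; elim: k f g => [|k ih] f g fg [cf df].
  split=> //; apply/(within_openP _ oU) => q Uq.
  have /(within_openP _ oU)/(_ q Uq) := cf.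
  rewrite /prop_for /continuous_at -fg//; apply: cvg_trans.
  apply: near_eq_cvg; have := open_nbhs_nbhs (conj oU Uq).
  by apply: filterS => r /fg ->.
split.
  apply/(within_openP _ oU) => q Uq.
  have /(within_openP _ oU)/(_ q Uq) := cf.
  rewrite /prop_for /continuous_at -fg//; apply: cvg_trans.
  apply: near_eq_cvg; have := open_nbhs_nbhs (conj oU Uq).
  by apply: filterS => r /fg ->.
move=> i; have [d1 d2] := df i; split=> [q Uq|].
  by apply: (pder_derivable_near_eq oU fg Uq); exact: d1.
by apply: ih d2 => q Uq; exact: (pder_near_eq _ oU fg).
Qed.

Lemma CL_pred {V : normedModType R} k U (f : 'rV[R]_p * W -> V) :
  CL k.+1 U f -> CL k U f.
Proof.
elim: k f => [|k ih] f [cf df]; split=> // i.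
by have [d1 d2] := df i; split=> //; exact: ih.
Qed.

Lemma CL_le {V : normedModType R} k k' U (f : 'rV[R]_p * W -> V) :
  (k <= k')%N -> CL k' U f -> CL k U f.
Proof.
by move=> /subnK <-; elim: (k' - k)%N => // n ih /CL_pred.
Qed.

Lemma CL_pder {V : normedModType R} k U (f : 'rV[R]_p * W -> V) i :
  CL k.+1 U f -> CL k U (pder i f).
Proof. by move=> [_ /(_ i)[]]. Qed.

Lemma CL_derivable {V : normedModType R} k U (f : 'rV[R]_p * W -> V) i q :
  CL k.+1 U f -> U q -> derivable (fun y => f (y, q.2)) q.1 (delta_mx 0 i).
Proof. by move=> [_ /(_ i)[+ _]]; exact. Qed.

Lemma CL_intro {V : normedModType R} k U (f : 'rV[R]_p * W -> V) : open U ->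
  (forall q, U q -> {for q, continuous f}) ->
  (forall i q, U q -> derivable (fun y => f (y, q.2)) q.1 (delta_mx 0 i)) ->
  (forall i, CL k U (pder i f)) -> CL k.+1 U f.
Proof.
move=> oU cf df dk; split; first exact/(within_openP _ oU).
by move=> i; split=> // q; exact: df.
Qed.

(** Continuity in the transverse variable suffices for every k, as all leafwise derivatives vanish.
    This is the source of transverse test functions and cutoffs. *)
Lemma CL_leaf_constant {V : normedModType R} k U (h : W -> V) : open U ->
  (forall q, U q -> {for q.2, continuous h}) -> CL k U (fun q => h q.2).
Proof.
move=> oU ch.
have cU q : U q -> {for q, continuous (fun q : 'rV[R]_p * W => h q.2)}.
  by move=> /ch; apply: continuous_comp; exact: cvg_snd.
have d0 i : pder i (fun q : 'rV[R]_p * W => h q.2) = cst 0.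
  by apply/funext => q; rewrite /pder /= derive_cst.
case: k => [|k]; first by split=> //; exact/(within_openP _ oU).
apply: CL_intro => // [i q _|i]; first exact: (derivable_cst (h q.2)).
rewrite d0.
elim: k => [|k ih]; first by split=> //; apply/(within_openP _ oU) => q _; exact: cvg_cst.
apply: CL_intro => // [q _|i' q _|]; [exact: cvg_cst|exact: derivable_cst|].
by move=> j; rewrite (_ : pder _ _ = cst 0)//; apply/funext => q; rewrite /pder derive_cst.
Qed.

Lemma CL_cst {V : normedModType R} k U (c : V) : open U -> CL k U (fun=> c).
Proof. by move=> oU; apply: (@CL_leaf_constant _ k U (fun=> c)) => // q _; exact: cvg_cst. Qed.

Lemma CL_add {V : normedModType R} k U (f g : 'rV[R]_p * W -> V) : open U ->
  CL k U f -> CL k U g -> CL k U (fun q => f q + g q).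
Proof.
move=> oU; elim: k f g => [|k ih] f g cf cg.
  split=> //; apply/(within_openP _ oU) => q Uq.
  by apply: cvgD; [exact: (CL_continuous oU cf)|exact: (CL_continuous oU cg)].
apply: CL_intro => // [q Uq|i q Uq|i].
- by apply: cvgD; [exact: (CL_continuous oU cf)|exact: (CL_continuous oU cg)].
- by apply: derivableD; [exact: (CL_derivable cf Uq)|exact: (CL_derivable cg Uq)].
- apply: (@CL_eq _ _ _ (fun q => pder i f q + pder i g q)) => // [q Uq|].
    by rewrite /pder deriveD//; [exact: (CL_derivable cf Uq)|exact: (CL_derivable cg Uq)].
  by apply: ih; exact: CL_pder.
Qed.

Lemma CL_mul k U (f g : 'rV[R]_p * W -> R) : open U ->
  CL k U f -> CL k U g -> CL k U (fun q => f q * g q).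
Proof.
move=> oU; elim: k f g => [|k ih] f g cf cg.
  split=> //; apply/(within_openP _ oU) => q Uq.
  by apply: cvgM; [exact: (CL_continuous oU cf)|exact: (CL_continuous oU cg)].
apply: CL_intro => // [q Uq|i q Uq|i].
- by apply: cvgM; [exact: (CL_continuous oU cf)|exact: (CL_continuous oU cg)].
- by apply: derivableM; [exact: (CL_derivable cf Uq)|exact: (CL_derivable cg Uq)].
- apply: (@CL_eq _ _ _ (fun q => f q * pder i g q + g q * pder i f q)) => // [q Uq|].
    rewrite /pder deriveM//; [|exact: (CL_derivable cf Uq)|exact: (CL_derivable cg Uq)].
    by case: q {Uq}.
  by apply: CL_add => //; apply: ih; (try exact: CL_pder); exact: CL_pred.
Qed.

Lemma CL_sum {V : normedModType R} (I : finType) k U (f : I -> 'rV[R]_p * W -> V) : open U ->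
  (forall i, CL k U (f i)) -> CL k U (fun q => \sum_i f i q).
Proof.
move=> oU cf; rewrite /index_enum; elim: (Finite.enum I) => [|i s ih].
  by apply: (@CL_eq _ _ _ (fun=> 0)) => //; [move=> q _; rewrite big_nil|exact: CL_cst].
apply: (@CL_eq _ _ _ (fun q => f i q + \sum_(j <- s) f j q)) => //.
  by move=> q _; rewrite big_cons.
exact: CL_add.
Qed.

Lemma pder_coord i l q : pder l (fun q : 'rV[R]_p * W => q.1 0 i) q = (i == l)%:R :> R.
Proof.
rewrite /pder /=.
have := derive_mx (@derivable_id R 'rV[R]_p q.1 (delta_mx 0 l)).
by rewrite derive_id => /matrixP/(_ 0 i); rewrite !mxE eqxx.
Qed.

Lemma CL_coordinate k U i : open U -> CL k U (fun q => q.1 0 i : R).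
Proof.
move=> oU.
have cq q : {for q, continuous (fun q : 'rV[R]_p * W => q.1 0 i : R)}.
  apply: (@continuous_comp _ _ _ fst (fun y : 'rV[R]_p => y 0 i)); first exact: cvg_fst.
  exact: coord_continuous.
case: k => [|k]; first by split=> //; exact/(within_openP _ oU).
apply: CL_intro => // [l q _|l].
  by apply: (derivable_mxP (fun y : 'rV[R]_p => y) q.1 (delta_mx 0 l)).1; exact: derivable_id.
rewrite (_ : pder l _ = (fun=> (i == l)%:R : R)); first exact: CL_cst.
by apply/funext => q; rewrite pder_coord.
Qed.

Lemma pder_entry {d : nat} U (f : 'rV[R]_p * W -> 'rV[R]_d) i j q :
  CL 1 U f -> U q -> pder i (fun q => f q 0 j) q = pder i f q 0 j :> R.
Proof.
move=> cf Uq; rewrite /pder.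
by rewrite (derive_mx (CL_derivable (i := i) cf Uq)) mxE.
Qed.

Lemma CL_entry {d : nat} k U (f : 'rV[R]_p * W -> 'rV[R]_d) j : open U ->
  CL k U f -> CL k U (fun q => f q 0 j : R).
Proof.
move=> oU; elim: k f => [|k ih] f cf.
  split=> //; apply/(within_openP _ oU) => q Uq.
  apply: (@continuous_comp _ _ _ f (fun y : 'rV[R]_d => y 0 j)).
    exact: (CL_continuous oU cf).
  exact: coord_continuous.
apply: CL_intro => // [q Uq|i q Uq|i].
- apply: (@continuous_comp _ _ _ f (fun y : 'rV[R]_d => y 0 j)).
    exact: (CL_continuous oU cf).
  exact: coord_continuous.
- by have /derivable_mxP := CL_derivable (i := i) cf Uq; exact.
- apply: (@CL_eq _ _ _ (fun q => pder i f q 0 j)) => // [q Uq|].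
    by rewrite (@pder_entry _ U)//; apply: CL_le cf.
  by apply: ih; exact: CL_pder.
Qed.


Lemma CL_opp {V : normedModType R} k U (f : 'rV[R]_p * W -> V) : open U ->
  CL k U f -> CL k U (fun q => - f q).
Proof.
move=> oU; elim: k f => [|k ih] f cf.
  split=> //; apply/(within_openP _ oU) => q Uq.
  by apply: cvgN; exact: (CL_continuous oU cf).
apply: CL_intro => // [q Uq|i q Uq|i].
- by apply: cvgN; exact: (CL_continuous oU cf).
- by apply: derivableN; exact: (CL_derivable cf Uq).
- apply: (@CL_eq _ _ _ (fun q => - pder i f q)) => // [q Uq|].
    by rewrite /pder deriveN//; exact: (CL_derivable cf Uq).
  by apply: ih; exact: CL_pder.
Qed.

Lemma line_is_derive {V : normedModType R} (f : 'rV[R]_p -> V) (y v : 'rV[R]_p) (h : R) :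
  derivable f (h *: v + y) v ->
  is_derive h 1 (fun r : R => f (r *: v + y)) ('D_v f (h *: v + y)).
Proof.
move=> df.
have E : (fun r : R => r^-1 *: (f ((r *: 1 + h) *: v + y) - f (h *: v + y))) =
         (fun r : R => r^-1 *: (f (r *: v + (h *: v + y)) - f (h *: v + y))).
  by apply/funext => r; rewrite [_ *: 1]mulr1 scalerDl addrA.
apply: DeriveDef; first by rewrite /derivable /= E.
by rewrite /derive /= E.
Qed.

Lemma line_MVT (f : 'rV[R]_p -> R) (y v : 'rV[R]_p) (d : R) :
  (forall r : R, `|r| <= `|d| -> derivable f (r *: v + y) v) ->
  exists2 c : R, `|c| <= `|d| & f (d *: v + y) - f y = d * 'D_v f (c *: v + y).
Proof.
move=> df; pose g (r : R) := f (r *: v + y).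
have dg (r : R) : `|r| <= `|d| -> is_derive r 1 g ('D_v f (r *: v + y)).
  by move=> /df; exact: line_is_derive.
have cg (a b : R) : (forall r, a <= r -> r <= b -> `|r| <= `|d|) -> {within `[a, b], continuous g}.
  move=> ab; apply: derivable_within_continuous => r; rewrite in_itv /= => /andP[ar rb].
  exact: (@ex_derive _ _ _ _ _ _ _ (dg _ (ab _ ar rb))).
have g0 : g 0 = f y by rewrite /g scale0r add0r.
have [d0|d0] := leP 0 d.
  have cg0 : {within `[0, d], continuous g}.
    by apply: cg => r r0 rd; rewrite !ger0_norm.
  have [c|c cd e] := @MVT_segment R g (fun r => 'D_v f (r *: v + y)) 0 d d0 _ cg0.
    by rewrite in_itv /= => /andP[c0 cd]; apply: dg; rewrite !ger0_norm// ltW.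
  move: cd; rewrite in_itv /= => /andP[c0 cd].
  exists c; first by rewrite !ger0_norm.
  by rewrite -g0 -/(g d) e subr0 mulrC.
have cgd : {within `[d, 0], continuous g}.
  by apply: cg => r dr r0; rewrite !ler0_norm ?lerN2// ltW.
have [c|c cd e] := @MVT_segment R g (fun r => 'D_v f (r *: v + y)) d 0 (ltW d0) _ cgd.
  by rewrite in_itv /= => /andP[cd c0]; apply: dg; rewrite !ltr0_norm// lerN2 ltW.
move: cd; rewrite in_itv /= => /andP[cd c0].
exists c; first by rewrite !ler0_norm ?lerN2// ltW.
by rewrite -g0 -/(g d) -opprB e sub0r mulrN opprK mulrC.
Qed.

(* Moving from [x] to [y] one coordinate at a time. *)
Lemma coordinate_MVT (f : 'rV[R]_p * W -> R) (x y : 'rV[R]_p) (z : W) :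
  (forall w i, `|w - x| <= `|y - x| ->
     derivable (fun y => f (y, z)) w (delta_mx 0 i)) ->
  exists2 xi : 'I_p -> 'rV[R]_p, forall i, `|xi i - x| <= `|y - x| &
    f (y, z) - f (x, z) = \sum_i (y - x) 0 i * pder i f (xi i, z).
Proof.
move=> df.
pose m (j : nat) : 'rV[R]_p := \row_i (if (i < j)%N then y 0 i else x 0 i).
have m0 : m 0%N = x by apply/rowP => i; rewrite mxE.
have mp : m p = y by apply/rowP => i; rewrite mxE ltn_ord.
have step (j : 'I_p) (r : R) : `|r| <= `|(y - x) 0 j| -> `|r *: delta_mx 0 j + m j - x| <= `|y - x|.
  move=> hr; apply: norm_le_coord => // i0 i; rewrite (ord1 i0) !mxE eqxx /=.
  case: (ltngtP i j) => [ij|ij|/val_inj ij].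
  - rewrite (negbTE (_ : i != j)) ?mulr0 ?add0r; first by have := coord_le_norm (y - x) 0 i; rewrite !mxE.
    by rewrite neq_ltn ij.
  - rewrite (negbTE (_ : i != j)) ?mulr0 ?add0r; first by rewrite subrr normr0.
    by rewrite neq_ltn ij orbT.
  - rewrite ij eqxx mulr1 addrK; apply: le_trans hr _; exact: coord_le_norm.
have /choice[c hc] (j : 'I_p) : exists c : R, `|c| <= `|(y - x) 0 j| /\
    f (m j.+1, z) - f (m j, z) = (y - x) 0 j * pder j f (c *: delta_mx 0 j + m j, z).
  have -> : m j.+1 = (y - x) 0 j *: delta_mx 0 j + m j.
    apply/rowP => i; rewrite !mxE eqxx /= ltnS.
    case: (ltngtP i j) => [ij|ij|/val_inj ij].
    - by rewrite (negbTE (_ : i != j)) ?mulr0 ?add0r// neq_ltn ij.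
    - by rewrite (negbTE (_ : i != j)) ?mulr0 ?add0r// neq_ltn ij orbT.
    - by rewrite ij eqxx mulr1 subrK.
  have [r hr|c cd e] := @line_MVT (fun y => f (y, z)) (m j) (delta_mx 0 j) ((y - x) 0 j).
    by apply: df; exact: step.
  by exists c.
exists (fun j => c j *: delta_mx 0 j + m j); first by move=> j; apply: step; case: (hc j).
have -> : f (y, z) - f (x, z) = \sum_(0 <= j < p) (f (m j.+1, z) - f (m j, z)).
  by rewrite telescope_sumr// m0 mp.
by rewrite big_mkord; apply: eq_bigr => j _; case: (hc j).
Qed.


Lemma ball_norm_slice U y z : open U -> U (y, z) ->
  exists2 e : R, 0 < e & forall w : 'rV[R]_p, `|w - y| <= e -> U (w, z).
Proof.
move=> oU Uq; have /nbhs_ballP[e /= e0 sub] := slice_near oU Uq.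
exists (e / 2); first by rewrite divr_gt0.
move=> w wy; apply: sub; rewrite mx_norm_ball /ball_ /= distrC.
by apply: le_lt_trans wy _; rewrite ltr_pdivrMr// ltr_pMr// ltr1n.
Qed.

(** [CL] provides only derivatives along coordinate vectors, so differentiability along a curve must
    be built from continuous partial derivatives: [coordinate_MVT] writes the increment with partial
    derivatives at points [xi] that converge to the base point. *)
Lemma slice_curve_is_derive U (f : 'rV[R]_p * W -> R) (gam : R -> 'rV[R]_p)
    (dgam : 'rV[R]_p) (z : W) (t : R) :
  open U -> CL 1 U f -> U (gam t, z) -> is_derive t 1 gam dgam ->
  is_derive t 1 (fun s => f (gam s, z)) (\sum_i dgam 0 i * pder i f (gam t, z)).
Proof.
move=> oU cf Ut dg.
have [e e0 Ue] := ball_norm_slice oU Ut.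
have gcont : {for t, continuous gam}.
  by apply/differentiable_continuous/derivable1_diffP; exact: ex_derive.
have ht : h + t @[h --> (0 : R)] --> t.
  by rewrite -[X in _ --> X]add0r; apply: cvgD; [exact: cvg_id|exact: cvg_cst].
have near_e : \forall h \near (0 : R), `|gam (h + t) - gam t| <= e.
  have : gam (h + t) @[h --> (0 : R)] --> gam t.
    apply: continuous_cvg; [exact: gcont|exact: ht].
  move/cvgrPdist_le => /(_ e e0); apply: filterS => h.
  by rewrite distrC.
(* The property is conditional on a small increment so that [choice] gives points for every h; all h
   near 0 satisfy the condition. *)
pose P (h : R) (xi : 'I_p -> 'rV[R]_p) := `|gam (h + t) - gam t| <= e ->
  (forall i, `|xi i - gam t| <= `|gam (h + t) - gam t|) /\
  f (gam (h + t), z) - f (gam t, z) =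
    \sum_i (gam (h + t) - gam t) 0 i * pder i f (xi i, z).
have /choice[xi hxi] h : exists xi, P h xi.
  have [he|] := pselect (`|gam (h + t) - gam t| <= e); last by exists (fun=> 0).
  have [w i hw|xi h1 h2] := @coordinate_MVT f (gam t) (gam (h + t)) z.
    have Uw : U (w, z) by apply: Ue; apply: le_trans hw he.
    exact: (CL_derivable cf Uw).
  by exists xi.
have xicv i : xi h i @[h --> (0 : R)] --> gam t.
  apply/cvgrPdist_le => d d0.
  have : gam (h + t) @[h --> (0 : R)] --> gam t.
    apply: continuous_cvg; [exact: gcont|exact: ht].
  move/cvgrPdist_le => /(_ d d0) hd; near=> h.
  have he : `|gam (h + t) - gam t| <= e by near: h.
  have [hx _] := hxi h he.
  rewrite distrC (le_trans (hx i))// distrC; by near: h.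
have pcv i : pder i f (xi h i, z) @[h --> (0 : R)] --> pder i f (gam t, z).
  have cp : {for gam t, continuous (fun y => pder i f (y, z))}.
    apply: (@slice_continuous _ (pder i f) (gam t, z)).
    apply: (CL_continuous oU _ Ut); exact: CL_pder cf.
  apply: (continuous_cvg _ cp); exact: xicv.
have gq : (h^-1 *: (gam (h + t) - gam t)) @[h --> (0 : R)^'] --> dgam.
  have /cvg_ex[l hl] := @ex_derive _ _ _ _ _ _ _ dg.
  have <- : l = dgam by rewrite -(@derive_val _ _ _ _ _ _ _ dg); apply/esym/cvg_lim.
  apply: cvg_trans hl; apply: near_eq_cvg; near=> h.
  by rewrite /= [_ *: 1]mulr1.
have cv : (h^-1 *: (f (gam (h + t), z) - f (gam t, z))) @[h --> (0 : R)^'] -->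
   \sum_i dgam 0 i * pder i f (gam t, z).
  have hs : (\sum_i (h^-1 *: (gam (h + t) - gam t)) 0 i * pder i f (xi h i, z)) @[h --> (0 : R)^'] -->
     \sum_i dgam 0 i * pder i f (gam t, z).
    apply: cvg_fin_sum => i; apply: cvgM.
      apply: (continuous_cvg _ (@coord_continuous _ _ _ 0 i dgam)); exact: gq.
    apply: cvg_trans (pcv i); apply: cvg_app; exact: cvg_within.
  apply: cvg_trans hs; apply: near_eq_cvg; near=> h.
  have he : `|gam (h + t) - gam t| <= e by near: h; exact: nbhs_dnbhs.
  have [_ ->] := hxi h he.
  rewrite scaler_sumr; apply: eq_bigr => i _.
  by rewrite [in LHS]mxE -mulrA.
have E : (fun h : R => h^-1 *: (f (gam (h + t), z) - f (gam t, z))) =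
         (fun h : R => h^-1 *: (f (gam (h *: 1 + t), z) - f (gam t, z))).
  by apply/funext => h; rewrite [_ *: 1]mulr1.
apply: DeriveDef; first by apply/cvg_ex; exists (\sum_i dgam 0 i * pder i f (gam t, z)); rewrite /= -E.
by rewrite /derive /= -E; exact/cvg_lim.
Unshelve. all: by end_near. Qed.

End ContinuousLeafwise.

Lemma is_derive_line {R : realType} {E V : normedModType R} (f : E -> V) (x v : E) (df : V) :
  is_derive (0 : R) 1 (fun h : R => f (h *: v + x)) df -> is_derive x v f df.
Proof.
have E1 : (fun h : R => h^-1 *: (f ((h *: (1 : R) + 0) *: v + x) - f (0 *: v + x))) =
          (fun h : R => h^-1 *: (f (h *: v + x) - f x)).
  by apply/funext => h; rewrite [_ *: 1]mulr1 addr0 scale0r add0r.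
move=> dd; apply: DeriveDef.
  by have := @ex_derive _ _ _ _ _ _ _ dd; rewrite /derivable /= E1.
by have := @derive_val _ _ _ _ _ _ _ dd; rewrite /derive /= E1.
Qed.

Lemma mean_value_bound {R : realType} (f df : R -> R) (C : R) :
  (forall r : R, 0 <= r -> r <= 1 -> is_derive r 1 f (df r)) ->
  (forall r : R, 0 <= r -> r <= 1 -> `|df r| <= C) -> `|f 1 - f 0| <= C.
Proof.
move=> d1 hC.
have cf : {within `[0, 1], continuous f}.
  apply: derivable_within_continuous => r; rewrite in_itv /= => /andP[r0 r1].
  exact: (@ex_derive _ _ _ _ _ _ _ (d1 _ r0 r1)).
have [|c] := @MVT_segment R f df 0 1 ler01 _ cf.
  by move=> r; rewrite in_itv /= => /andP[r0 r1]; apply: d1; exact: ltW.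
by rewrite in_itv /= => /andP[c0 c1] ->; rewrite subr0 mulr1; exact: hC.
Qed.

Section Composition.
Context {R : realType} {p1 p2 : nat} {W1 W2 : topologicalType}.

Lemma is_derive_comp_leafwise (N : set ('rV[R]_p1 * W1)) (U : set ('rV[R]_p2 * W2))
    (F : 'rV[R]_p2 * W2 -> R) (f1 : 'rV[R]_p1 * W1 -> 'rV[R]_p2) (f2 : W1 -> W2) i r :
  open N -> open U -> CL 1 U F -> CL 1 N f1 -> N r -> U (f1 r, f2 r.2) ->
  is_derive r.1 (delta_mx 0 i) (fun y => F (f1 (y, r.2), f2 r.2))
    (\sum_l pder i f1 r 0 l * pder l F (f1 r, f2 r.2)).
Proof.
move=> oN oU cF cf1 Nr Ur; apply: is_derive_line.
have := @slice_curve_is_derive _ _ _ U F (fun h => f1 (h *: delta_mx 0 i + r.1, r.2))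
  (pder i f1 r) (f2 r.2) 0 oU cF.
rewrite scale0r add0r -surjective_pairing => /(_ Ur); apply.
have := @line_is_derive _ _ _ (fun y => f1 (y, r.2)) r.1 (delta_mx 0 i) 0.
rewrite scale0r add0r; apply; exact: (CL_derivable cf1 Nr).
Qed.

(** By the chain rule a partial derivative of the composite is a sum of products of entries of
    [pder i f1] with composites of partial derivatives of [F], which the induction hypothesis
    covers. *)
Lemma CL_comp k (N : set ('rV[R]_p1 * W1)) (U : set ('rV[R]_p2 * W2))
    (F : 'rV[R]_p2 * W2 -> R) (f1 : 'rV[R]_p1 * W1 -> 'rV[R]_p2) (f2 : W1 -> W2) :
  open N -> open U -> CL k U F -> CL k N f1 ->
  (forall r, N r -> {for r, continuous (fun r => f2 r.2)}) ->
  (forall r, N r -> U (f1 r, f2 r.2)) ->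
  CL k N (fun r => F (f1 r, f2 r.2)).
Proof.
move=> oN oU + + cf2 NU; elim: k F f1 NU => [|k ih] F f1 NU cF cf1.
  split=> //; apply/(within_openP _ oN) => r Nr.
  apply: (@continuous_comp _ _ _ (fun r => (f1 r, f2 r.2)) F).
    apply: continuous_pair; first exact: (CL_continuous oN cf1 Nr).
    exact: cf2.
  exact: (CL_continuous oU cF (NU _ Nr)).
have d1 i r (Nr : N r) := @is_derive_comp_leafwise N U F f1 f2 i r oN oU
  (CL_le (isT : (1 <= k.+1)%N) cF) (CL_le (isT : (1 <= k.+1)%N) cf1) Nr (NU _ Nr).
apply: CL_intro => // [r Nr|i r Nr|i].
- apply: (@continuous_comp _ _ _ (fun r => (f1 r, f2 r.2)) F).
    apply: continuous_pair; first exact: (CL_continuous oN cf1 Nr).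
    exact: cf2.
  exact: (CL_continuous oU cF (NU _ Nr)).
- exact: (@ex_derive _ _ _ _ _ _ _ (d1 i r Nr)).
- apply: (@CL_eq _ _ _ _ _ _ (fun r => \sum_l pder i f1 r 0 l * pder l F (f1 r, f2 r.2))) => //.
    by move=> r Nr; rewrite -(@derive_val _ _ _ _ _ _ _ (d1 i r Nr)).
  apply: CL_sum => // l; apply: CL_mul => //.
    by apply: CL_entry => //; exact: CL_pder.
  by apply: ih => //; [exact: CL_pder|exact: CL_pred].
Qed.

End Composition.

(** * Powers of the positive part, used as cutoffs *)

Section PositivePart.
Context {R : realType}.

Definition pospow (n : nat) (x : R) : R := Num.max 0 x ^+ n.

Lemma pospow_neg n x : x <= 0 -> pospow n.+1 x = 0.
Proof. by move=> x0; rewrite /pospow max_l// expr0n. Qed.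

Lemma pospow_pos n x : 0 <= x -> pospow n x = x ^+ n.
Proof. by move=> x0; rewrite /pospow max_r. Qed.

Lemma is_derive_pospow n (x : R) : is_derive x 1 (pospow n.+2) (n.+2%:R * pospow n.+1 x).
Proof.
have [x0|x0|x0] := ltgtP x 0.
- apply: (@near_eq_is_derive _ _ _ (fun=> 0)).
    near=> y; rewrite pospow_neg//; near: y; exact: (filterS (fun y => @ltW _ _ y 0) (lt_nbhsl x0)).
  by rewrite pospow_neg ?ltW// mulr0; exact: is_derive_cst.
- apply: (@near_eq_is_derive R R R (fun y : R => y ^+ n.+2)).
    near=> y; rewrite pospow_pos//; near: y; exact: (filterS (fun y => @ltW _ _ 0 y) (lt_nbhsr x0)).
  rewrite pospow_pos ?ltW//.
  apply: DeriveDef; first exact: exprn_derivable.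
  by rewrite exp_derive /GRing.scale /= mulr1 mulr_natl.
(* At the origin the difference quotient is at most |h| when |h| <= 1, as the exponent is at least
   2. *)
- rewrite x0 pospow_neg// mulr0.
  have cv : (fun h : R => h^-1 *: (pospow n.+2 (h *: 1 + 0) - pospow n.+2 0)) @ 0^' --> (0 : R).
    apply/cvgrPdist_le => e e0; near=> h.
    have h0 : h != 0 by near: h; exact: nbhs_dnbhs_neq.
    rewrite [_ *: 1]mulr1 addr0 (pospow_neg _ (lexx 0)) subr0 sub0r normrN normrM.
    have hp : `|pospow n.+2 h| <= `|h| * `|h|.
      have [hn|hp] := leP h 0; first by rewrite pospow_neg// normr0 mulr_ge0.
      have h1 : `|h| <= 1 by near: h; apply: dnbhs0_le.
      rewrite pospow_pos ?(ltW hp)// normrX.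
      have -> : `|h| ^+ n.+2 = `|h| * `|h| * `|h| ^+ n by rewrite !exprS mulrA.
      by rewrite ler_piMr ?mulr_ge0// exprn_ile1.
    rewrite normfV ler_pdivrMl ?normr_gt0//.
    apply: le_trans hp _; rewrite ler_wpM2l//.
    by near: h; exact: dnbhs0_le.
  apply: DeriveDef; first by apply/cvg_ex; exists 0.
  exact/cvg_lim.
Unshelve. all: by end_near. Qed.

Lemma continuous_pospow n : continuous (pospow n.+1).
Proof.
move=> x; apply: (@continuous_comp _ _ _ (fun x : R => Num.max 0 x) (fun y => y ^+ n.+1)).
  by apply: continuous_max; [exact: cvg_cst|exact: cvg_id].
exact: exprn_continuous.
Qed.

Lemma CL_pospow {p : nat} {W : topologicalType} k n (U : set ('rV[R]_p * W)) (f : 'rV[R]_p * W -> R) :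
  open U -> (k < n)%N -> CL k U f -> CL k U (fun q => pospow n (f q)).
Proof.
move=> oU; elim: k n f => [|k ih] [//|n] f kn cf.
  split=> //; apply/(within_openP _ oU) => q Uq.
  by apply: continuous_comp; [exact: (CL_continuous oU cf Uq)|exact: continuous_pospow].
case: n kn => [//|n] kn.
have dd i q : U q -> is_derive q.1 (delta_mx 0 i) (fun y => pospow n.+2 (f (y, q.2)))
     (n.+2%:R * pospow n.+1 (f q) * pder i f q).
  move=> Uq; apply: is_derive_line.
  have d1 := @line_is_derive _ _ _ (fun y => f (y, q.2)) q.1 (delta_mx 0 i) 0.
  rewrite scale0r add0r in d1; have {}d1 := d1 (CL_derivable cf Uq).
  have d2 := is_derive_pospow n (f (0 *: delta_mx 0 i + q.1, q.2)).
  have := @is_derive1_comp _ (pospow n.+2) (fun h : R => f (h *: delta_mx 0 i + q.1, q.2)) 0 _ _ d2 d1.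
  by rewrite scale0r add0r -surjective_pairing mulrC.
apply: CL_intro => // [q Uq|i q Uq|i].
- by apply: continuous_comp; [exact: (CL_continuous oU cf Uq)|exact: continuous_pospow].
- exact: (@ex_derive _ _ _ _ _ _ _ (dd i q Uq)).
- apply: (@CL_eq _ _ _ _ _ _ (fun q => n.+2%:R * pospow n.+1 (f q) * pder i f q)) => //.
    by move=> q Uq; rewrite -(@derive_val _ _ _ _ _ _ _ (dd i q Uq)).
  apply: CL_mul => //; last exact: CL_pder.
  apply: CL_mul => //; first exact: CL_cst.
  by apply: ih => //; exact: CL_pred.
Qed.

End PositivePart.

(** * Two-point Taylor bounds on a convex part of a slice *)

Section TaylorBounds.
Context {R : realType} {p : nat} {W : topologicalType}.
Variables (U : set ('rV[R]_p * W)) (D : set 'rV[R]_p) (z : W) (M : R).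
Hypothesis oU : open U.
Hypothesis DU : forall y, D y -> U (y, z).
Hypothesis convD : forall (x v : 'rV[R]_p) (r : R), D x -> D (x + v) -> 0 <= r -> r <= 1 -> D (x + r *: v).
Hypothesis diamD : forall x y, D x -> D y -> `|y - x| <= M.
Implicit Types (f : 'rV[R]_p * W -> R) (L : R).

Definition slice_lipschitz f L :=
  forall x y, D x -> D y -> `|f (y, z) - f (x, z)| <= L * `|y - x|.

Definition slice_taylor1 f L := forall x v x' v' : 'rV[R]_p, D x -> D (x + v) -> D x' -> D (x' + v') ->
  `|(f (x + v, z) - f (x, z)) - (f (x' + v', z) - f (x', z))|
    <= L * (`|v - v'| + `|x - x'| * `|v|).

Definition slice_taylor2 f L := forall x v x' v' : 'rV[R]_p, D x -> D (x + v) -> D x' -> D (x' + v') ->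
  `|(f (x + v, z) - f (x, z) - \sum_l v 0 l * pder l f (x, z))
    - (f (x' + v', z) - f (x', z) - \sum_l v' 0 l * pder l f (x', z))|
    <= L * (`|x - x'| * `|v| ^+ 2 + `|v - v'| * (`|v| + `|v'|)).

Let ray_is_derive f (x v : 'rV[R]_p) (r : R) : CL 1 U f -> D x -> D (x + v) -> 0 <= r -> r <= 1 ->
  is_derive r 1 (fun r => f (x + r *: v, z)) (\sum_l v 0 l * pder l f (x + r *: v, z)).
Proof.
move=> cf Dx Dv r0 r1.
apply: (@slice_curve_is_derive _ _ _ U f (fun r => x + r *: v) v z r oU cf).
  exact/DU/convD.
have := @line_is_derive R _ _ (fun y => y) x v r (@derivable_id _ _ _ _).
rewrite derive_id; congr (is_derive _ _ _ _).
by apply/funext => s; rewrite addrC.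
Qed.

Let sum_le (F : 'I_p -> R) (C : R) : (forall l, `|F l| <= C) -> `|\sum_l F l| <= p%:R * C.
Proof.
move=> h; apply: le_trans (ler_norm_sum _ _ _) _.
apply: le_trans (ler_sum _ (fun l _ => h l)) _.
by rewrite sumr_const card_ord mulr_natl.
Qed.

Lemma lipschitz_of_pder f L : CL 1 U f -> 
  (forall l x, D x -> `|pder l f (x, z)| <= L) -> slice_lipschitz f (p%:R * L).
Proof.
move=> cf hL x y Dx Dy; have Dv : D (x + (y - x)) by rewrite addrC subrK.
have := @mean_value_bound _ (fun r => f (x + r *: (y - x), z))
  (fun r => \sum_l (y - x) 0 l * pder l f (x + r *: (y - x), z)) (p%:R * L * `|y - x|).
rewrite scale1r scale0r addr0 (addrC x) subrK; apply.
  by move=> r r0 r1; exact: ray_is_derive.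
move=> r r0 r1; rewrite -mulrA; apply: sum_le => l.
rewrite normrM mulrC; apply: ler_pM => //; first exact/hL/convD.
exact: coord_le_norm.
Qed.

(** Apply the mean value bound to the difference of [f] along the segments from x to x + v and from
    x' to x' + v'. The summand [L1 * M] arises from the product of |v - v'| with |v|, where |v| is
    at most the diameter. *)
Lemma taylor1_of_pder f L0 L1 : CL 1 U f -> 0 <= L0 -> 0 <= L1 -> 0 <= M ->
  (forall l x, D x -> `|pder l f (x, z)| <= L0) ->
  (forall l, slice_lipschitz (pder l f) L1) ->
  slice_taylor1 f (p%:R * (L0 + L1 * M + L1)).
Proof.
move=> cf L00 L10 M0 hL0 hL1 x v x' v' Dx Dv Dx' Dv'.
pose dk r := (\sum_l v 0 l * pder l f (x + r *: v, z)) -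
        (\sum_l v' 0 l * pder l f (x' + r *: v', z)).
have := @mean_value_bound _ (fun r => f (x + r *: v, z) - f (x' + r *: v', z)) dk
  (p%:R * (L0 + L1 * M + L1) * (`|v - v'| + `|x - x'| * `|v|)).
rewrite !scale1r !scale0r !addr0.
have -> : (f (x + v, z) - f (x' + v', z) - (f (x, z) - f (x', z))) =
  ((f (x + v, z) - f (x, z)) - (f (x' + v', z) - f (x', z))) by ring.
apply.
  by move=> r r0 r1; apply: is_deriveB; exact: ray_is_derive.
move=> r r0 r1; rewrite /dk -sumrB -mulrA; apply: sum_le => l.
have Dr : D (x + r *: v) by exact: convD.
have Dr' : D (x' + r *: v') by exact: convD.
have -> : v 0 l * pder l f (x + r *: v, z) - v' 0 l * pder l f (x' + r *: v', z) =
  v 0 l * (pder l f (x + r *: v, z) - pder l f (x' + r *: v', z)) +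
  (v - v') 0 l * pder l f (x' + r *: v', z) by rewrite !mxE; ring.
apply: le_trans (ler_normD _ _) _; rewrite !normrM.
have vM : `|v| <= M by have := diamD Dx Dv; rewrite addrC addKr.
have h1 : `|pder l f (x + r *: v, z) - pder l f (x' + r *: v', z)| <= L1 * (`|x - x'| + `|v - v'|).
  apply: le_trans (hL1 l _ _ Dr' Dr) _; rewrite ler_wpM2l//.
  have -> : x + r *: v - (x' + r *: v') = (x - x') + r *: (v - v') by rewrite scalerBr opprD addrACA.
  apply: le_trans (ler_normD _ _) _; rewrite lerD// normrZ ger0_norm// ler_piMl//.
have h2 : `|v 0 l| * `|pder l f (x + r *: v, z) - pder l f (x' + r *: v', z)| <= `|v| * (L1 * (`|x - x'| + `|v - v'|)).
  by apply: ler_pM => //; exact: coord_le_norm.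
have h3 : `|(v - v') 0 l| * `|pder l f (x' + r *: v', z)| <= `|v - v'| * L0.
  by apply: ler_pM => //; [exact: coord_le_norm|exact: hL0].
have h4 : L1 * `|v - v'| * `|v| <= L1 * `|v - v'| * M by rewrite ler_wpM2l ?mulr_ge0.
have h5 : 0 <= L0 * (`|x - x'| * `|v|) by rewrite !mulr_ge0.
have h6 : 0 <= L1 * M * (`|x - x'| * `|v|) by rewrite !mulr_ge0.
have h7 : 0 <= L1 * `|v - v'| by rewrite mulr_ge0.
lra.
Qed.

(** As before, after subtracting the linear term [r * c]. The derivative in r is then a difference
    of increments of [pder l f], to which the first order two-point bound applies. *)
Lemma taylor2_of_pder f L1 L2 : CL 2 U f -> 0 <= L1 -> 0 <= L2 ->
  (forall l, slice_lipschitz (pder l f) L1) ->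
  (forall l, slice_taylor1 (pder l f) L2) ->
  slice_taylor2 f (p%:R * (L1 + L2)).
Proof.
move=> cf L10 L20 hL1 hL2 x v x' v' Dx Dv Dx' Dv'.
have cf1 : CL 1 U f by exact: CL_pred.
pose c := \sum_l v 0 l * pder l f (x, z) - \sum_l v' 0 l * pder l f (x', z).
pose dk r := (\sum_l v 0 l * pder l f (x + r *: v, z)) -
        (\sum_l v' 0 l * pder l f (x' + r *: v', z)) - c.
have := @mean_value_bound _ (fun r => f (x + r *: v, z) - f (x' + r *: v', z) - r * c) dk
  (p%:R * (L1 + L2) * (`|x - x'| * `|v| ^+ 2 + `|v - v'| * (`|v| + `|v'|))).
rewrite !scale1r !scale0r !addr0 mul1r mul0r subr0.
have -> : f (x + v, z) - f (x' + v', z) - c - (f (x, z) - f (x', z)) =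
  (f (x + v, z) - f (x, z) - \sum_l v 0 l * pder l f (x, z))
    - (f (x' + v', z) - f (x', z) - \sum_l v' 0 l * pder l f (x', z)) by rewrite /c; ring.
apply.
  move=> r r0 r1; apply: is_deriveB; first by apply: is_deriveB; exact: ray_is_derive.
  have := @is_deriveM _ _ (@id R) (cst c) r 1 1 0 (is_derive_id _ _) (is_derive_cst _ _ _).
  by move=> h; apply: (is_derive_eq h); rewrite scaler0 add0r /GRing.scale /= mulr1.
move=> r r0 r1; rewrite /dk /c -!sumrB -mulrA; apply: sum_le => l.
have Dr : D (x + r *: v) by exact: convD.
have Dr' : D (x' + r *: v') by exact: convD.
set a := pder l f (x + r *: v, z); set b := pder l f (x, z).
set a' := pder l f (x' + r *: v', z); set b' := pder l f (x', z).
have -> : v 0 l * a - v' 0 l * a' - (v 0 l * b - v' 0 l * b') =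
  v 0 l * ((a - b) - (a' - b')) + (v - v') 0 l * (a' - b') by rewrite !mxE; ring.
apply: le_trans (ler_normD _ _) _; rewrite !normrM.
have h1 : `|(a - b) - (a' - b')| <= L2 * (`|v - v'| + `|x - x'| * `|v|).
  apply: le_trans (hL2 l _ _ _ _ Dx Dr Dx' Dr') _; rewrite ler_wpM2l//.
  rewrite -scalerBr !normrZ ger0_norm//; apply: lerD; first by rewrite ler_piMl.
  by rewrite ler_wpM2l// ler_piMl.
have h2 : `|a' - b'| <= L1 * `|v'|.
  apply: le_trans (hL1 l _ _ Dx' Dr') _; rewrite ler_wpM2l//.
  by rewrite addrC addKr normrZ ger0_norm// ler_piMl.
have h3 : `|v 0 l| * `|(a - b) - (a' - b')| <= `|v| * (L2 * (`|v - v'| + `|x - x'| * `|v|)).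
  by apply: ler_pM => //; exact: coord_le_norm.
have h4 : `|(v - v') 0 l| * `|a' - b'| <= `|v - v'| * (L1 * `|v'|).
  by apply: ler_pM => //; exact: coord_le_norm.
have h5 : 0 <= L1 * (`|v - v'| * `|v|) by rewrite !mulr_ge0.
have h6 : 0 <= L2 * (`|v - v'| * `|v'|) by rewrite !mulr_ge0.
have h7 : 0 <= L1 * (`|x - x'| * `|v| ^+ 2) by rewrite !mulr_ge0 ?exprn_ge0.
lra.
Qed.

End TaylorBounds.

(** Any monotone family of bounds is met by the sum of the absolute values of the individual ones;
    the summand 1 makes the result usable as a constant that must be at least 1. *)
Lemma common_bound {R : realType} (I : finType) (P : I -> R -> Prop) :
  (forall i L L', L <= L' -> P i L -> P i L') -> (forall i, exists L, P i L) ->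
  exists2 L, 1 <= L & forall i, P i L.
Proof.
move=> mono /choice[f hf]; exists (1 + \sum_i `|f i|); first by rewrite lerDl sumr_ge0.
move=> i; apply: mono (hf i); apply: le_trans (ler_norm _) _.
rewrite (bigD1 i) //= addrCA lerDl addr_ge0// sumr_ge0//.
Qed.

Lemma compact_bound {R : realType} {T : topologicalType} (K : set T) (f : T -> R) :
  compact K -> (forall x, K x -> {for x, continuous f}) ->
  exists2 L, 0 <= L & forall x, K x -> `|f x| <= L.
Proof.
move=> cK cf.
have [|M [_ hM]] := @compact_bounded _ _ (f @` K).
  apply: continuous_compact => //; apply: continuous_in_subspaceT => x.
  by rewrite inE; exact: cf.
exists (Num.max 0 (M + 1)); first by rewrite le_max lexx.
move=> x Kx; rewrite le_max; apply/orP; right.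
by apply: (hM (M + 1)); [rewrite ltrDl|exists x].
Qed.

(** * Taylor constants uniform in the transverse coordinate, by compactness *)

Section UniformTaylor.
Context {R : realType} {p : nat} {W : topologicalType}.
Variables (U : set ('rV[R]_p * W)) (D : set 'rV[R]_p) (K : set W) (M : R).
Hypothesis oU : open U.
Hypothesis cDK : compact (D `*` K).
Hypothesis DKU : D `*` K `<=` U.
Hypothesis convD : forall (x v : 'rV[R]_p) (r : R), D x -> D (x + v) -> 0 <= r -> r <= 1 -> D (x + r *: v).
Hypothesis diamD : forall x y, D x -> D y -> `|y - x| <= M.
Hypothesis M0 : 0 <= M.
Implicit Types (f : 'rV[R]_p * W -> R) (L : R).

Lemma CL_bounded f : CL 0 U f ->
  exists2 L, 0 <= L & forall x z, D x -> K z -> `|f (x, z)| <= L.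
Proof.
move=> cf; have [|L L0 hL] := compact_bound cDK (f := f).
  by move=> q /DKU; exact: (CL_continuous oU cf).
by exists L => // x z Dx Kz; exact: hL.
Qed.

Let DU z : K z -> forall y, D y -> U (y, z).
Proof. by move=> Kz y Dy; exact: DKU. Qed.

Let CL_pder_bounded f : CL 1 U f ->
  exists2 L, 1 <= L & forall l x z, D x -> K z -> `|pder l f (x, z)| <= L.
Proof.
move=> cf; have := @common_bound R 'I_p (fun l L => forall x z, D x -> K z -> `|pder l f (x, z)| <= L).
case.
- by move=> l L L' LL h x z Dx Kz; apply: le_trans LL; exact: h.
- by move=> l; have [L _ hL] := CL_bounded (CL_pder l cf); exists L.
- by move=> L L1 hL; exists L => // l x z; exact: hL.
Qed.

Lemma CL_lipschitz f : CL 1 U f ->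
  exists2 L, 0 <= L & forall z, K z -> slice_lipschitz D z f L.
Proof.
move=> cf; have [L L1 hL] := CL_pder_bounded cf.
exists (p%:R * L); first by rewrite mulr_ge0//; lra.
move=> z Kz; apply: (lipschitz_of_pder oU (DU Kz) convD cf) => l x Dx; exact: hL.
Qed.

Let CL_pder_lipschitz f : CL 2 U f ->
  exists2 L, 1 <= L & forall l z, K z -> slice_lipschitz D z (pder l f) L.
Proof.
move=> cf; have := @common_bound R 'I_p (fun l L => forall z, K z -> slice_lipschitz D z (pder l f) L).
case.
- move=> l L L' LL h z Kz x y Dx Dy; apply: le_trans (h _ Kz _ _ Dx Dy) _.
  by rewrite ler_wpM2r.
- by move=> l; have [L _ hL] := CL_lipschitz (CL_pder l cf); exists L.
- by move=> L L1 hL; exists L => // l z; exact: hL.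
Qed.

Lemma CL_taylor1 f : CL 2 U f ->
  exists2 L, 0 <= L & forall z, K z -> slice_taylor1 D z f L.
Proof.
move=> cf; have cf1 := CL_pred cf; have [L L1 hL] := CL_pder_bounded cf1.
have [L' L1' hL'] := CL_pder_lipschitz cf.
exists (p%:R * (L + L' * M + L')).
  rewrite mulr_ge0// !addr_ge0 ?mulr_ge0//; lra.
move=> z Kz; apply: (taylor1_of_pder oU (DU Kz) convD diamD cf1) => //; try lra.
  by move=> l x Dx; exact: hL.
by move=> l; exact: hL'.
Qed.

Let CL_pder_taylor1 f : CL 3 U f ->
  exists2 L, 1 <= L & forall l z, K z -> slice_taylor1 D z (pder l f) L.
Proof.
move=> cf; have := @common_bound R 'I_p (fun l L => forall z, K z -> slice_taylor1 D z (pder l f) L).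
case.
- move=> l L L' LL h z Kz x v x' v' Dx Dy Dx' Dy'; apply: le_trans (h _ Kz _ _ _ _ Dx Dy Dx' Dy') _.
  by rewrite ler_wpM2r// addr_ge0// mulr_ge0.
- by move=> l; have [L _ hL] := CL_taylor1 (CL_pder l cf); exists L.
- by move=> L L1 hL; exists L => // l z; exact: hL.
Qed.

Lemma CL_taylor2 f : CL 3 U f ->
  exists2 L, 0 <= L & forall z, K z -> slice_taylor2 D z f L.
Proof.
move=> cf; have cf2 := CL_pred cf; have [L L1 hL] := CL_pder_lipschitz cf2.
have [L' L1' hL'] := CL_pder_taylor1 cf.
exists (p%:R * (L + L')); first by rewrite mulr_ge0//; lra.
move=> z Kz; apply: (taylor2_of_pder oU (DU Kz) convD cf2) => //; try lra.
  by move=> l; exact: hL.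
by move=> l; exact: hL'.
Qed.

End UniformTaylor.

(** * Geometric rough paths *)

Lemma norm_trmx {R : realType} {m n : nat} (A : 'M[R]_(m, n)) : `|A^T| = `|A|.
Proof.
apply/eqP; rewrite eq_le; apply/andP; split; apply: norm_le_coord => // i j.
  by rewrite mxE; exact: coord_le_norm.
by have := coord_le_norm A^T j i; rewrite mxE.
Qed.

Lemma within_continuous_comp_sub {X Y Z : topologicalType} (A : set Y) (B : set X)
    (f : Y -> Z) (phi : X -> Y) :
  {within A, continuous f} -> continuous phi -> (forall x, B x -> A (phi x)) ->
  {within B, continuous (fun x => f (phi x))}.
Proof.
move=> /subspace_continuousP cf cphi BA; apply/subspace_continuousP => x Bx N nN.
have hh : nbhs x (fun x' => A (phi x') -> N (f (phi x'))) := cphi _ _ (cf _ (BA _ Bx) _ nN).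
change (nbhs x (fun x' => B x' -> N (f (phi x')))).
by apply: filterS hh => x' h /BA.
Qed.

Lemma continuous_trmx {R : realType} {m n : nat} : continuous (@trmx R m n).
Proof.
move=> A; apply: (iffRL (@cvgrPdist_le _ _ _ (nbhs A) (nbhs_filter A) trmx A^T)) => e e0.
have /nbhs_ballP := nbhsx_ballx A e e0.
move=> [r /= r0 hr]; apply/nbhs_ballP; exists r => // B /hr.
by rewrite mx_norm_ball /ball_ /= -linearB norm_trmx => /ltW.
Qed.

(** * Riemann-Stieltjes sums: integration by parts and time reversal *)

Section RiemannStieltjes.
Context {R : realType}.
Implicit Types (a b s t : R).

Lemma uniform_partition a b (e : R) : a <= b -> 0 < e -> exists2 s : seq R,
  itv_partition a b s &
  forall i, (i < size s)%N -> nth b (a :: s) i.+1 - nth b (a :: s) i < e.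
Proof.
(* A partition in the sense of [itv_partition] is strictly increasing, so for a = b only the empty
   one exists. *)
rewrite le_eqVlt => /predU1P[<- _|ab e0].
  by exists [::] => //; split => //=.
pose n := (Num.bound ((b - a) / e)).+1.
have nn : (b - a) / e < n%:R.
  apply: lt_trans (archi_boundP _) _; first by rewrite divr_ge0 ?subr_ge0// ltW.
  by rewrite ltr_nat.
have n0 : 0 < n%:R :> R by rewrite ltr0n.
pose g (i : nat) := a + (b - a) * (i%:R / n%:R).
have gE i : (i <= n)%N -> nth b (a :: mkseq (fun i => g i.+1) n) i = g i.
  case: i => [|i] hi; first by rewrite /g mul0r mulr0 addr0.
  by rewrite /= nth_mkseq.
have step i : g i.+1 - g i = (b - a) / n%:R.
  by rewrite /g -natr1; field; rewrite gt_eqF.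
exists (mkseq (fun i => g i.+1) n); last first.
  move=> i; rewrite size_mkseq => hi; rewrite !gE//; last exact: ltnW.
  by rewrite step ltr_pdivrMr// mulrC -ltr_pdivrMr.
split.
  apply/(pathP b) => i; rewrite size_mkseq => hi.
  rewrite gE; last exact: ltnW.
  by rewrite nth_mkseq// -subr_gt0 step divr_gt0// subr_gt0.
apply/eqP; rewrite (last_nth b) size_mkseq gE// /g divff ?gt_eqF//; ring.
Qed.

Lemma partition_increasing a b (s : seq R) i : itv_partition a b s -> (i < size s)%N ->
  nth b (a :: s) i < nth b (a :: s) i.+1.
Proof. by move=> [/(pathP b) h _] hi; exact: h. Qed.

Lemma partition_last a b (s : seq R) : itv_partition a b s -> nth b (a :: s) (size s) = b.
Proof. by move=> [_ /eqP]; rewrite (last_nth b). Qed.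

Lemma partition_mono a b (s : seq R) i j : itv_partition a b s -> (i <= j)%N -> (j <= size s)%N ->
  nth b (a :: s) i <= nth b (a :: s) j.
Proof.
move=> ps ij; rewrite -(subnK ij); elim: (j - i)%N => // k ih hk.
apply: le_trans (ih (ltnW hk)) _; rewrite addSn; apply/ltW/partition_increasing => //.
Qed.

Lemma partition_bounds a b (s : seq R) i : itv_partition a b s -> (i <= size s)%N ->
  a <= nth b (a :: s) i <= b.
Proof.
move=> ps hi; apply/andP; split.
  by have := @partition_mono a b s 0 i ps (leq0n _) hi.
by rewrite -[leRHS](partition_last ps) partition_mono.
Qed.

Lemma partition_length a b (s : seq R) : itv_partition a b s ->
  \sum_(i < size s) (nth b (a :: s) i.+1 - nth b (a :: s) i) = b - a.
Proof.
by move=> ps; rewrite -(big_mkord xpredT (fun i => nth b (a :: s) i.+1 - nth b (a :: s) i)) telescope_sumr// (partition_last ps).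
Qed.

Lemma partition_sum_bound a b (s : seq R) (F : nat -> R) (C : R) : itv_partition a b s ->
  (forall i, (i < size s)%N -> `|F i| <= C * (nth b (a :: s) i.+1 - nth b (a :: s) i)) ->
  `|\sum_(i < size s) F i| <= C * (b - a).
Proof.
move=> ps hF; apply: le_trans (ler_norm_sum _ _ _) _.
apply: le_trans (ler_sum _ (fun (i : 'I_(size s)) _ => hF i (ltn_ord i))) _.
by rewrite -mulr_sumr partition_length.
Qed.

Lemma RS_integral_bound (f g : R -> R) a b I (C K : R) : a <= b -> 0 <= C -> 0 <= K ->
  (forall u, a <= u -> u <= b -> `|f u| <= C) ->
  (forall u v, a <= u -> u <= v -> v <= b -> `|g v - g u| <= K * (v - u)) ->
  RS_integral f g a b I -> `|I| <= C * K * (b - a).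
Proof.
move=> ab C0 K0 hf hg hI; apply/ler_addgt0Pl => e e0.
have [d d0 hd] := hI e e0.
have [s ps ms] := uniform_partition ab d0.
have := hd s (fun i => nth b (a :: s) i) ps.
set S := \sum_(i < size s) _ => /(_ _)/ltW hS.
have hS' : `|S - I| <= e.
  apply: hS => i hi /=; split; first exact: ms.
  by rewrite lexx/=; exact/ltW/partition_increasing.
have : `|S| <= C * K * (b - a).
  apply: (partition_sum_bound (F := fun i => f (nth b (a :: s) i) * (g (nth b (a :: s) i.+1) - g (nth b (a :: s) i)))) => // i hi.
  have /andP[h1 h2] := partition_bounds ps (ltnW hi).
  have /andP[h3 h4] := partition_bounds ps hi.
  have h5 := ltW (partition_increasing ps hi).
  by rewrite normrM -mulrA; apply: ler_pM => //; [exact: hf|exact: hg].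
have := ler_normB S (S - I); rewrite opprB addrC subrK; lra.
Qed.

(** Discrete integration by parts with both factors at left end points, at the price of a bracket
    term. The variant below takes one factor at the right end point, and no bracket appears. *)
Lemma telescope_product (a b : nat -> R) n :
  \sum_(i < n) a i * (b i.+1 - b i) + \sum_(i < n) b i * (a i.+1 - a i)
    + \sum_(i < n) (a i.+1 - a i) * (b i.+1 - b i) = a n * b n - a 0%N * b 0%N.
Proof.
rewrite -!big_split /= -(big_mkord xpredT (fun i => a i * (b i.+1 - b i) + b i * (a i.+1 - a i) + (a i.+1 - a i) * (b i.+1 - b i))).
rewrite -(telescope_sumr (fun i => a i * b i) (leq0n n)).
by apply: eq_bigr => i _; ring.
Qed.

Lemma telescope_product' (a b : nat -> R) n :
  \sum_(i < n) a i * (b i.+1 - b i) + \sum_(i < n) b i.+1 * (a i.+1 - a i)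
     = a n * b n - a 0%N * b 0%N.
Proof.
rewrite -!big_split /= -(big_mkord xpredT (fun i => a i * (b i.+1 - b i) + b i.+1 * (a i.+1 - a i))).
rewrite -(telescope_sumr (fun i => a i * b i) (leq0n n)).
by apply: eq_bigr => i _; ring.
Qed.

Lemma RS_integral_ext (f g f' g' : R -> R) a b I :
  (forall u, f u = f' u) -> (forall u v, g v - g u = g' v - g' u) ->
  RS_integral f g a b I -> RS_integral f' g' a b I.
Proof.
move=> ff gg hI e e0; have [d d0 hd] := hI e e0; exists d => // s xi ps ms.
have := hd s xi ps ms; congr (`|_ - _| < _).
by apply: eq_bigr => i _; rewrite ff gg.
Qed.

Definition lipschitz_on (f : R -> R) (K : R) a b :=
  forall u v, a <= u -> u <= v -> v <= b -> `|f v - f u| <= K * (v - u).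

(** Both sums are taken on one partition with left tags; the bracket term of [telescope_product] is
    at most K^2 times mesh times length. *)
Lemma RS_integral_by_parts (f g : R -> R) a b (I J K : R) : a <= b -> 0 <= K ->
  lipschitz_on f K a b -> lipschitz_on g K a b ->
  RS_integral (fun u => f u - f a) g a b I ->
  RS_integral (fun u => g u - g a) f a b J ->
  I + J = (f b - f a) * (g b - g a).
Proof.
move=> ab K0 hf hg hI hJ; apply/eqP; rewrite -subr_eq0 -normr_le0.
apply/ler_addgt0Pl => e e0; rewrite addr0.
pose e' := e / 3.
have e'0 : 0 < e' by rewrite divr_gt0.
have [d1 d10 hd1] := hI e' e'0; have [d2 d20 hd2] := hJ e' e'0.
(* The mesh at which the bracket term is at most e'; the summand 1 keeps the denominator
   positive. *)
pose d3 := e' / (K * K * (b - a) + 1).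
have den0 : 0 < K * K * (b - a) + 1 by rewrite ltr_wpDl// !mulr_ge0// subr_ge0.
have d30 : 0 < d3 by rewrite divr_gt0.
have [|s ps ms] := @uniform_partition a b (Num.min d1 (Num.min d2 d3)) ab.
  by rewrite !lt_min d10 d20 d30.
pose P i := nth b (a :: s) i.
have m1 i : (i < size s)%N -> P i.+1 - P i < d1 /\ P i <= P i <= P i.+1.
  move=> hi; rewrite lexx /= (ltW (partition_increasing ps hi)); split=> //.
  by have := ms i hi; rewrite !lt_min => /andP[].
have m2 i : (i < size s)%N -> P i.+1 - P i < d2 /\ P i <= P i <= P i.+1.
  move=> hi; rewrite lexx /= (ltW (partition_increasing ps hi)); split=> //.
  by have := ms i hi; rewrite !lt_min => /and3P[].
have m3 i : (i < size s)%N -> P i.+1 - P i < d3.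
  by move=> hi; have := ms i hi; rewrite !lt_min => /and3P[].
have := hd1 s P ps m1; have := hd2 s P ps m2.
rewrite -!/(P _).
have := telescope_product (fun i => f (P i) - f a) (fun i => g (P i) - g a) (size s).
have Pn : P (size s) = b := partition_last ps.
rewrite Pn [P 0%N]/= !subrr mul0r subr0.
set S1 := (X in X + _ + _ = _); set S2 := (X in _ + X + _ = _); set S3 := (X in _ + _ + X = _).
move=> hS hJ' hI'.
have hS1 : `|S1 - I| < e'.
  suff -> : S1 = \sum_(i < size s) (f (P i) - f a) * (g (P i.+1) - g (P i)) by [].
  by apply: eq_bigr => i _; congr (_ * _); ring.
have hS2 : `|S2 - J| < e'.
  suff -> : S2 = \sum_(i < size s) (g (P i) - g a) * (f (P i.+1) - f (P i)) by [].
  by apply: eq_bigr => i _; congr (_ * _); ring.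
have hS3 : `|S3| <= K * K * d3 * (b - a).
  apply: (partition_sum_bound (F := fun i => (f (P i.+1) - f a - (f (P i) - f a)) * (g (P i.+1) - g a - (g (P i) - g a)))) => // i hi.
  have /andP[h1 h2] := partition_bounds ps (ltnW hi).
  have /andP[h3 h4] := partition_bounds ps hi.
  have h5 := ltW (partition_increasing ps hi).
  have -> : f (P i.+1) - f a - (f (P i) - f a) = f (P i.+1) - f (P i) by ring.
  have -> : g (P i.+1) - g a - (g (P i) - g a) = g (P i.+1) - g (P i) by ring.
  have -> : K * K * d3 * (nth b (a :: s) i.+1 - nth b (a :: s) i) = (K * d3) * (K * (P i.+1 - P i)) by rewrite /P; ring.
  rewrite normrM; apply: ler_pM => //; last exact: hg.
  apply: le_trans (hf _ _ h1 h5 h4) _; rewrite ler_wpM2l//; exact/ltW/m3.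
have hS3' : `|S3| <= e'.
  apply: le_trans hS3 _.
  have -> : K * K * d3 * (b - a) = e' * ((K * K * (b - a)) / (K * K * (b - a) + 1)) by rewrite /d3; ring.
  by apply: ler_piMr; [exact: ltW|rewrite ler_pdivrMr// mul1r lerDl].
have -> : I + J - (f b - f a) * (g b - g a) = - (S1 - I) - (S2 - J) - S3 by rewrite -hS; ring.
have := ler_normB (- (S1 - I) - (S2 - J)) S3; have := ler_normB (- (S1 - I)) (S2 - J).
rewrite normrN; rewrite /e' in hS1 hS2 hS3'; lra.
Qed.

(** Substituting u = S - v gives minus the integral of g - g(b) against f over [a, b]. Integration
    by parts turns it into the integral of f - f(a) against g; the boundary terms vanish because one
    factor is zero at each end. *)
Lemma RS_integral_reverse (f g : R -> R) a b S (I K : R) : a <= b -> 0 <= K ->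
  lipschitz_on f K a b -> lipschitz_on g K a b ->
  RS_integral (fun u => f u - f a) g a b I ->
  RS_integral (fun u => g (S - u) - g b) (fun u => f (S - u)) (S - b) (S - a) I.
Proof.
move=> ab K0 hf hg hI e e0.
pose e' := e / 2.
have e'0 : 0 < e' by rewrite divr_gt0.
have [d1 d10 hd1] := hI e' e'0.
pose d3 := e' / (K * K * (b - a) + 1).
have den0 : 0 < K * K * (b - a) + 1 by rewrite ltr_wpDl// !mulr_ge0// subr_ge0.
have d30 : 0 < d3 by rewrite divr_gt0.
exists (Num.min d1 d3); first by rewrite lt_min d10.
move=> s xi ps ms; pose n := size s.
pose P i := nth (S - a) ((S - b) :: s) i.
have P0 : P 0%N = S - b by [].
have Pn : P n = S - a by exact: partition_last ps.
(* The given partition [P] of [S - b, S - a], reflected to a partition of [a, b]. *)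
pose Q i := S - P (n - i)%N.
pose s' := mkseq (fun i => Q i.+1) n.
have sz : size s' = n by rewrite size_mkseq.
have QE i : (i <= n)%N -> nth b (a :: s') i = Q i.
  case: i => [|i] hi; first by rewrite /= /Q subn0 Pn; ring.
  by rewrite /= nth_mkseq.
have Qlt i : (i < n)%N -> Q i < Q i.+1.
  move=> hi; rewrite /Q ltrD2l ltrN2.
  have := @partition_increasing _ _ s (n - i.+1) ps.
  have hn : (n - i.+1 < size s)%N by rewrite ltn_subrL (leq_ltn_trans _ hi).
  by move=> /(_ hn); rewrite subnSK.
have Qmesh i : (i < n)%N -> Q i.+1 - Q i = P (n - i.+1).+1 - P (n - i.+1)%N.
  by move=> hi; rewrite /Q subnSK//; ring.
have Pb i : (i <= n)%N -> a <= S - P i /\ S - P i <= b.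
  by move=> hi; have /andP := partition_bounds ps hi; rewrite -/(P i); lra.
have ps' : itv_partition a b s'.
  split.
    apply/(pathP b) => i; rewrite sz => hi.
    rewrite QE; last exact: ltnW.
    by rewrite nth_mkseq//; exact: Qlt.
  by apply/eqP; rewrite (last_nth b) sz QE// /Q subnn P0; ring.
have ms' i : (i < n)%N -> P i.+1 - P i < d1 /\ P i.+1 - P i < d3 /\ P i <= xi i <= P i.+1.
  move=> hi; have [] := ms i hi; rewrite -!/(P _) lt_min => /andP[? ?] ?.
  by split.
have := hd1 s' (fun i => nth b (a :: s') i) ps'.
have m1 i : (i < size s')%N -> let l := nth b (a :: s') i in let r := nth b (a :: s') i.+1 in
  r - l < d1 /\ l <= nth b (a :: s') i <= r.
  rewrite sz => hi; rewrite /= -[nth b s' i]/(nth b (a :: s') i.+1) !QE//; last exact: ltnW.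
  rewrite Qmesh// lexx (ltW (Qlt _ hi)); split=> //.
  by have [] := ms' (n - i.+1)%N; rewrite // ltn_subrL (leq_ltn_trans _ hi).
move=> /(_ m1); set S1 := \sum_(i < size s') _ => hS1.
pose A i := g (S - P i) - g b; pose B i := f (S - P i) - f a.
(* Reflection exchanges left and right end points, so left tags on [Q] become the right tags needed
   by [telescope_product']. *)
have S1E : S1 = - \sum_(i < n) B i.+1 * (A i.+1 - A i).
  rewrite /S1 sz -sumrN (reindex_inj rev_ord_inj) /=; apply: eq_bigr => i _.
  have hi : (n - i.+1 < n)%N by rewrite ltn_subrL (leq_ltn_trans _ (ltn_ord i)).
  rewrite -[nth b s' _]/(nth b (a :: s') (n - i.+1).+1) !QE//; last exact: ltnW.
  rewrite /Q subKn ?ltn_ord// subnSK ?ltn_ord// subKn; last exact/ltnW/ltn_ord.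
  by rewrite /A /B; ring.
have := telescope_product' A B n.
have -> : A 0%N = 0 by rewrite /A P0 (_ : S - (S - b) = b) ?subrr//; ring.
have -> : B n = 0 by rewrite /B Pn (_ : S - (S - a) = a) ?subrr//; ring.
rewrite mulr0 mul0r subr0 => tele.
set S2 := \sum_(i < size s) _.
(* The cost of replacing the arbitrary tags [xi] by left end points. *)
pose S3 := \sum_(i < n) (g (S - xi i) - g (S - P i)) * (B i.+1 - B i).
have S2E : S2 = \sum_(i < n) A i * (B i.+1 - B i) + S3.
  rewrite /S2 /S3 -big_split /=; apply: eq_bigr => i _.
  by rewrite -[nth (S - a) s i]/(P i.+1) -/(P i) /A /B; ring.
have hS3 : `|S3| <= K * K * d3 * (b - a).
  have -> : b - a = (S - a) - (S - b) by ring.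
  apply: (partition_sum_bound (F := fun i => (g (S - xi i) - g (S - P i)) * (B i.+1 - B i)) ps) => i hi.
  have [_ [m3 /andP[x1 x2]]] := ms' i hi.
  have [b1 b2] := Pb i (ltnW hi); have [b3 b4] := Pb i.+1 hi.
  have y1 : S - xi i <= S - P i := lerB (lexx S) x1.
  have y2 : S - P i.+1 <= S - xi i := lerB (lexx S) x2.
  rewrite -/(P i.+1) -/(P i).
  have -> : K * K * d3 * (P i.+1 - P i) = (K * d3) * (K * (P i.+1 - P i)) by ring.
  rewrite normrM; apply: ler_pM => //.
    rewrite distrC; apply: le_trans (hg (S - xi i) (S - P i) (le_trans b3 y2) y1 b2) _.
    have -> : S - P i - (S - xi i) = xi i - P i by ring.
    by rewrite ler_wpM2l//; exact: le_trans (lerB x2 (lexx _)) (ltW m3).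
  rewrite /B distrC (_ : f (S - P i) - f a - (f (S - P i.+1) - f a) = f (S - P i) - f (S - P i.+1)); last by ring.
  apply: le_trans (hf (S - P i.+1) (S - P i) b3 (le_trans y2 y1) b2) _.
  by have -> : S - P i - (S - P i.+1) = P i.+1 - P i by ring.
have hS3' : `|S3| <= e'.
  apply: le_trans hS3 _.
  have -> : K * K * d3 * (b - a) = e' * ((K * K * (b - a)) / (K * K * (b - a) + 1)) by rewrite /d3; ring.
  by apply: ler_piMr; [exact: ltW|rewrite ler_pdivrMr// mul1r lerDl].
have -> : S2 - I = (S1 - I) + S3.
  by rewrite S2E S1E; move: tele; set X := \sum_(i < n) _; set Y := \sum_(i < n) _; lra.
by apply: le_lt_trans (ler_normD _ _) _; rewrite /e' in hS1 hS3'; lra.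
Qed.

End RiemannStieltjes.

(** * Bounds, Chen relations and the symmetric part of the second level *)

Section Drivers.
Context {R : realType} {d : nat}.
Variable al : R.
Hypothesis al_gt : 3^-1 < al.
Hypothesis al_lt : al < 2^-1.
Implicit Types (w L : two_param R d) (T S W : R).

Definition rough_bounds T W w := forall s t, 0 <= s -> s <= t -> t <= T ->
  `|rp1 w s t| <= W * (t - s) `^ al /\ `|rp2 w s t| <= W * (t - s) `^ al ^+ 2.

(** The properties of a geometric rough path from which the estimates on solutions are made, with
    one constant [W] for its size. They are stable under restriction, time reversal and small
    perturbation within geometric rough paths. *)
Record driver T W w : Prop := {
  driver_chen1 : forall s u t, 0 <= s -> s <= u -> u <= t -> t <= T ->
    rp1 w s t = rp1 w s u + rp1 w u t ;
  driver_chen2 : forall s u t, 0 <= s -> s <= u -> u <= t -> t <= T ->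
    rp2 w s t = rp2 w s u + rp2 w u t + (rp1 w s u)^T *m rp1 w u t ;
  driver_bounds : rough_bounds T W w ;
  driver_symmetric : forall s t, 0 <= s -> s <= t -> t <= T ->
    rp2 w s t + (rp2 w s t)^T = (rp1 w s t)^T *m rp1 w s t }.

Lemma powR_double (x : R) : x `^ (2 * al) = (x `^ al) ^+ 2.
Proof. by rewrite mulrC powRrM powR_mulrn// powR_ge0. Qed.

Lemma rough_path_bounds T w : rough_path al T w -> exists2 W, 0 <= W & rough_bounds T W w.
Proof.
move=> [_ _ c1 c2 [[W1 h1] [W2 h2]]].
exists (Num.max 0 (Num.max W1 W2)); first by rewrite le_max lexx.
set W := Num.max _ _ => s t s0 st tT.
have [W1W W2W] : W1 <= W /\ W2 <= W by rewrite /W !le_max !lexx !orbT.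
have W0 : 0 <= W by rewrite /W le_max lexx.
move: st; rewrite le_eqVlt => /predU1P[st|st].
  (* The Hölder quotients do not cover the diagonal; there the Chen relations at s = u = t force
     both levels to vanish. *)
  have z1 : rp1 w s s = 0.
    have sT : s <= T by rewrite st.
    by apply: (@addrI _ (rp1 w s s)); rewrite addr0 -c1.
  have z2 : rp2 w s s = 0.
    have sT : s <= T by rewrite st.
    apply: (@addrI _ (rp2 w s s)); rewrite addr0 {3}(c2 s s s)// z1 mulmx0 addr0.
    by [].
  by rewrite -st z1 z2 !normr0 !mulr_ge0 ?exprn_ge0 ?powR_ge0.
have p0 : 0 < (t - s) `^ al by rewrite powR_gt0// subr_gt0.
split.
  rewrite -ler_pdivrMr//; apply: le_trans W1W; apply: h1.
  by exists s, t; split.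
rewrite -powR_double -ler_pdivrMr ?powR_gt0 ?subr_gt0//; apply: le_trans W2W; apply: h2.
by exists s, t; split.
Qed.

(** The constant [C] witnesses that the quotients are bounded above; without this [sup] would be a
    default value. *)
Lemma holder_norm_ge {V : normedModType R} T beta (f : R -> R -> V) (C : R) :
  (forall s t, 0 <= s -> s < t -> t <= T -> `|f s t| <= C * (t - s) `^ beta) ->
  forall s t, 0 <= s -> s < t -> t <= T -> `|f s t| <= holder_norm T beta f * (t - s) `^ beta.
Proof.
move=> hC s t s0 st tT.
have p0 s' t' : s' < t' -> 0 < (t' - s') `^ beta by move=> ?; rewrite powR_gt0// subr_gt0.
rewrite -ler_pdivrMr ?p0//; apply: ub_le_sup; last by exists s, t; split.
exists C => _ [s' [t' [s'0 st' tT' ->]]].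
by rewrite ler_pdivrMr ?p0//; exact: hC.
Qed.

Lemma holder_norm_le {V : normedModType R} T beta (f : R -> R -> V) (C : R) : 0 <= C ->
  (forall s t, 0 <= s -> s < t -> t <= T -> `|f s t| <= C * (t - s) `^ beta) ->
  holder_norm T beta f <= C.
Proof.
move=> C0 hC; rewrite /holder_norm.
(* There are no quotients when the interval has no two points; the supremum of the empty set is
   0. *)
have [->|/set0P ne] := eqVneq (holder_quotients T beta f) set0; first by rewrite sup0.
apply: ge_sup => // _ [s' [t' [s'0 st' tT' ->]]].
by rewrite ler_pdivrMr ?powR_gt0 ?subr_gt0//; exact: hC.
Qed.

(** The pointwise form of a bound by [e] on [rough_dist]: free of suprema, and therefore easy to
    restrict, reverse and use along filters. *)
Definition rough_close T e w w' := forall s t, 0 <= s -> s <= t -> t <= T ->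
  `|rp1 w s t - rp1 w' s t| <= e * (t - s) `^ al /\
  `|rp2 w s t - rp2 w' s t| <= e * (t - s) `^ al ^+ 2.

Lemma rough_dist_close T e W W' w w' :
  rough_bounds T W w -> rough_bounds T W' w' -> rough_dist al T w w' < e ->
  rough_close T e w w'.
Proof.
move=> hw hw' hd s t s0 st tT.
have [hw1 hw2] := hw _ _ s0 st tT; have [hw1' hw2'] := hw' _ _ s0 st tT.
move: hd; rewrite /rough_dist gt_max => /andP[/ltW d1 /ltW d2].
move: (st); rewrite le_eqVlt => /predU1P[est|lst].
  have e0 : (t - s) `^ al = 0 by rewrite est subrr powR0// lt0r_neq0// al_gt0.
  move: hw1 hw2 hw1' hw2'; rewrite e0 expr0n !mulr0 !normr_le0.
  by move=> /eqP -> /eqP -> /eqP -> /eqP ->; rewrite !subrr !eqxx.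
have h1 := @holder_norm_ge _ T al (fun s t => rp1 w s t - rp1 w' s t) (W + W').
have h2 := @holder_norm_ge _ T (2 * al) (fun s t => rp2 w s t - rp2 w' s t) (W + W').
split.
  apply: le_trans (h1 _ s t s0 lst tT) _.
    move=> s' t' s0' st' tT'; rewrite mulrDl; apply: le_trans (ler_normB _ _) _.
    by apply: lerD; [have [] := hw _ _ s0' (ltW st') tT'|have [] := hw' _ _ s0' (ltW st') tT'].
  by rewrite ler_wpM2r ?powR_ge0.
rewrite -powR_double; apply: le_trans (h2 _ s t s0 lst tT) _.
  move=> s' t' s0' st' tT'; rewrite powR_double mulrDl; apply: le_trans (ler_normB _ _) _.
  by apply: lerD; [have [] := hw _ _ s0' (ltW st') tT'|have [] := hw' _ _ s0' (ltW st') tT'].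
by rewrite ler_wpM2r ?powR_ge0.
Qed.

Lemma rough_close_dist T e w w' : 0 <= e -> rough_close T e w w' ->
  rough_dist al T w w' <= e.
Proof.
move=> e0 h; rewrite /rough_dist ge_max; apply/andP; split; apply: holder_norm_le => //.
  by move=> s t s0 st tT; have [] := h _ _ s0 (ltW st) tT.
by move=> s t s0 st tT; rewrite powR_double; have [] := h _ _ s0 (ltW st) tT.
Qed.

Let coordinate_lipschitz T (v : R -> 'rV[R]_d) (K : R) j :
  (forall s t, 0 <= s <= T -> 0 <= t <= T -> `|v s - v t| <= K * `|s - t|) ->
  forall a b, 0 <= a -> b <= T -> lipschitz_on (fun u => v u 0 j) K a b.
Proof.
move=> hK a b a0 bT s t as_ st tb.
have := coord_le_norm (v t - v s) 0 j; rewrite !mxE => /le_trans; apply.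
apply: le_trans (hK _ _ _ _) _; rewrite ?ger0_norm ?subr_ge0//; apply/andP; split; lra.
Qed.

Lemma natural_lift_quadratic T (v : R -> 'rV[R]_d) L : lipschitz_path T v -> natural_lift T v L ->
  exists2 K, 0 <= K & forall s t, 0 <= s -> s <= t -> t <= T ->
    `|rp1 L s t| <= K * (t - s) /\ `|rp2 L s t| <= K * K * (t - s) ^+ 2.
Proof.
move=> [_ [K0 hK0]] hL; pose K := Num.max 0 K0.
have K_ge0 : 0 <= K by rewrite /K le_max lexx.
have hK s t : 0 <= s <= T -> 0 <= t <= T -> `|v s - v t| <= K * `|s - t|.
  move=> hs ht; apply: le_trans (hK0 _ _ hs ht) _.
  by rewrite ler_wpM2r// /K le_max lexx orbT.
exists K => // s t s0 st tT; have [-> hI] := hL _ _ s0 st tT.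
split.
  apply: le_trans (hK _ _ _ _) _; rewrite ?ger0_norm ?subr_ge0//; apply/andP; split; lra.
apply: norm_le_coord; first by rewrite !mulr_ge0 ?exprn_ge0 ?subr_ge0.
move=> j k; have hj := coordinate_lipschitz j hK s0 tT.
have := @RS_integral_bound _ _ _ s t _ (K * (t - s)) K st _ K_ge0 _ _ (hI j k).
have -> : K * K * (t - s) ^+ 2 = K * (t - s) * K * (t - s) by ring.
apply; first by rewrite mulr_ge0// subr_ge0.
  move=> u su ut; apply: le_trans (hj _ _ (lexx s) su ut) _.
  by rewrite ler_wpM2l//; lra.
exact: (coordinate_lipschitz k hK s0 tT).
Qed.

Lemma natural_lift_bounds T (v : R -> 'rV[R]_d) L : lipschitz_path T v -> natural_lift T v L ->
  exists2 W, 0 <= W & rough_bounds T W L.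
Proof.
move=> hv hL; have [K K0 hK] := natural_lift_quadratic hv hL.
have al1 : 0 < 1 - al by move: al_lt; lra.
(* On [0, T] one has t = t^(1 - al) t^al <= C t^al, which turns Lipschitz bounds into Hölder
   bounds. *)
pose c := Num.max 1 T; pose C := c `^ (1 - al).
have C0 : 0 <= C by exact: powR_ge0.
have hC t : 0 <= t -> t <= T -> t <= C * t `^ al.
  move=> t0 tT; move: (t0); rewrite le_eqVlt => /predU1P[<-|tp].
    by rewrite mulr_ge0// powR_ge0.
  rewrite -{1}(powRr1 t0) (_ : 1 = (1 - al) + al); last by ring.
  rewrite powRD; last by rewrite (gt_eqF tp) implybT.
  rewrite ler_wpM2r ?powR_ge0//; apply: ge0_ler_powR; first exact: ltW.
  - by rewrite nnegrE.
  - by rewrite nnegrE /c le_max ler01.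
  - by rewrite /c le_max tT orbT.
exists (K * C + K * K * C ^+ 2); first by rewrite addr_ge0 ?mulr_ge0 ?exprn_ge0.
move=> s t s0 st tT; have [h1 h2] := hK _ _ s0 st tT.
have tsC : t - s <= C * (t - s) `^ al by apply: hC; lra.
have p0 : 0 <= (t - s) `^ al by exact: powR_ge0.
split.
  apply: le_trans h1 _; rewrite mulrDl -mulrA ler_wpDr//.
    by rewrite !mulr_ge0 ?exprn_ge0.
  by rewrite ?mulrA -?mulrA ler_wpM2l.
apply: le_trans h2 _; rewrite mulrDl ler_wpDl//.
  by rewrite !mulr_ge0 ?exprn_ge0.
rewrite -[leRHS]mulrA -exprMn ler_wpM2l ?mulr_ge0// lerXn2r ?nnegrE ?subr_ge0// mulr_ge0//.
Qed.

Lemma natural_lift_symmetric T (v : R -> 'rV[R]_d) L : lipschitz_path T v -> natural_lift T v L ->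
  forall s t, 0 <= s -> s <= t -> t <= T ->
    rp2 L s t + (rp2 L s t)^T = (rp1 L s t)^T *m rp1 L s t.
Proof.
move=> [_ [K0 hK0]] hL s t s0 st tT; pose K := Num.max 0 K0.
have K_ge0 : 0 <= K by rewrite /K le_max lexx.
have hK s' t' : 0 <= s' <= T -> 0 <= t' <= T -> `|v s' - v t'| <= K * `|s' - t'|.
  move=> hs ht; apply: le_trans (hK0 _ _ hs ht) _.
  by rewrite ler_wpM2r// /K le_max lexx orbT.
have [-> hI] := hL _ _ s0 st tT.
apply/matrixP => j k; rewrite !mxE big_ord1 !mxE.
exact: (RS_integral_by_parts st K_ge0 (coordinate_lipschitz j hK s0 tT)
  (coordinate_lipschitz k hK s0 tT) (hI j k) (hI k j)).
Qed.

(** The Chen relations and bounds belong to [rough_path]; the symmetric part is known for natural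
    lifts, by integration by parts, and passes to the limit because both sides are continuous in the
    two levels. *)
Lemma geometric_driver T w : geometric_rough_path al T w -> exists2 W, 0 <= W & driver T W w.
Proof.
move=> [rw gw]; have [W W0 hW] := rough_path_bounds rw; exists W => //.
have [_ _ c1 c2 _] := rw.
split=> // s t s0 st tT.
apply/eqP; rewrite -subr_eq0 -normr_le0; apply/ler_addgt0Pl => e e0; rewrite addr0.
set X := _ - _.
pose p := (t - s) `^ al; have p0 : 0 <= p by exact: powR_ge0.
(* The summand 2 p^2 accounts for the second level and its transpose, the next two for the product
   of first levels, where [e1 <= 1] absorbs the quadratic error. *)
pose c := (2 * p ^+ 2 + 2 * W * p ^+ 2 + p ^+ 2 + 1).
have cp : 0 < c by rewrite /c ltr_wpDl// !addr_ge0 ?mulr_ge0 ?exprn_ge0.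
pose e1 := Num.min 1 (e / c).
have e10 : 0 < e1 by rewrite lt_min ltr01 divr_gt0.
have e11 : e1 <= 1 by rewrite ge_min lexx.
have e1c : e1 * c <= e by rewrite -ler_pdivlMr// ge_min lexx orbT.
have [v [L [hv hL hd]]] := gw _ e10.
have [WL WL0 hWL] := natural_lift_bounds hv hL.
have [h1 h2] := rough_dist_close hW hWL hd s0 st tT.
have sL := natural_lift_symmetric hv hL s0 st tT.
have [hw1 _] := hW _ _ s0 st tT.
rewrite -/p in h1 h2 hw1.
have -> : X = (rp2 w s t - rp2 L s t) + (rp2 w s t - rp2 L s t)^T
  - ((rp1 w s t)^T *m rp1 w s t - (rp1 L s t)^T *m rp1 L s t).
  by rewrite linearB /= -sL /X; zmod.
have hprod : `|(rp1 w s t)^T *m rp1 w s t - (rp1 L s t)^T *m rp1 L s t|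
    <= e1 * (2 * W * p ^+ 2 + p ^+ 2).
  apply: norm_le_coord.
    by rewrite mulr_ge0 ?addr_ge0 ?mulr_ge0 ?exprn_ge0// ltW.
  move=> j k; rewrite !mxE !big_ord1 !mxE.
  set a := rp1 w s t 0 j; set b := rp1 w s t 0 k; set a' := rp1 L s t 0 j; set b' := rp1 L s t 0 k.
  have ha : `|a - a'| <= e1 * p.
    by apply: le_trans h1; have := coord_le_norm (rp1 w s t - rp1 L s t) 0 j; rewrite !mxE.
  have hb : `|b - b'| <= e1 * p.
    by apply: le_trans h1; have := coord_le_norm (rp1 w s t - rp1 L s t) 0 k; rewrite !mxE.
  have hA : `|a| <= W * p by apply: le_trans hw1; exact: coord_le_norm.
  have hB : `|b| <= W * p by apply: le_trans hw1; exact: coord_le_norm.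
  have -> : a * b - a' * b' = a * (b - b') + (a - a') * b - (a - a') * (b - b') by ring.
  have m1 : `|a * (b - b')| <= W * p * (e1 * p) by rewrite normrM ler_pM.
  have m2 : `|(a - a') * b| <= e1 * p * (W * p) by rewrite normrM ler_pM.
  have m3 : `|(a - a') * (b - b')| <= e1 * p * (1 * p).
    by rewrite normrM ler_pM// (le_trans hb)// ler_wpM2r.
  apply: le_trans (ler_normB _ _) _; have := ler_normD (a * (b - b')) ((a - a') * b); lra.
apply: le_trans (ler_normB _ _) _.
have := ler_normD (rp2 w s t - rp2 L s t) (rp2 w s t - rp2 L s t)^T.
rewrite norm_trmx; move: hprod h2 e1c e10; rewrite /c.
set n1 := `|_ - _|; set n2 := `|_ - _|; set n3 := `|_ + _|; move=> *; nra.
Qed.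

Lemma driver_close T W w w' e : rough_bounds T W w -> rough_close T e w w' ->
  rough_bounds T (W + e) w'.
Proof.
move=> hw hc s t s0 st tT; have [h1 h2] := hw _ _ s0 st tT; have [c1 c2] := hc _ _ s0 st tT.
split.
  have -> : rp1 w' s t = rp1 w s t - (rp1 w s t - rp1 w' s t) by zmod.
  by rewrite mulrDl; apply: le_trans (ler_normB _ _) _; exact: lerD.
have -> : rp2 w' s t = rp2 w s t - (rp2 w s t - rp2 w' s t) by zmod.
by rewrite mulrDl; apply: le_trans (ler_normB _ _) _; exact: lerD.
Qed.

Lemma driver_restrict T S W w : S <= T -> driver T W w -> driver S W w.
Proof.
by move=> ST [h1 h2 h3 h4]; split; move=> *; (apply: h1 || apply: h2 || apply: h3 || apply: h4) => //; lra.
Qed.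

(** Transposition exchanges the factors of the cross term in the Chen relation, and the two signs of
    the first level cancel. *)
Lemma driver_reversal T S W w : 0 <= S <= T -> driver T W w -> driver S W (time_reversal S w).
Proof.
move=> /andP[S0 ST] [h1 h2 h3 h4]; split.
- move=> s u t s0 su ut tS /=; rewrite (h1 (S - t) (S - u) (S - s)); [|lra..].
  by rewrite opprD addrC.
- move=> s u t s0 su ut tS /=; rewrite (h2 (S - t) (S - u) (S - s)); [|lra..].
  rewrite !linearD /= trmx_mul trmxK [(- _)^T]linearN /= mulNmx mulmxN opprK.
  by congr (_ + _); exact: addrC.
- move=> s t s0 st tS /=; rewrite normrN norm_trmx.
  have -> : t - s = (S - s) - (S - t) by ring.
  by apply: h3; lra.
- move=> s t s0 st tS /=; rewrite trmxK [(- _)^T]linearN /= mulNmx mulmxN opprK addrC.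
  by apply: h4; lra.
Qed.

End Drivers.

(** * Time reversal preserves geometric rough paths *)

Section Reversal.
Context {R : realType} {d : nat}.
Variable al : R.
Hypothesis al_gt : 3^-1 < al.
Hypothesis al_lt : al < 2^-1.

Lemma time_reversal_involutive (S : R) (w : two_param R d) :
  time_reversal S (time_reversal S w) = w.
Proof.
case: w => w1 w2; rewrite /time_reversal /=; congr TwoParam; apply/funext => s; apply/funext => t.
  by rewrite opprK !subKr.
by rewrite trmxK !subKr.
Qed.

(** The reversed lift is the lift of the reversed path, shifted by [v S] so that it starts at 0; on
    the second level this is [RS_integral_reverse]. *)
Lemma natural_lift_reversal (T S : R) (v : R -> 'rV[R]_d) (L : two_param R d) : 0 <= S <= T ->
  lipschitz_path T v -> natural_lift T v L ->
  lipschitz_path S (fun t => v (S - t) - v S) /\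
  natural_lift S (fun t => v (S - t) - v S) (time_reversal S L).
Proof.
move=> /andP[S0 ST] [_ [K0 hK0]] hL; pose K := Num.max 0 K0.
have K_ge0 : 0 <= K by rewrite /K le_max lexx.
have hK s t : 0 <= s <= T -> 0 <= t <= T -> `|v s - v t| <= K * `|s - t|.
  move=> hs ht; apply: le_trans (hK0 _ _ hs ht) _.
  by rewrite ler_wpM2r// /K le_max lexx orbT.
split.
  split; first by rewrite subr0 subrr.
  exists K => s t /andP[s0 sS] /andP[t0 tS].
  have -> : v (S - s) - v S - (v (S - t) - v S) = v (S - s) - v (S - t) by zmod.
  have -> : `|s - t| = `|(S - s) - (S - t)| by rewrite distrC; congr (`|_|); ring.
  by apply: hK; apply/andP; split; lra.
move=> s t s0 st tS.
have Ss0 : 0 <= S - t by lra.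
have SsS : S - t <= S - s by lra.
have SsT : S - s <= T by lra.
have [e1 hI] := hL _ _ Ss0 SsS SsT.
split; first by rewrite /= e1 !opprB addrA subrK.
move=> j k; have -> : rp2 (time_reversal S L) s t j k = rp2 L (S - t) (S - s) k j by rewrite /= mxE.
have hl (i : 'I_d) : lipschitz_on (fun u => v u 0 i) K (S - t) (S - s).
  move=> a b a1 ab b1; have := coord_le_norm (v b - v a) 0 i; rewrite !mxE => /le_trans; apply.
  apply: le_trans (hK _ _ _ _) _; rewrite ?ger0_norm ?subr_ge0//; apply/andP; split; lra.
have := @RS_integral_reverse _ _ _ _ _ S _ _ SsS K_ge0 (hl k) (hl j) (hI k j).
rewrite !subKr; apply: RS_integral_ext => u.
  by rewrite !mxE; ring.
by move=> u'; rewrite !mxE; ring.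
Qed.

(** Reversing both a path and its approximating lift does not increase their distance. The
    approximation is taken within e / 2 because [rough_close] yields only a weak inequality. *)
Lemma geometric_reversal (T S : R) (w : two_param R d) : 0 <= S <= T ->
  geometric_rough_path al T w -> geometric_rough_path al S (time_reversal S w).
Proof.
move=> ST gw; have [W W0 hw] := geometric_driver al_gt al_lt gw.
have [h1 h2 h3 h4] := driver_reversal ST hw.
move: gw => [rw gw]; case/andP: (ST) => S0 S1.
split.
  have rev_cont (V : topologicalType) (f : R * R -> V) :
      {within triangle T, continuous f} ->
      {within triangle S, continuous (fun st => f (S - st.2, S - st.1))}.
    move=> cf.
    apply: (within_continuous_comp_sub (A := triangle T)) => //.
      move=> st; apply: (@continuous_pair _ _ _ (fun x : R * R => S - x.2) (fun x : R * R => S - x.1) st).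
        by apply: cvgB; [exact: cvg_cst|exact: cvg_snd].
      by apply: cvgB; [exact: cvg_cst|exact: cvg_fst].
    by move=> [s t] /= [/= s0 [st tS]]; split; [|split] => /=; lra.
  have [c1 c2 _ _ _] := rw.
  split => //.
  - by move=> x; apply: cvgN; exact: (rev_cont _ _ c1).
  - move=> x; apply: (@continuous_comp _ _ _ (fun st : subspace (triangle S) => rp2 w (S - st.2) (S - st.1)) trmx).
      exact: (rev_cont _ _ c2).
    exact: continuous_trmx.
  - split.
      exists W => _ [s [t [s0 st tS ->]]].
      rewrite ler_pdivrMr ?powR_gt0 ?subr_gt0//.
      by have [] := h3 _ _ s0 (ltW st) tS.
    exists W => _ [s [t [s0 st tS ->]]].
    rewrite ler_pdivrMr ?powR_gt0 ?subr_gt0// powR_double.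
    by have [] := h3 _ _ s0 (ltW st) tS.
move=> e e0; have e20 : 0 < e / 2 by rewrite divr_gt0.
have [v [L [hv hL hd]]] := gw _ e20.
have [WL WL0 hWL] := natural_lift_bounds al_lt hv hL.
have hc := rough_dist_close al_gt (driver_bounds hw) hWL hd.
have [hv' hL'] := natural_lift_reversal ST hv hL.
exists (fun t => v (S - t) - v S), (time_reversal S L); split=> //.
apply: (@le_lt_trans _ _ (e / 2)); last by rewrite ltr_pdivrMr// ltr_pMr// ltr1n.
apply: rough_close_dist; first exact: ltW.
move=> s t s0 st tS /=.
have -> : t - s = (S - s) - (S - t) by ring.
have [|||k1 k2] := hc (S - t) (S - s); [lra..|].
split.
  by rewrite -opprD normrN.
by rewrite -linearB norm_trmx.
Qed.

End Reversal.

(** * Charts and test functions *)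

Lemma open_setX {X Y : topologicalType} (A : set X) (B : set Y) :
  open A -> open B -> open (A `*` B).
Proof.
rewrite !openE => oA oB [x y] [/= Ax By].
by exists (A, B) => //; split; [exact: oA|exact: oB].
Qed.

Lemma open_preimage_in {X Y : topologicalType} (A : set X) (B : set Y) (f : X -> Y) :
  open A -> open B -> (forall x, A x -> {for x, continuous f}) ->
  open [set x | A x /\ B (f x)].
Proof.
move=> oA oB cf; rewrite openE => x [Ax Bfx].
have h1 : nbhs x A by exact: open_nbhs_nbhs.
have h2 : nbhs x (f @^-1` B) by apply: (cf _ Ax); exact: open_nbhs_nbhs.
by rewrite /interior; apply: filterS2 h1 h2 => y Ay By.
Qed.

Section MetricFacts.
Context {R : realType} {X : metricType R}.

Lemma mdist_lipschitz (x y z : X) : `|mdist x z - mdist y z| <= mdist x y.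
Proof.
rewrite ler_norml; apply/andP; split.
  by have := metric_triangle y x z; rewrite (metric_sym y x); lra.
by have := metric_triangle x y z; lra.
Qed.

Lemma continuous_mdist (z : X) : continuous (fun x => mdist x z).
Proof.
move=> x; apply/cvgrPdist_le => e e0; apply/nbhs_ballP; exists e => //= y.
rewrite ballEmdist /= => xy; apply: le_trans (mdist_lipschitz x y z) _; exact: ltW.
Qed.

Lemma open_mdist_ball (z : X) (r : R) : open [set x | mdist x z < r].
Proof.
rewrite openE => x /= xr; apply/nbhs_ballP; exists (r - mdist x z); first by rewrite /= subr_gt0.
move=> y; rewrite ballEmdist /= => xy; have := metric_triangle y x z.
by rewrite (metric_sym y x); lra.
Qed.

Lemma closed_mdist_ball (z : X) (r : R) : closed [set x | mdist x z <= r].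
Proof.
rewrite (_ : [set x | _] = (fun x => mdist x z) @^-1` [set y | y <= r])//.
by apply: preimage_closed; [move=> x _; exact: continuous_mdist|exact: closed_le].
Qed.

Lemma nbhs_mdistP (x : X) (A : set X) :
  nbhs x A <-> exists2 e : R, 0 < e & forall y, mdist x y < e -> A y.
Proof.
rewrite -nbhs_ballE /nbhs_ball /nbhs_ball_; split=> [[e e0 sub]|[e e0 h]]; exists e => //= y.
  by move=> xy; apply: sub; rewrite /= ballEmdist.
by rewrite ballEmdist => /h.
Qed.

End MetricFacts.

Section NormBalls.
Context {R : realType} {p : nat}.

Lemma closed_norm_ball (y0 : 'rV[R]_p) (r : R) : closed [set y : 'rV[R]_p | `|y - y0| <= r].
Proof.
rewrite (_ : [set y | _] = (fun y : 'rV[R]_p => `|y - y0|) @^-1` [set y : R | y <= r])//.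
apply: preimage_closed; last exact: closed_le.
move=> y _; apply: (@continuous_comp _ _ _ (fun y : 'rV[R]_p => y - y0) Num.norm).
  by apply: (@cvgD _ _ _ (nbhs y) _ id (fun=> - y0)); [exact: cvg_id|exact: cvg_cst].
exact: norm_continuous.
Qed.

Lemma compact_norm_ball (y0 : 'rV[R]_p) (r : R) : compact [set y : 'rV[R]_p | `|y - y0| <= r].
Proof.
apply: bounded_closed_compact; last exact: closed_norm_ball.
exists (`|y0| + r); split; first exact: num_real.
move=> M hM y /= hy; have -> : y = y0 + (y - y0) by rewrite addrC subrK.
by apply: le_trans (ler_normD _ _) _; apply: le_trans (ltW hM); rewrite lerD2l.
Qed.

Lemma convex_norm_ball (y0 x v : 'rV[R]_p) (r t : R) :
  `|x - y0| <= r -> `|x + v - y0| <= r -> 0 <= t -> t <= 1 -> `|x + t *: v - y0| <= r.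
Proof.
move=> h1 h2 t0 t1.
have -> : x + t *: v - y0 = (1 - t) *: (x - y0) + t *: (x + v - y0).
  by apply/rowP => i; rewrite !mxE; ring.
apply: le_trans (ler_normD _ _) _; rewrite !normrZ !ger0_norm//; last by lra.
have := ler_wpM2l t0 h2; have : 0 <= 1 - t by lra.
move=> t2; have := ler_wpM2l t2 h1; lra.
Qed.

Lemma diam_norm_ball (y0 x y : 'rV[R]_p) (r : R) :
  `|x - y0| <= r -> `|y - y0| <= r -> `|y - x| <= 2 * r.
Proof.
move=> h1 h2; have -> : y - x = (y - y0) - (x - y0) by zmod.
by apply: le_trans (ler_normB _ _) _; lra.
Qed.

End NormBalls.

(** * Fields and functions in charts, and global test functions *)

Section Foliation.
Context {R : realType} {p : nat} {M Z : metricType R} (F : foliated_space p M Z).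
Implicit Types (a b : fol_index F) (V : vfield F).
Notation E := 'rV[R]_p.

Definition fbox a := chart_box (fol_chart a).
Definition fdom a := chart_dom (fol_chart a).
Definition fmap_ a := chart_map (fol_chart a).
Definition finv_ a := chart_inv (fol_chart a).

Lemma open_fbox a : open (fbox a).
Proof. by apply: open_setX; [exact: chart_base_open|exact: chart_trans_open]. Qed.

Lemma open_fdom a : open (fdom a). Proof. exact: chart_dom_open. Qed.

Lemma fmap_continuous a m : fdom a m -> {for m, continuous (fmap_ a)}.
Proof.
move=> am; have := @chart_map_continuous _ _ _ _ (fol_chart a).
rewrite continuous_open_subspace; last exact: chart_dom_open.
by move=> h; apply: h; rewrite inE.
Qed.

Lemma finv_continuous a q : fbox a q -> {for q, continuous (finv_ a)}.
Proof.
move=> aq; have := @chart_inv_continuous _ _ _ _ (fol_chart a).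
rewrite continuous_open_subspace; last exact: open_fbox.
by move=> h; apply: h; rewrite inE.
Qed.

Lemma fmap_box a m : fdom a m -> fbox a (fmap_ a m).
Proof. exact: chart_map_box. Qed.

Lemma finv_dom a q : fbox a q -> fdom a (finv_ a q).
Proof. exact: chart_inv_dom. Qed.

Lemma fmapK a m : fdom a m -> finv_ a (fmap_ a m) = m.
Proof. exact: chart_mapK. Qed.

Lemma finvK a q : fbox a q -> fmap_ a (finv_ a q) = q.
Proof. exact: chart_invK. Qed.

Definition foverlap a b := [set q | fbox a q /\ fdom b (finv_ a q)].

Lemma transition_local a b k q : foverlap a b q -> exists N : set (E * Z),
  [/\ open N, N q, N `<=` foverlap a b &
   exists (f1 : E * Z -> E) (f2 : Z -> Z),
     [/\ CL k N f1, (forall r, N r -> {for r, continuous (fun r : E * Z => f2 r.2)}),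
      (forall r, N r -> fmap_ b (finv_ a r) = (f1 r, f2 r.2)) &
      (forall r, N r -> fbox b (f1 r, f2 r.2))]].
Proof.
move=> abq; have [N [oN Nq Nab [f1 [f2 [cf1 _ hN]]]]] := @fol_transition _ _ _ _ F a b k q abq.
exists N; split=> //; exists f1, f2.
have hN' r : N r -> fmap_ b (finv_ a r) = (f1 r, f2 r.2) by move=> /hN.
split=> // r Nr; last first.
  by rewrite -hN'//; apply: fmap_box; have [] := Nab _ Nr.
have [ar br] := Nab _ Nr.
have c1 : {for r, continuous (fun r => (fmap_ b (finv_ a r)).2)}.
  apply: (@continuous_comp _ _ _ (fun r => fmap_ b (finv_ a r)) snd); last exact: cvg_snd.
  by apply: continuous_comp; [exact: finv_continuous|exact: fmap_continuous].
rewrite /prop_for /continuous_at in c1 *.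
have -> : f2 r.2 = (fmap_ b (finv_ a r)).2 by rewrite hN'.
apply: cvg_trans c1; apply: near_eq_cvg.
have := open_nbhs_nbhs (conj oN Nr); apply: filterS => s Ns.
by rewrite hN'.
Qed.

Lemma pder_change_chart a b (g : M -> R) m i : fdom a m -> fdom b m ->
  CL 1 (fbox b) (g \o finv_ b) ->
  pder i (g \o finv_ a) (fmap_ a m) =
  \sum_l pder i (fun q => (fmap_ b (finv_ a q)).1) (fmap_ a m) 0 l *
         pder l (g \o finv_ b) (fmap_ b m).
Proof.
move=> am bm cg; set q := fmap_ a m.
have abq : foverlap a b q by split; [exact: fmap_box|rewrite fmapK].
have [N [oN Nq Nab [f1 [f2 [cf1 cf2 hN hb]]]]] := transition_local 1 abq.
have e1 : pder i (fun q => (fmap_ b (finv_ a q)).1) q = pder i f1 q.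
  by apply: (pder_near_eq i oN) => // r Nr; rewrite hN.
have e2 : pder i (g \o finv_ a) q = pder i (fun r => (g \o finv_ b) (f1 r, f2 r.2)) q.
  apply: (pder_near_eq i oN) => // r Nr /=; rewrite -hN// fmapK//.
  by have [] := Nab _ Nr.
have := @is_derive_comp_leafwise _ _ _ _ _ N (fbox b) (g \o finv_ b) f1 f2 i q oN (@open_fbox b) cg cf1 Nq (hb _ Nq).
move=> /(@derive_val _ _ _ _ _ _ _) dv.
have -> : fmap_ b m = (f1 q, f2 q.2) by rewrite -hN// fmapK.
by rewrite e2 e1 /pder dv.
Qed.

Definition lie a V (G : E * Z -> R) (q : E * Z) : R :=
  \sum_l V a (finv_ a q) 0 l * pder l G q.

(** [vf_app] uses one chosen chart around each point. The Jacobian of the transition in the chain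
    rule for [g] is the one in [tangent], so any chart gives the same value. *)
Lemma vf_app_chart V (g : M -> R) a m : tangent V -> leafwise_function F 1 g ->
  fdom a m -> vf_app V g m = lie a V (g \o finv_ a) (fmap_ a m).
Proof.
move=> tV cg am; rewrite /vf_app /lie fmapK//.
have bm : fdom (chart_at F m) m by exact: (projT2 (cid (fol_cover F m))).
set b := chart_at F m in bm *.
rewrite (tV a b m am bm).
under [RHS]eq_bigr do rewrite (pder_change_chart _ am bm (cg b)) mulr_sumr.
rewrite exchange_big /=; apply: eq_bigr => l _.
rewrite summxE mulr_suml; apply: eq_bigr => i _.
by rewrite mxE mulrA.
Qed.

Lemma leafwise_le k k' (g : M -> R) : (k <= k')%N -> leafwise_function F k' g -> leafwise_function F k g.
Proof. by move=> kk hg a; exact: CL_le (hg a). Qed.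

Lemma CL_lie k V (G : E * Z -> R) a (O : set (E * Z)) : open O -> O `<=` fbox a ->
  leafwise_vfield k V -> CL k.+1 O G -> CL k O (lie a V G).
Proof.
move=> oO Oa [tV cV] cG; apply: CL_sum => // l; apply: CL_mul => //.
  by apply: (CL_entry l oO); apply: CL_sub (cV a).
exact: CL_pder.
Qed.

Lemma vf_app_finv V (g : M -> R) a q : tangent V -> leafwise_function F 1 g ->
  fbox a q -> vf_app V g (finv_ a q) = lie a V (g \o finv_ a) q.
Proof. by move=> tV hg aq; rewrite (vf_app_chart tV hg (finv_dom aq)) finvK. Qed.

Lemma leafwise_vf_app k V (g : M -> R) : leafwise_vfield k V -> leafwise_function F k.+1 g ->
  leafwise_function F k (vf_app V g).
Proof.
move=> hV hg a; apply: (@CL_eq _ _ _ _ _ _ (lie a V (g \o finv_ a))); first exact: open_fbox.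
  move=> q aq; rewrite /= vf_app_finv//; first by case: hV.
  exact: leafwise_le hg.
by apply: CL_lie => //; exact: open_fbox.
Qed.

Lemma lie_near_eq a V (O : set (E * Z)) (G G' : E * Z -> R) q : open O -> O q ->
  (forall r, O r -> G r = G' r) -> lie a V G q = lie a V G' q.
Proof. by move=> oO Oq GG; apply: eq_bigr => l _; rewrite (pder_near_eq l oO GG). Qed.

Lemma lie_leaf_constant a V (h : Z -> R) q : lie a V (fun q => h q.2) q = 0.
Proof. by rewrite /lie big1// => l _; rewrite /pder /= derive_cst mulr0. Qed.

Lemma lie_coordinate a V i q : lie a V (fun q => q.1 0 i) q = V a (finv_ a q) 0 i.
Proof.
rewrite /lie (bigD1 i)//= pder_coord eqxx mulr1 big1 ?addr0// => l li.
by rewrite pder_coord eq_sym (negbTE li) mulr0.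
Qed.

Definition field_in a V (q : E * Z) : E := V a (finv_ a q).

(** The derivative of the components of V' along V: applied to a coordinate function, the operator V
    V' gives an entry of this vector, see [lie_field]. *)
Definition second_field a V V' (q : E * Z) : E :=
  \sum_l field_in a V q 0 l *: pder l (field_in a V') q.

Lemma lie_field a V V' i q : leafwise_vfield 1 V' -> fbox a q ->
  lie a V (fun q => field_in a V' q 0 i) q = second_field a V V' q 0 i.
Proof.
move=> [_ cV] aq; rewrite /lie /second_field summxE; apply: eq_bigr => l _.
by rewrite (pder_entry _ _ (cV a) aq) mxE.
Qed.

Lemma CL_second_field k V V' a i : leafwise_vfield k V -> leafwise_vfield k.+1 V' ->
  CL k (fbox a) (fun q => second_field a V V' q 0 i).
Proof.
move=> [_ cV] [_ cV']; have oa := @open_fbox a.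
apply: (@CL_eq _ _ _ _ _ _ (fun q => \sum_l field_in a V q 0 l * pder l (field_in a V') q 0 i)) => //.
  by move=> q aq; rewrite /second_field summxE; apply: eq_bigr => l _; rewrite mxE.
apply: CL_sum => // l; apply: CL_mul => //; apply: CL_entry => //; first exact: cV.
by apply: CL_pder; exact: cV'.
Qed.

Definition extend_by_zero a (G : E * Z -> R) (m : M) : R :=
  if `[< fdom a m >] then G (fmap_ a m) else 0.

Lemma extend_by_zero_finv a G q : fbox a q -> extend_by_zero a G (finv_ a q) = G q.
Proof.
by move=> aq; rewrite /extend_by_zero asboolT ?finvK//; exact: finv_dom.
Qed.

(** The image of the compact [K] is closed in [M], so the domain of [a] and the complement of this
    image are open and cover [M]. On the former the extension is [G] composed with a transition map,
    on the latter it vanishes. *)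
Lemma leafwise_extend_by_zero k a (G : E * Z -> R) (K : set (E * Z)) :
  compact K -> K `<=` fbox a -> CL k (fbox a) G ->
  (forall q, fbox a q -> ~ K q -> G q = 0) ->
  leafwise_function F k (extend_by_zero a G).
Proof.
move=> cK Ka cG G0 b; have ob := @open_fbox b.
have clK : closed (finv_ a @` K).
  apply: compact_closed; first exact: metric_hausdorff.
  apply: continuous_compact => //; apply: continuous_in_subspaceT => q.
  by rewrite inE => /Ka; exact: finv_continuous.
apply: CL_local => // q bq; have [am|nam] := pselect (fdom a (finv_ b q)).
  have [N [oN Nq Nab [f1 [f2 [cf1 cf2 hN hb]]]]] := transition_local k (conj bq am : foverlap b a q).
  exists N; split=> //.
  apply: (@CL_eq _ _ _ _ _ _ (fun r => G (f1 r, f2 r.2))) => //.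
    move=> r Nr; have [br ar] := Nab _ Nr.
    by rewrite /= /extend_by_zero asboolT// hN.
  exact: (@CL_comp _ _ _ _ _ k N (fbox a) G f1 f2 oN (@open_fbox a)).
exists [set r | fbox b r /\ (~` (finv_ a @` K)) (finv_ b r)]; split.
- by apply: open_preimage_in => //; [exact: closed_openC|exact: finv_continuous].
- split=> // -[r Kr e]; apply: nam; rewrite -e.
  exact/finv_dom/Ka.
- have oN : open [set r | fbox b r /\ (~` (finv_ a @` K)) (finv_ b r)].
    by apply: open_preimage_in => //; [exact: closed_openC|exact: finv_continuous].
  apply: (@CL_eq _ _ _ _ _ _ (fun=> 0)) => //; last exact: CL_cst.
  move=> r [br nK]; rewrite /= /extend_by_zero; case: asboolP => // ar.
  rewrite G0//; first exact: fmap_box.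
  by move=> Kr; apply: nK; exists (fmap_ a (finv_ b r)) => //; rewrite fmapK.
Qed.


Definition region (q0 : E * Z) (r sig : R) : set (E * Z) :=
  [set y : E | `|y - q0.1| <= r] `*` [set z : Z | mdist z q0.2 <= sig].

(* The outer [1 - pospow 4 (1 - _)] makes it equal to [1], and not only
   positive, near [y0]; it is of class C^3 since [pospow 4] is. *)
Definition cutoff (y0 : E) (rho : R) (y : E) : R :=
  1 - pospow 4 (1 - pospow 4 (2 - \sum_i ((y 0 i - y0 0 i) / rho) ^+ 2)).

Lemma cutoff1 (y0 : E) (rho : R) (y : E) : \sum_i ((y 0 i - y0 0 i) / rho) ^+ 2 <= 1 ->
  cutoff y0 rho y = 1.
Proof.
move=> h; rewrite /cutoff pospow_neg ?subr0//.
rewrite pospow_pos; last by lra.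
by rewrite subr_le0 exprn_ege1//; lra.
Qed.

Lemma cutoff0 (y0 : E) (rho : R) (y : E) : 2 <= \sum_i ((y 0 i - y0 0 i) / rho) ^+ 2 ->
  cutoff y0 rho y = 0.
Proof.
move=> h; have h' : 2 - \sum_i ((y 0 i - y0 0 i) / rho) ^+ 2 <= 0 by lra.
rewrite /cutoff (pospow_neg 3 h') subr0.
by rewrite pospow_pos// expr1n subrr.
Qed.

Lemma CL_quadratic k (O : set (E * Z)) (y0 : E) (rho : R) : open O ->
  CL k O (fun q : E * Z => \sum_i ((q.1 0 i - y0 0 i) / rho) ^+ 2 : R).
Proof.
move=> oO; apply: CL_sum => // i.
have cl : CL k O (fun q : E * Z => (q.1 0 i - y0 0 i) / rho : R).
  apply: (@CL_mul _ _ _ _ _ (fun q : E * Z => q.1 0 i - y0 0 i) (fun=> rho^-1)) => //; last exact: CL_cst.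
  by apply: (@CL_add _ _ _ _ _ _ (fun q : E * Z => q.1 0 i : R) (fun=> - y0 0 i)) => //; [exact: CL_coordinate|exact: CL_cst].
exact: (CL_mul oO cl cl).
Qed.

Lemma CL_cst_sub k (O : set (E * Z)) (c : R) (f : E * Z -> R) : open O ->
  CL k O f -> CL k O (fun q => c - f q).
Proof.
move=> oO cf; apply: (@CL_add _ _ _ _ _ _ (fun=> c) (fun q => - f q)) => //.
  exact: CL_cst.
exact: CL_opp.
Qed.

Lemma CL_cutoff k (O : set (E * Z)) (y0 : E) (rho : R) : (k < 4)%N -> open O ->
  CL k O (fun q : E * Z => cutoff y0 rho q.1).
Proof.
move=> k4 oO; apply: CL_cst_sub => //; apply: CL_pospow => //.
apply: CL_cst_sub => //; apply: CL_pospow => //; apply: CL_cst_sub => //.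
exact: CL_quadratic.
Qed.

(** Supplies the test functions: near [q0], every function of class C_L^3 on a chart agrees with a
    globally defined one. In the transverse direction the cutoff is merely continuous, which
    [CL_leaf_constant] allows, and its support is compact because [Z] is locally compact. *)
Lemma local_extension a q0 : fbox a q0 -> exists r sig : R, exists O : set (E * Z),
  [/\ 0 < r, 0 < sig, open O, O `<=` fbox a & region q0 r sig `<=` O] /\
  [/\ compact (region q0 r sig) &
   forall G : E * Z -> R, CL 3 (fbox a) G ->
     exists2 f : M -> R, leafwise_function F 3 f & forall q, O q -> f (finv_ a q) = G q].
Proof.
case: q0 => y0 z0 [/= by0 tz0].
have [rho0 rho00 hrho] : exists2 e : R, 0 < e & forall y, `|y - y0| <= e -> chart_base (fol_chart a) y.
  have /nbhs_ballP[e /= e0 sub] : nbhs y0 (chart_base (fol_chart a)).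
    by apply: open_nbhs_nbhs; split => //; exact: chart_base_open.
  exists (e / 2); first by rewrite divr_gt0.
  move=> w wy; apply: sub; rewrite mx_norm_ball /ball_ /= distrC.
  by apply: le_lt_trans wy _; rewrite ltr_pdivrMr// ltr_pMr// ltr1n.
have [e1 e10 h1] : exists2 e : R, 0 < e & forall z, mdist z0 z < e -> chart_trans (fol_chart a) z.
  apply/nbhs_mdistP; apply: open_nbhs_nbhs; split => //; exact: chart_trans_open.
have [U nU [cU clU]] : exists2 U : set Z, nbhs z0 U & compact U /\ closed U.
  have [U nU hU] := @fol_trans_locally_compact _ _ _ _ F z0 I.
  by exists U => //; apply: filterS (nU : nbhs z0 (fun z => [set: Z] z -> U z)) => z; exact.
have [e2 e20 h2] := (nbhs_mdistP z0 U).1 nU.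
(* The ball of radius 2 * sig, which carries the transverse cutoff, lies in the chart and in the
   compact neighbourhood [U]. *)
pose sig := Num.min e1 e2 / 3.
have sig0 : 0 < sig by rewrite /sig divr_gt0// lt_min e10 e20.
have [sig1 sig2] : 2 * sig < e1 /\ 2 * sig < e2.
  have : Num.min e1 e2 <= e1 by rewrite ge_min lexx.
  have : Num.min e1 e2 <= e2 by rewrite ge_min lexx orbT.
  by move: sig0; rewrite /sig; lra.
pose rho := rho0 / 2.
have rho0' : 0 < rho by rewrite divr_gt0.
pose Q (y : E) := \sum_i ((y 0 i - y0 0 i) / rho) ^+ 2.
pose h (z : Z) : R := Num.max 0 (Num.min 1 (2 - mdist z z0 / sig)).
have c1 : continuous (fun z : Z => 2 - mdist z z0 / sig : R).
  move=> z; apply: cvgB; first exact: cvg_cst.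
  by apply: cvgMr_tmp; exact: continuous_mdist.
have ch : continuous h.
  move=> z; apply: (@continuous_max _ _ (fun=> 0) (fun z => Num.min 1 (2 - mdist z z0 / sig))); first exact: cvg_cst.
  apply: (@continuous_min _ _ (fun=> 1) (fun z => 2 - mdist z z0 / sig)); first exact: cvg_cst.
  exact: c1.
pose K := region (y0, z0) (2 * rho) (2 * sig).
have Ka : K `<=` fbox a.
  move=> [y z] [/= hy hz]; split => /=.
    by apply: hrho; apply: le_trans hy _; rewrite /rho; lra.
  by apply: h1; rewrite metric_sym; lra.
have cK s : s <= 2 * sig -> compact [set z | mdist z z0 <= s].
  move=> ss; apply: (subclosed_compact _ cU); first exact: closed_mdist_ball.
  by move=> z /= hz; apply: h2; rewrite metric_sym; lra.
have sumQ y c : 0 <= c -> `|y - y0| <= c * rho -> Q y <= p%:R * c ^+ 2.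
  move=> c0 hy; rewrite /Q.
  have hi i : ((y 0 i - y0 0 i) / rho) ^+ 2 <= c ^+ 2.
    rewrite -real_normK ?num_real// lerXn2r ?nnegrE//.
    rewrite normrM normfV (gtr0_norm rho0') ler_pdivrMr//.
    by apply: le_trans hy; have := coord_le_norm (y - y0) 0 i; rewrite !mxE.
  apply: le_trans (ler_sum _ (fun i _ => hi i)) _.
  by rewrite sumr_const card_ord mulr_natl.
(* For |y - y0| <= r in the max norm the sum of squares [Q y] is at most p / (p + 1)^2 < 1, so the
   cutoff equals 1 there. *)
pose r := rho / (p%:R + 1).
have p1 : 0 < (p%:R + 1 : R) by rewrite ltr_wpDl.
exists r, (sig / 2), [set q | fbox a q /\ (Q q.1 < 1 /\ mdist q.2 z0 < sig)].
have Qc : forall q : E * Z, {for q, continuous (fun q : E * Z => Q q.1)}.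
  by move=> q; apply: (CL_continuous openT (CL_quadratic 0 y0 rho openT)).
split; split.
- by rewrite divr_gt0.
- by rewrite divr_gt0.
- have -> : [set q | fbox a q /\ (Q q.1 < 1 /\ mdist q.2 z0 < sig)] =
    fbox a `&` ((fun q : E * Z => Q q.1) @^-1` [set x | x < 1]) `&` (snd @^-1` [set z | mdist z z0 < sig]).
    by apply/seteqP; split => q /=; tauto.
  apply: openI; first (apply: openI; first exact: open_fbox).
    by apply: open_comp; [move=> q _; exact: Qc|exact: open_lt].
  by apply: open_comp; [move=> q _; exact: cvg_snd|exact: open_mdist_ball].
- by move=> q [].
- move=> [y z] [/= hy hz].
  have rr : r <= rho by rewrite ler_pdivrMr//; apply: ler_peMr; [exact: ltW|rewrite lerDr].
  split; first by apply: Ka; split => /=; [apply: le_trans hy _; lra|lra].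
  split => /=; last by lra.
  have := @sumQ y ((p%:R + 1)^-1) _ _; rewrite invr_ge0 (ltW p1) mulrC => /(_ isT hy) /le_lt_trans; apply.
  have p0 : 0 <= (p%:R : R) by exact: ler0n.
  rewrite exprVn ltr_pdivrMr ?exprn_gt0// mul1r; nra.
- by apply: compact_setX; [exact: compact_norm_ball|apply: cK; lra].
move=> G cG.
exists (extend_by_zero a (fun q => cutoff y0 rho q.1 * h q.2 * G q)).
  have ofa := @open_fbox a.
  apply: (@leafwise_extend_by_zero _ _ _ K); [|exact: Ka| |].
  - by apply: compact_setX; [exact: compact_norm_ball|apply: cK; lra].
  - apply: CL_mul; [exact: ofa| |exact: cG].
    apply: CL_mul; [exact: ofa|exact: CL_cutoff|].
    by apply: (@CL_leaf_constant _ _ _ _ _ _ h); [exact: ofa|move=> q _; exact: ch].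
  - move=> [y z] aq nK /=.
    have [hy|hy] := leP `|y - y0| (2 * rho); last first.
      rewrite cutoff0; first by rewrite !mul0r.
      rewrite leNgt; apply/negP => Q2.
      move: hy; rewrite ltNge => /negP; apply; apply: norm_le_coord; first by rewrite mulr_ge0// ltW.
      move=> j i; rewrite (ord1 j) !mxE -ler_pdivrMr// -[rho in X in X <= _](gtr0_norm rho0') -normfV -normrM.
      rewrite -(@ler_pXn2r _ 2) ?nnegrE// real_normK ?num_real//.
      have := @ler_sum _ _ (index_enum 'I_p) xpredT (fun l => if l == i then ((y 0 i - y0 0 i) / rho) ^+ 2 else 0) (fun l => ((y 0 l - y0 0 l) / rho) ^+ 2).
      rewrite -big_mkcond big_pred1_eq => hs.
      have {}hs : ((y 0 i - y0 0 i) / rho) ^+ 2 <= Q y.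
        by apply: hs => l _; case: eqP => [->|_]//; exact: sqr_ge0.
      by move: Q2 hs; rewrite /Q; lra.
    have hz : 2 * sig < mdist z z0.
      by rewrite ltNge; apply/negP => hz; apply: nK.
    have -> : h z = 0.
      rewrite /h max_l// ge_min; apply/orP; right.
      by rewrite subr_le0 ler_pdivlMr// ltW.
    by rewrite mulr0 mul0r.
move=> [y z] [aq [/= Q1 hz]]; rewrite extend_by_zero_finv//= cutoff1; last exact: ltW.
have -> : h z = 1.
  rewrite /h min_l; first by rewrite max_r.
  have : mdist z z0 / sig <= 1 by rewrite ler_pdivrMr// mul1r ltW.
  lra.
by rewrite !mul1r.
Qed.

End Foliation.

(** Each halving multiplies the constant by [halving_ratio], which is less than 1; in the limit the
    increment vanishes. *)
Lemma superlinear_constant {R : realType} (al : R) (g : R -> R) (a b C : R) :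
  3^-1 < al ->
  (forall s t, a <= s -> s <= t -> t <= b -> `|g t - g s| <= C * (t - s) `^ al ^+ 3) ->
  forall s t, a <= s -> s <= t -> t <= b -> g t = g s.
Proof.
move=> al_gt hg s t as_ st tb.
have q0 := halving_ratio_gt0 al; have q1 := halving_ratio_lt1 al_gt.
have H n : forall s t, a <= s -> s <= t -> t <= b ->
   `|g t - g s| <= halving_ratio al ^+ n * C * (t - s) `^ al ^+ 3.
  elim: n => [|n ih] {as_ st tb}s {}t as_ st tb; first by rewrite expr0 mul1r; exact: hg.
  pose u := (s + t) / 2.
  have su : s <= u by rewrite /u; lra.
  have ut : u <= t by rewrite /u; lra.
  have h1 := ih _ _ as_ su (le_trans ut tb); have h2 := ih _ _ (le_trans as_ su) ut tb.
  have us : u - s = (t - s) / 2 by rewrite /u; lra.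
  have tu : t - u = (t - s) / 2 by rewrite /u; lra.
  rewrite us in h1; rewrite tu in h2.
  have e := powR_half al (_ : 0 <= t - s); rewrite subr_ge0 in e; have {}e := e st.
  have -> : g t - g s = (g t - g u) + (g u - g s) by ring.
  apply: le_trans (ler_normD _ _) _; rewrite exprS.
  have -> : halving_ratio al * halving_ratio al ^+ n * C * (t - s) `^ al ^+ 3 =
    halving_ratio al ^+ n * C * (halving_ratio al * (t - s) `^ al ^+ 3) by ring.
  by rewrite -e; lra.
apply/eqP; rewrite -subr_eq0 -normr_le0.
apply: (@contraction_bound _ _ _ (C * (t - s) `^ al ^+ 3) (halving_ratio al)) => //; first exact: ltW.
by move=> n; rewrite add0r mulrA; exact: H.
Qed.

(** * From the RDE to Davie's expansion in a chart *)

Section LocalEquation.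
Context {R : realType} {p d : nat} {M Z : metricType R} (F : foliated_space p M Z).
Variable al : R.
Hypothesis al_gt : 3^-1 < al.
Notation E := 'rV[R]_p.
Implicit Types (a : fol_index F) (V : 'I_d -> vfield F) (w : two_param R d).

Definition local_A a V (z : Z) w (s t : R) (x : E) : E :=
  \sum_i rp1 w s t 0 i *: field_in a (V i) (x, z).

(** The drift is counted among the second order terms: over intervals of length at most 1, t - s is
    at most (t - s)^(2 al) because 2 al < 1. *)
Definition local_B a V (V0 : vfield F) (z : Z) w (s t : R) (x : E) : E :=
  \sum_j \sum_k rp2 w s t j k *: second_field a (V j) (V k) (x, z)
    + (t - s) *: field_in a V0 (x, z).

Definition local_G a V (z : Z) w (s t : R) (x v : E) : E :=
  \sum_i rp1 w s t 0 i *: \sum_l v 0 l *: pder l (field_in a (V i)) (x, z).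

Section TestFunction.
Variables (a : fol_index F) (O : set (E * Z)) (f : M -> R) (G : E * Z -> R).
Hypothesis oO : open O.
Hypothesis Oa : O `<=` fbox a.
Hypothesis hf : leafwise_function F 3 f.
Hypothesis fG : forall q, O q -> f (finv_ a q) = G q.

Lemma test_function_first (U : vfield F) q : leafwise_vfield 3 U -> O q ->
  vf_app U f (finv_ a q) = lie a U G q.
Proof.
move=> [tU _] Oq; rewrite (vf_app_finv tU _ (Oa Oq)); last exact: (leafwise_le (k' := 3)).
by apply: (lie_near_eq a U oO Oq) => r /fG.
Qed.

Lemma test_function_second (U U' : vfield F) q :
  leafwise_vfield 3 U -> leafwise_vfield 3 U' -> O q ->
  vf_app U (vf_app U' f) (finv_ a q) = lie a U (lie a U' G) q.
Proof.
move=> [tU _] hU' Oq; rewrite (vf_app_finv tU _ (Oa Oq)); last first.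
  apply: (leafwise_vf_app (k := 1)); last exact: (leafwise_le (k' := 3)).
  by case: hU' => tU' cU'; split=> [|b]; [exact: tU'|exact: (CL_le (k' := 3))].
by apply: (lie_near_eq a U oO Oq) => r Or; exact: test_function_first.
Qed.

End TestFunction.

Lemma powR_triple (t : R) : t `^ (3 * al) = t `^ al ^+ 3.
Proof. by rewrite mulrC powRrM powR_mulrn// powR_ge0. Qed.

Lemma expansion_congr (A A' : 'I_d -> R) (B B' : 'I_d -> 'I_d -> R) (v v' c tau K : R)
    (w1 : 'rV[R]_d) (w2 : 'M[R]_d) :
  (forall i, A i = A' i) -> (forall j k, B j k = B' j k) -> v = v' ->
  `|c - \sum_i A i * w1 0 i - \sum_j \sum_k B j k * w2 j k - v * tau| <= K ->
  `|c - \sum_i A' i * w1 0 i - \sum_j \sum_k B' j k * w2 j k - v' * tau| <= K.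
Proof.
move=> /funext -> BB <-; have -> : B = B' by apply/funext => j; apply/funext.
exact.
Qed.

(** The constants come from finitely many test functions: the transverse distance and the p leaf
    coordinates, extended to [M]. *)
Lemma RDE_local_equation (T : R) V (V0 : vfield F) w m x a (O : set (E * Z)) s1 s2 :
  (forall i, leafwise_vfield 3 (V i)) -> leafwise_vfield 3 V0 ->
  open O -> O `<=` fbox a ->
  (forall G : E * Z -> R, CL 3 (fbox a) G ->
     exists2 f : M -> R, leafwise_function F 3 f & forall q, O q -> f (finv_ a q) = G q) ->
  RDE_solution al 0 T V V0 w m x -> 0 <= s1 -> s1 <= s2 -> s2 <= T ->
  (forall u, s1 <= u -> u <= s2 -> fdom a (x u) /\ O (fmap_ a (x u))) ->
  (forall u, s1 <= u -> u <= s2 -> (fmap_ a (x u)).2 = (fmap_ a (x s1)).2) /\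
  exists C, forall s t, s1 <= s -> s <= t -> t <= s2 ->
    `|davie_defect (local_A a V (fmap_ a (x s1)).2 w) (local_B a V V0 (fmap_ a (x s1)).2 w)
        (fun u => (fmap_ a (x u)).1) s t| <= C * (t - s) `^ al ^+ 3.
Proof.
move=> hV hV0 oO Oa hext [_ _ hsol] s10 s12 s2T hx.
have eq_f (f : M -> R) (G : E * Z -> R) : leafwise_function F 3 f ->
  (forall q, O q -> f (finv_ a q) = G q) -> exists C, forall s t : R, s1 <= s -> s <= t -> t <= s2 ->
   `|G (fmap_ a (x t)) - G (fmap_ a (x s))
     - \sum_i lie a (V i) G (fmap_ a (x s)) * rp1 w s t 0 i
     - \sum_j \sum_k lie a (V j) (lie a (V k) G) (fmap_ a (x s)) * rp2 w s t j k
     - lie a V0 G (fmap_ a (x s)) * (t - s)| <= C * (t - s) `^ al ^+ 3.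
  move=> lf fG; have [C hC] := hsol f lf; exists C => s t s1s st ts2.
  have h0s : 0 <= s by lra.
  have htT : t <= T by lra.
  have := hC s t h0s st htT; rewrite powR_triple.
  have [sdom sO] : fdom a (x s) /\ O (fmap_ a (x s)) by apply: hx; lra.
  have [tdom tO] : fdom a (x t) /\ O (fmap_ a (x t)) by apply: hx; lra.
  have e1 (U : vfield F) : leafwise_vfield 3 U -> vf_app U f (x s) = lie a U G (fmap_ a (x s)).
    by move=> hU; rewrite -[in LHS](fmapK sdom); exact: (test_function_first oO Oa lf fG hU sO).
  have e2 (U U' : vfield F) : leafwise_vfield 3 U -> leafwise_vfield 3 U' ->
      vf_app U (vf_app U' f) (x s) = lie a U (lie a U' G) (fmap_ a (x s)).
    by move=> hU hU'; rewrite -[in LHS](fmapK sdom); exact: (test_function_second oO Oa lf fG hU hU' sO).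
  rewrite -(fG _ tO) -(fG _ sO) (fmapK tdom) (fmapK sdom).
  exact: (expansion_congr (fun i => e1 _ (hV i)) (fun j k => e2 _ _ (hV j) (hV k)) (e1 _ hV0)).
have zc : forall u, s1 <= u -> u <= s2 -> (fmap_ a (x u)).2 = (fmap_ a (x s1)).2.
  set z1 := (fmap_ a (x s1)).2.
  (* The distance to the initial transverse coordinate is a single continuous function that detects
     equality in [Z]; its leafwise derivatives vanish, so [superlinear_constant] applies to it. *)
  have [f lf fG] : exists2 f : M -> R, leafwise_function F 3 f &
      forall q, O q -> f (finv_ a q) = mdist q.2 z1.
    apply: hext; apply: (@CL_leaf_constant _ _ _ _ _ _ (fun z => mdist z z1)); first exact: open_fbox.
    by move=> q _; exact: continuous_mdist.
  have [C hC] := eq_f f (fun q => mdist q.2 z1) lf fG.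
  have hl (U : vfield F) : lie a U (fun q => mdist q.2 z1) = fun=> 0.
    by apply/funext => q; exact: (lie_leaf_constant _ _ (fun z => mdist z z1)).
  have hl0 (U : vfield F) : lie a U (fun q => 0) = fun=> 0.
    by apply/funext => q; exact: (lie_leaf_constant _ _ (fun z => 0)).
  move=> u s1u us2.
  have := @superlinear_constant _ al (fun u => mdist (fmap_ a (x u)).2 z1) s1 s2 C al_gt _ s1 u (lexx _) s1u us2.
  rewrite /z1 mdistxx => h; apply: mdist_positivity; apply: h => s t s1s st ts2.
  have := hC s t s1s st ts2.
  rewrite hl mul0r subr0 big1; last by move=> i _; rewrite hl mul0r.
  rewrite subr0 big1 ?subr0// => j _; rewrite big1// => k _.
  by rewrite hl hl0 mul0r.
split=> //.
set z1 := (fmap_ a (x s1)).2.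
have /choice[C hC] (i : 'I_p) : exists C, forall s t, s1 <= s -> s <= t -> t <= s2 ->
    `|davie_defect (local_A a V z1 w) (local_B a V V0 z1 w)
        (fun u => (fmap_ a (x u)).1) s t 0 i| <= C * (t - s) `^ al ^+ 3.
  have [f lf fG] : exists2 f : M -> R, leafwise_function F 3 f &
      forall q, O q -> f (finv_ a q) = q.1 0 i.
    by apply: hext; apply: CL_coordinate; exact: open_fbox.
  have [C hC] := eq_f f (fun q => q.1 0 i) lf fG; exists C => s t s1s st ts2.
  have [sdom sO] : fdom a (x s) /\ O (fmap_ a (x s)) by apply: hx; lra.
  have := hC s t s1s st ts2; congr (`|_| <= _).
  have ss2 : s <= s2 by lra.
  have qE : fmap_ a (x s) = ((fmap_ a (x s)).1, z1) by rewrite /z1 -(zc s s1s ss2) -surjective_pairing.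
  have sO' : fbox a ((fmap_ a (x s)).1, z1) by rewrite -qE; exact: Oa.
  have hl (U : vfield F) q : lie a U (fun q => q.1 0 i) q = field_in a U q 0 i.
    exact: lie_coordinate.
  have hV1 k : leafwise_vfield 1 (V k).
    by have [tV cV] := hV k; split=> // b; exact: CL_le (cV b).
  rewrite /davie_defect /local_A /local_B !mxE !summxE opprD addrA.
  congr (_ - _ - _ - _).
  - by apply: eq_bigr => k _; rewrite hl qE !mxE mulrC.
  - apply: eq_bigr => j _; rewrite summxE; apply: eq_bigr => k _.
    rewrite (_ : lie a (V k) _ = fun q => field_in a (V k) q 0 i); last by apply/funext => q; rewrite hl.
    by rewrite [X in lie _ _ _ X]qE (lie_field _ _ (hV1 k) sO') [RHS]mxE mulrC.
  - by rewrite hl qE mulrC.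
exists (\sum_i `|C i|) => s t s1s st ts2; apply: norm_le_coord.
  by rewrite mulr_ge0 ?sumr_ge0 ?exprn_ge0 ?powR_ge0.
move=> j i; rewrite (ord1 j); apply: le_trans (hC i s t s1s st ts2) _.
rewrite ler_wpM2r ?exprn_ge0 ?powR_ge0//; apply: le_trans (ler_norm _) _.
by rewrite (bigD1 i)//= lerDl sumr_ge0.
Qed.

End LocalEquation.

(** * Uniform bounds in a chart *)

Lemma scaled_sum_bound {R : realType} {V : normedModType R} (n : nat) (c : 'I_n -> R)
    (v : 'I_n -> V) (C X : R) :
  0 <= C -> (forall i, `|c i| <= C) -> (forall i, `|v i| <= X) ->
  `|\sum_i c i *: v i| <= n%:R * (C * X).
Proof.
move=> C0 hc hv; apply: le_trans (ler_norm_sum _ _ _) _.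
apply: (@le_trans _ _ (\sum_(i < n) C * X)).
  by apply: ler_sum => i _; rewrite normrZ ler_pM.
by rewrite sumr_const card_ord mulr_natl.
Qed.

Section FieldBounds.
Context {R : realType} {p : nat} {Z : topologicalType}.
Notation E := 'rV[R]_p.
Variables (U : set (E * Z)) (D : set E) (K : set Z) (diam : R).
Hypothesis oU : open U.
Hypothesis cDK : compact (D `*` K).
Hypothesis DKU : D `*` K `<=` U.
Hypothesis convD : forall (x v : E) (r : R), D x -> D (x + v) -> 0 <= r -> r <= 1 -> D (x + r *: v).
Hypothesis diamD : forall x y, D x -> D y -> `|y - x| <= diam.
Hypothesis diam0 : 0 <= diam.

Definition leaf_derivative (f : E * Z -> E) (q : E * Z) (v : E) : E :=
  \sum_l v 0 l *: pder l f q.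

(** What the vectors entering [local_B], the second order fields and the drift, must satisfy. The
    fields entering [local_A] need the stronger [C3_bounds], whose last item is the two-point Taylor
    bound. *)
Record C2_bounds (f : E * Z -> E) (L : R) : Prop := {
  C2_bounded : forall x z, D x -> K z -> `|f (x, z)| <= L ;
  C2_lipschitz : forall x x' z, D x -> D x' -> K z ->
    `|f (x, z) - f (x', z)| <= L * `|x - x'| ;
  C2_taylor : forall x y x' y' z, D x -> D y -> D x' -> D y' -> K z ->
    `|(f (y, z) - f (x, z)) - (f (y', z) - f (x', z))| <=
    L * (`|(y - x) - (y' - x')| + `|x - x'| * `|y - x|) }.

Record C3_bounds (f : E * Z -> E) (L : R) : Prop := {
  C3_bounded : forall x z, D x -> K z -> `|f (x, z)| <= L ;
  C3_lipschitz : forall x x' z, D x -> D x' -> K z ->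
    `|f (x, z) - f (x', z)| <= L * `|x - x'| ;
  C3_derivative : forall x v z, D x -> K z -> `|leaf_derivative f (x, z) v| <= L * `|v| ;
  C3_derivative_lipschitz : forall x x' v z, D x -> D x' -> K z ->
    `|leaf_derivative f (x, z) v - leaf_derivative f (x', z) v| <= L * (`|x - x'| * `|v|) ;
  C3_taylor : forall x y x' y' z, D x -> D y -> D x' -> D y' -> K z ->
    `|(f (y, z) - f (x, z) - leaf_derivative f (x, z) (y - x))
      - (f (y', z) - f (x', z) - leaf_derivative f (x', z) (y' - x'))| <=
    L * (`|x - x'| * `|y - x| ^+ 2 + `|(y - x) - (y' - x')| * (`|y - x| + `|y' - x'|)) }.

Lemma C2_bounds_le f L L' : L <= L' -> C2_bounds f L -> C2_bounds f L'.
Proof.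
move=> LL [h1 h2 h3]; split.
- by move=> x z Dx Kz; apply: le_trans LL; exact: h1.
- move=> x x' z Dx Dx' Kz; apply: le_trans (h2 _ _ _ Dx Dx' Kz) _.
  by rewrite ler_wpM2r.
- move=> x y x' y' z Dx Dy Dx' Dy' Kz; apply: le_trans (h3 _ _ _ _ _ Dx Dy Dx' Dy' Kz) _.
  by rewrite ler_wpM2r// addr_ge0// mulr_ge0.
Qed.

Lemma C3_bounds_le f L L' : L <= L' -> C3_bounds f L -> C3_bounds f L'.
Proof.
move=> LL [h1 h2 h3 h4 h5]; split.
- by move=> x z Dx Kz; apply: le_trans LL; exact: h1.
- move=> x x' z Dx Dx' Kz; apply: le_trans (h2 _ _ _ Dx Dx' Kz) _.
  by rewrite ler_wpM2r.
- move=> x v z Dx Kz; apply: le_trans (h3 _ _ _ Dx Kz) _.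
  by rewrite ler_wpM2r.
- move=> x x' v z Dx Dx' Kz; apply: le_trans (h4 _ _ _ _ Dx Dx' Kz) _.
  by rewrite ler_wpM2r// mulr_ge0.
- move=> x y x' y' z Dx Dy Dx' Dy' Kz; apply: le_trans (h5 _ _ _ _ _ Dx Dy Dx' Dy' Kz) _.
  by rewrite ler_wpM2r// addr_ge0 ?mulr_ge0 ?addr_ge0 ?exprn_ge0.
Qed.

Let row_bounded (f : E * Z -> E) : (forall c, CL 0 U (fun q => f q 0 c : R)) ->
  exists2 L, 1 <= L & forall x z, D x -> K z -> `|f (x, z)| <= L.
Proof.
move=> cf.
have [||L L1 hL] := @common_bound R 'I_p (fun c L => forall x z, D x -> K z -> `|f (x, z) 0 c| <= L).
- by move=> c L L' LL h x z Dx Kz; apply: le_trans LL; exact: h.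
- by move=> c; have [L _ hL] := CL_bounded oU cDK DKU (cf c); exists L.
exists L => // x z Dx Kz; apply: norm_le_coord; first lra.
by move=> i c; rewrite (ord1 i); exact: hL.
Qed.

Let row_lipschitz (f : E * Z -> E) : (forall c, CL 1 U (fun q => f q 0 c : R)) ->
  exists2 L, 1 <= L & forall x x' z, D x -> D x' -> K z ->
    `|f (x, z) - f (x', z)| <= L * `|x - x'|.
Proof.
move=> cf.
have [||L L1 hL] := @common_bound R 'I_p (fun c L => forall x x' z, D x -> D x' -> K z ->
   `|f (x, z) 0 c - f (x', z) 0 c| <= L * `|x - x'|).
- move=> c L L' LL h x x' z Dx Dx' Kz; apply: le_trans (h _ _ _ Dx Dx' Kz) _.
  by rewrite ler_wpM2r.
- move=> c; have [L _ hL] := CL_lipschitz oU cDK DKU convD (cf c); exists L.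
  by move=> x x' z Dx Dx' Kz; exact: (hL z Kz).
exists L => // x x' z Dx Dx' Kz; apply: norm_le_coord; first by rewrite mulr_ge0//; lra.
by move=> i c; rewrite (ord1 i) !mxE; exact: hL.
Qed.

Lemma C2_bounds_exist (f : E * Z -> E) : (forall c, CL 2 U (fun q => f q 0 c : R)) ->
  exists L, C2_bounds f L.
Proof.
move=> cf2; have cf1 c := CL_pred (cf2 c); have cf0 c := CL_pred (cf1 c).
have [L1 L11 h1] := row_bounded cf0; have [L2 L21 h2] := row_lipschitz cf1.
have [||L L3 hL] := @common_bound R 'I_p (fun c L => forall x y x' y' z, D x -> D y -> D x' -> D y' -> K z ->
    `|(f (y, z) 0 c - f (x, z) 0 c) - (f (y', z) 0 c - f (x', z) 0 c)| <=
    L * (`|(y - x) - (y' - x')| + `|x - x'| * `|y - x|)).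
- move=> c L L' LL h x y x' y' z Dx Dy Dx' Dy' Kz; apply: le_trans (h _ _ _ _ _ Dx Dy Dx' Dy' Kz) _.
  by rewrite ler_wpM2r// addr_ge0// mulr_ge0.
- move=> c; have [L _ hL] := CL_taylor1 oU cDK DKU convD diamD diam0 (cf2 c).
  exists L => x y x' y' z Dx Dy Dx' Dy' Kz.
  have ey : y = x + (y - x) by rewrite addrC subrK.
  have ey' : y' = x' + (y' - x') by rewrite addrC subrK.
  by have := hL z Kz x (y - x) x' (y' - x'); rewrite -ey -ey'; apply.
exists (L1 + L2 + L); split=> [x z Dx Kz|x x' z Dx Dx' Kz|x y x' y' z Dx Dy Dx' Dy' Kz].
- by apply: le_trans (h1 _ _ Dx Kz) _; lra.
- apply: le_trans (h2 _ _ _ Dx Dx' Kz) _; apply: ler_wpM2r => //; lra.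
- apply: norm_le_coord; first by rewrite mulr_ge0 ?addr_ge0 ?mulr_ge0//; lra.
  move=> i c; rewrite (ord1 i) !mxE; apply: le_trans (hL c _ _ _ _ _ Dx Dy Dx' Dy' Kz) _.
  by rewrite ler_wpM2r ?addr_ge0 ?mulr_ge0//; lra.
Qed.

Lemma C3_bounds_exist (f : E * Z -> E) : CL 3 U f -> exists L, C3_bounds f L.
Proof.
move=> cf3; have cf2 := CL_pred cf3; have cf1 := CL_pred cf2; have cf0 := CL_pred cf1.
have [L1 L11 h1] := row_bounded (fun c => CL_entry c oU cf0).
have [L2 L21 h2] := row_lipschitz (fun c => CL_entry c oU cf1).
have [||L3 L31 h3] := @common_bound R 'I_p (fun l L => forall x z, D x -> K z -> `|pder l f (x, z)| <= L).
- by move=> c L L' LL h x z Dx Kz; apply: le_trans LL; exact: h.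
- move=> l; have [L _ hL] := row_bounded (fun c => CL_entry c oU (CL_pder l cf1)).
  by exists L.
have [||L4 L41 h4] := @common_bound R 'I_p (fun l L => forall x x' z, D x -> D x' -> K z ->
   `|pder l f (x, z) - pder l f (x', z)| <= L * `|x - x'|).
- move=> c L L' LL h x x' z Dx Dx' Kz; apply: le_trans (h _ _ _ Dx Dx' Kz) _.
  by rewrite ler_wpM2r.
- move=> l; have [L _ hL] := row_lipschitz (fun c => CL_entry c oU (CL_pder l cf2)).
  by exists L.
have [||L5 L51 h5] := @common_bound R 'I_p (fun c L => forall x y x' y' z, D x -> D y -> D x' -> D y' -> K z ->
    `|((f (y, z) - f (x, z) - leaf_derivative f (x, z) (y - x))
      - (f (y', z) - f (x', z) - leaf_derivative f (x', z) (y' - x'))) 0 c| <=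
    L * (`|x - x'| * `|y - x| ^+ 2 + `|(y - x) - (y' - x')| * (`|y - x| + `|y' - x'|))).
- move=> c L L' LL h x y x' y' z Dx Dy Dx' Dy' Kz; apply: le_trans (h _ _ _ _ _ Dx Dy Dx' Dy' Kz) _.
  by rewrite ler_wpM2r// addr_ge0 ?mulr_ge0 ?addr_ge0 ?exprn_ge0.
- move=> c; have [L _ hL] := CL_taylor2 oU cDK DKU convD diamD diam0 (CL_entry c oU cf3).
  exists L => x y x' y' z Dx Dy Dx' Dy' Kz.
  have ey : y = x + (y - x) by rewrite addrC subrK.
  have ey' : y' = x' + (y' - x') by rewrite addrC subrK.
  have dE x0 v : D x0 -> leaf_derivative f (x0, z) v 0 c =
      \sum_l v 0 l * pder l (fun q => f q 0 c : R) (x0, z).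
    move=> Dx0; rewrite /leaf_derivative summxE; apply: eq_bigr => l _.
    by rewrite mxE (pder_entry _ _ cf1 (DKU (conj Dx0 Kz : (D `*` K) (x0, z)))).
  have sE x0 y0 v : D x0 -> (f (y0, z) - f (x0, z) - leaf_derivative f (x0, z) v) 0 c =
      f (y0, z) 0 c - f (x0, z) 0 c - \sum_l v 0 l * pder l (fun q => f q 0 c : R) (x0, z).
    by move=> Dx0; rewrite -(dE x0 v Dx0) !mxE.
  have entryB (u v : E) (b1 b2 B : R) : u 0 c = b1 -> v 0 c = b2 ->
      `|b1 - b2| <= B -> `|(u - v) 0 c| <= B by move=> <- <-; rewrite !mxE.
  apply: (entryB _ _ _ _ _ (sE x y (y - x) Dx) (sE x' y' (y' - x') Dx')).
  by have := hL z Kz x (y - x) x' (y' - x'); rewrite -ey -ey'; apply.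
exists (L1 + L2 + p%:R * L3 + p%:R * L4 + L5).
have p0 : 0 <= (p%:R : R) by exact: ler0n.
have q3 : 0 <= p%:R * L3 by rewrite mulr_ge0//; lra.
have q4 : 0 <= p%:R * L4 by rewrite mulr_ge0//; lra.
split=> [x z Dx Kz|x x' z Dx Dx' Kz|x v z Dx Kz|x x' v z Dx Dx' Kz|x y x' y' z Dx Dy Dx' Dy' Kz].
- by apply: le_trans (h1 _ _ Dx Kz) _; lra.
- apply: le_trans (h2 _ _ _ Dx Dx' Kz) _; apply: ler_wpM2r => //; lra.
- apply: le_trans (scaled_sum_bound (C := `|v|) _ _ (fun l => h3 l x z Dx Kz)) _ => //.
    by move=> i; exact: coord_le_norm.
  by rewrite (mulrC `|v|) mulrA ler_wpM2r//; lra.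
- rewrite /leaf_derivative -sumrB; under eq_bigr do rewrite -scalerBr.
  apply: le_trans (scaled_sum_bound (C := `|v|) _ _ (fun l => h4 l x x' z Dx Dx' Kz)) _ => //.
    by move=> i; exact: coord_le_norm.
  have -> : p%:R * (`|v| * (L4 * `|x - x'|)) = p%:R * L4 * (`|x - x'| * `|v|) by ring.
  by rewrite ler_wpM2r ?mulr_ge0//; lra.
- have g0 : 0 <= `|x - x'| * `|y - x| ^+ 2 + `|(y - x) - (y' - x')| * (`|y - x| + `|y' - x'|).
    by rewrite addr_ge0 ?mulr_ge0 ?addr_ge0 ?exprn_ge0.
  apply: norm_le_coord; first by rewrite mulr_ge0//; lra.
  move=> i c; rewrite (ord1 i); apply: le_trans (h5 c _ _ _ _ _ Dx Dy Dx' Dy' Kz) _.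
  by rewrite ler_wpM2r//; lra.
Qed.

End FieldBounds.

(** * The fields in a chart form a Davie system *)

Section LocalSystem.
Context {R : realType} {p d : nat} {M Z : metricType R} (F : foliated_space p M Z).
Variable al : R.
Hypothesis al_gt : 3^-1 < al.
Hypothesis al_lt : al < 2^-1.
Notation E := 'rV[R]_p.
Implicit Types (a : fol_index F) (V : 'I_d -> vfield F) (w : two_param R d).
Implicit Types (s u t tau : R) (z : Z) (x v : E) (c : 'M[R]_d) (S : 'I_d -> 'I_d -> E).

Lemma le_powR_al2 (t : R) : 0 <= t -> t <= 1 -> t <= t `^ al ^+ 2.
Proof.
move=> t0 t1; rewrite -powR_double; have [->|tn] := eqVneq t 0; first exact: powR_ge0.
rewrite -[leLHS]powRr1//; apply: ger_powR; last by move: al_lt; lra.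
by rewrite lt_neqAle eq_sym tn t0.
Qed.

Definition second_order (c : 'M[R]_d) (tau : R) (S : 'I_d -> 'I_d -> E) (v : E) : E :=
  \sum_j \sum_k c j k *: S j k + tau *: v.

Lemma second_orderB c tau S S' v v' : second_order c tau S v - second_order c tau S' v' =
  second_order c tau (fun j k => S j k - S' j k) (v - v').
Proof.
rewrite /second_order opprD addrACA -scalerBr -sumrB; congr (_ + _).
by apply: eq_bigr => j _; rewrite -sumrB; apply: eq_bigr => k _; rewrite scalerBr.
Qed.

Lemma second_order_bound c tau S v (C X : R) : 0 <= C -> (forall j k, `|c j k| <= C) ->
  0 <= tau -> tau <= C -> (forall j k, `|S j k| <= X) -> `|v| <= X ->
  `|second_order c tau S v| <= (d%:R ^+ 2 + 1) * (C * X).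
Proof.
move=> C0 hc t0 tC hS hv; apply: le_trans (ler_normD _ _) _; rewrite mulrDl mul1r.
apply: lerD; last by rewrite normrZ ger0_norm//; apply: ler_pM.
apply: le_trans (ler_norm_sum _ _ _) _.
apply: (@le_trans _ _ (\sum_(j < d) d%:R * (C * X))).
  by apply: ler_sum => j _; apply: scaled_sum_bound.
by rewrite sumr_const card_ord expr2 -mulrA [leRHS]mulr_natl.
Qed.

Lemma local_BE a V (V0 : vfield F) z w s t x : local_B a V V0 z w s t x =
  second_order (rp2 w s t) (t - s) (fun j k => second_field a (V j) (V k) (x, z)) (field_in a V0 (x, z)).
Proof. by []. Qed.

Lemma local_GE a V z w s t x v : local_G a V z w s t x v =
  \sum_i rp1 w s t 0 i *: leaf_derivative (field_in a (V i)) (x, z) v.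
Proof. by []. Qed.

(** The cross term of the Chen relation in terms of the fields: differentiating V_k along V_j pairs
    the tensor product of the first levels with the second order fields. *)
Lemma local_G_A a V z w s u u' t x : local_G a V z w u' t x (local_A a V z w s u x) =
  \sum_j \sum_k (rp1 w s u 0 j * rp1 w u' t 0 k) *: second_field a (V j) (V k) (x, z).
Proof.
rewrite exchange_big /=; apply: eq_bigr => k _.
have -> : \sum_l local_A a V z w s u x 0 l *: pder l (field_in a (V k)) (x, z) =
    \sum_l \sum_j (rp1 w s u 0 j * field_in a (V j) (x, z) 0 l) *: pder l (field_in a (V k)) (x, z).
  by apply: eq_bigr => l _; rewrite summxE scaler_suml; apply: eq_bigr => j _; rewrite mxE.
rewrite exchange_big scaler_sumr; apply: eq_bigr => j _.
rewrite !scaler_sumr; apply: eq_bigr => l _.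
by rewrite !scalerA; congr (_ *: _); ring.
Qed.

Lemma local_B_chen a V (V0 : vfield F) z (T W : R) w s u t x : driver al T W w ->
  0 <= s -> s <= u -> u <= t -> t <= T ->
  local_B a V V0 z w s t x = local_B a V V0 z w s u x + local_B a V V0 z w u t x
    + local_G a V z w u t x (local_A a V z w s u x).
Proof.
move=> hw s0 su ut tT.
rewrite local_G_A.
rewrite /local_B (driver_chen2 hw s0 su ut tT).
have -> : t - s = (u - s) + (t - u) by ring.
rewrite scalerDl [in RHS]addrACA [RHS]addrAC; congr (_ + _).
rewrite -!big_split /=; apply: eq_bigr => j _; rewrite -!big_split /=; apply: eq_bigr => k _.
rewrite -!scalerDl; congr (_ *: _).
by rewrite !mxE big_ord1 mxE.
Qed.

(** The constant depends on the driver only through the size [W], and not on the slice or the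
    interval; this uniformity is what later gives equicontinuity. *)
Lemma local_davie_system a q0 (r sig : R) V (V0 : vfield F) :
  0 <= r -> compact (region q0 r sig) -> region q0 r sig `<=` fbox a ->
  (forall i, leafwise_vfield 3 (V i)) -> leafwise_vfield 3 V0 ->
  exists L : R -> R, forall (T W : R) w z (s1 s2 : R), 0 <= W -> driver al T W w ->
    mdist z q0.2 <= sig -> 0 <= s1 -> s2 <= T -> s2 - s1 <= 1 ->
    davie_system al (L W) s1 s2 [set y | `|y - q0.1| <= r]
      (local_A a V z w) (local_B a V V0 z w) (local_G a V z w).
Proof.
move=> r0 cDK DKU hV hV0.
set D := [set y | _]; pose K := [set z : Z | mdist z q0.2 <= sig].
have oU := @open_fbox _ _ _ _ _ a.
have convD (x v : E) (c : R) : D x -> D (x + v) -> 0 <= c -> c <= 1 -> D (x + c *: v).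
  exact: convex_norm_ball.
have diamD (x y : E) : D x -> D y -> `|y - x| <= 2 * r by exact: diam_norm_ball.
have diam0 : 0 <= 2 * r by rewrite mulr_ge0.
have [||B1 B11 h1] := @common_bound R 'I_d (fun i => C3_bounds D K (field_in a (V i))).
- by move=> i L L'; exact: C3_bounds_le.
- by move=> i; apply: (C3_bounds_exist oU cDK DKU convD diamD diam0); have [_ cV] := hV i; exact: cV.
have [||B2 B21 h2] := @common_bound R ('I_d * 'I_d)%type (fun i => C2_bounds D K (second_field a (V i.1) (V i.2))).
- by move=> i L L'; exact: C2_bounds_le.
- move=> i; apply: (C2_bounds_exist oU cDK DKU convD diamD diam0) => c.
  apply: CL_second_field; last exact: hV.
  by have [tV cV] := hV i.1; split=> // b; exact: CL_pred.
have [B3 h3] : exists L, C2_bounds D K (field_in a V0) L.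
  apply: (C2_bounds_exist oU cDK DKU convD diamD diam0) => c; apply: CL_entry => //.
  by apply: CL_pred; have [_ cV] := hV0; exact: cV.
pose B := B1 + B2 + `|B3|.
have nB3 : 0 <= `|B3| by [].
have B0 : 1 <= B by rewrite /B -addrA; apply: le_trans B11 _; rewrite lerDl addr_ge0// (le_trans ler01).
have {}h1 i : C3_bounds D K (field_in a (V i)) B by apply: C3_bounds_le (h1 i); rewrite /B; lra.
have {}h2 j k : C2_bounds D K (second_field a (V j) (V k)) B.
  by apply: C2_bounds_le (h2 (j, k)); rewrite /B; lra.
have {}h3 : C2_bounds D K (field_in a V0) B.
  by apply: C2_bounds_le h3; rewrite /B; have := ler_norm B3; lra.
pose N := (d%:R + (d%:R ^+ 2 + 1)) * B.
have d0 : 0 <= (d%:R : R) by exact: ler0n.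
have d20 : 0 <= (d%:R ^+ 2 : R) by exact: exprn_ge0.
(* With W + 1 in place of W the constant is at least 1 and the drift satisfies the same bound as the
   second level. *)
exists (fun W => N * (W + 1)) => T W w z s1 s2 W0 hw Kz s10 s2T s12.
have om0 (t : R) := powR_ge0 t al.
have W1 : 1 <= W + 1 by rewrite lerDr.
have W10 : 0 <= W + 1 := le_trans ler01 W1.
have WW : W <= W + 1 by rewrite lerDl.
have first s t (v : 'I_d -> E) (X : R) : s1 <= s -> s <= t -> t <= s2 -> 0 <= X ->
    (forall i, `|v i| <= B * X) ->
    `|\sum_i rp1 w s t 0 i *: v i| <= N * (W + 1) * (t - s) `^ al * X.
  move=> ss st ts X0 hv.
  have [hr _] := driver_bounds hw (le_trans s10 ss) st (le_trans ts s2T).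
  apply: le_trans (scaled_sum_bound (C := (W + 1) * (t - s) `^ al) _ _ hv) _.
  - exact: mulr_ge0.
  - move=> i; apply: le_trans (coord_le_norm _ _ _) _; apply: le_trans hr _.
    by rewrite ler_wpM2r.
  have -> : d%:R * ((W + 1) * (t - s) `^ al * (B * X)) = d%:R * B * ((W + 1) * ((t - s) `^ al * X)) by ring.
  have -> : N * (W + 1) * (t - s) `^ al * X = N * ((W + 1) * ((t - s) `^ al * X)) by ring.
  rewrite ler_wpM2r//; first by rewrite !mulr_ge0.
  rewrite /N; nra.
have second s t (S : 'I_d -> 'I_d -> E) v (X : R) : s1 <= s -> s <= t -> t <= s2 -> 0 <= X ->
    (forall j k, `|S j k| <= B * X) -> `|v| <= B * X ->
    `|second_order (rp2 w s t) (t - s) S v| <= N * (W + 1) * (t - s) `^ al ^+ 2 * X.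
  move=> ss st ts X0 hS hv.
  have [_ hr] := driver_bounds hw (le_trans s10 ss) st (le_trans ts s2T).
  have ts0 : 0 <= t - s by rewrite subr_ge0.
  have o20 : 0 <= (t - s) `^ al ^+ 2 by exact: exprn_ge0.
  have tso : t - s <= (t - s) `^ al ^+ 2 by apply: (le_powR_al2 ts0); exact: le_trans (lerB ts ss) s12.
  apply: le_trans (second_order_bound (C := (W + 1) * (t - s) `^ al ^+ 2) _ _ _ _ hS hv) _.
  - exact: mulr_ge0.
  - move=> j k; apply: le_trans (coord_le_norm _ _ _) _; apply: le_trans hr _.
    by rewrite ler_wpM2r.
  - lra.
  - nra.
  have -> : (d%:R ^+ 2 + 1) * ((W + 1) * (t - s) `^ al ^+ 2 * (B * X)) = (d%:R ^+ 2 + 1) * B * ((W + 1) * ((t - s) `^ al ^+ 2 * X)) by ring.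
  have -> : N * (W + 1) * (t - s) `^ al ^+ 2 * X = N * ((W + 1) * ((t - s) `^ al ^+ 2 * X)) by ring.
  rewrite ler_wpM2r//; first by rewrite !mulr_ge0.
  rewrite /N; nra.
split.
- apply: mulr_ege1 => //; rewrite /N; apply: mulr_ege1 => //; lra.
- exact: s12.
- move=> s u t x ss su ut ts; rewrite /local_A -big_split /=; apply: eq_bigr => i _.
  by rewrite -scalerDl (driver_chen1 hw (le_trans s10 ss) su ut (le_trans ts s2T)) mxE.
- by move=> s u t x ss su ut ts; exact: (local_B_chen _ _ _ _ _ hw (le_trans s10 ss) su ut (le_trans ts s2T)).
- move=> s t x v v'; rewrite !local_GE -big_split /=; apply: eq_bigr => i _.
  rewrite -scalerDr /leaf_derivative -big_split /=; congr (_ *: _); apply: eq_bigr => l _.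
  by rewrite mxE scalerDl.
- move=> s t x ss st ts Dx; rewrite -[leRHS]mulr1; apply: first => // i.
  by rewrite mulr1; apply: (C3_bounded (h1 i)).
- move=> s t x ss st ts Dx; rewrite -[leRHS]mulr1 local_BE; apply: second => // [j k|].
    by rewrite mulr1; apply: (C2_bounded (h2 j k)).
  by rewrite mulr1; apply: (C2_bounded h3).
- move=> s t x v ss st ts Dx; rewrite local_GE; apply: first => // i.
  exact: (C3_derivative (h1 i)).
- move=> s t x x' ss st ts Dx Dx'; rewrite /local_A -sumrB; under eq_bigr do rewrite -scalerBr.
  by apply: first => // i; exact: (C3_lipschitz (h1 i)).
- move=> s t x x' ss st ts Dx Dx'; rewrite !local_BE second_orderB; apply: second => // [j k|].
    exact: (C2_lipschitz (h2 j k)).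
  exact: (C2_lipschitz h3).
- move=> s t x x' v ss st ts Dx Dx'; rewrite !local_GE -sumrB; under eq_bigr do rewrite -scalerBr.
  by apply: first => // i; exact: (C3_derivative_lipschitz (h1 i)).
- move=> s t x y x' y' ss st ts Dx Dy Dx' Dy'; rewrite !local_GE /local_A -!sumrB.
  under eq_bigr do rewrite -!scalerBr.
  apply: first => // i; exact: (C3_taylor (h1 i)).
- move=> s t x y x' y' ss st ts Dx Dy Dx' Dy'; rewrite !local_BE !second_orderB.
  apply: second => // [j k|].
    exact: (C2_taylor (h2 j k)).
  exact: (C2_taylor h3).
Qed.

End LocalSystem.

(** * Local solutions in charts *)

(** The supremum of the times up to which [P] holds is attained by the closedness hypothesis, and
    cannot be less than [b] by the step. *)
Lemma real_induction {R : realType} (P : R -> Prop) (a b : R) :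
  P a ->
  (forall t, a <= t -> t < b -> (forall u, a <= u -> u <= t -> P u) ->
     exists2 delta, 0 < delta & forall u, t < u -> u < t + delta -> u <= b -> P u) ->
  (forall t, a < t -> t <= b -> (forall u, a <= u -> u < t -> P u) -> P t) ->
  forall t, a <= t -> t <= b -> P t.
Proof.
move=> Pa Pstep Plim t at_ tb; have ab : a <= b by lra.
pose S := [set t | [/\ a <= t, t <= b & forall u, a <= u -> u <= t -> P u]].
have Sa : S a.
  by split=> // u au ua; have -> : u = a by apply: le_anti; rewrite ua au.
have hS : has_sup S by split; [exists a|exists b => u []].
pose s := sup S.
have as_ : a <= s by apply: ub_le_sup => //; case: hS.
have sb : s <= b by apply: ge_sup => [|u []]; first by exists a.
have Plt u : a <= u -> u < s -> P u.
  move=> au us; have us0 : 0 < s - u by rewrite subr_gt0.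
  have [v [av vb hv]] := sup_adherent us0 hS; rewrite -/s => uv.
  by apply: hv => //; lra.
have Ps : P s.
  have [->//|ns] := eqVneq s a; apply: Plim => //.
  by rewrite lt_neqAle eq_sym ns.
have Ple u : a <= u -> u <= s -> P u.
  by move=> au; rewrite le_eqVlt => /orP[/eqP->//|]; exact: Plt.
have [sb'|bs] := ltP s b; last by apply: Ple => //; lra.
have [delta d0 hd] := Pstep s as_ sb' Ple.
pose v := Num.min b (s + delta / 2).
have d2 : 0 < delta / 2 by rewrite divr_gt0.
have sv : s < v by rewrite /v lt_min sb' ltrDl.
have [vb vd] : v <= b /\ v <= s + delta / 2.
  by have := lexx v; rewrite {2}/v le_min => /andP.
have : S v.
  split=> [|//|u au uv]; first lra.
  have [us|su] := leP u s; first exact: Ple.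
  by apply: hd => //; lra.
by move=> /(ub_le_sup (proj2 hS)); rewrite -/s; lra.
Qed.

Lemma mdist_lt_half {R : realType} {X : metricType R} (x y z : X) (e : R) :
  mdist x z < e / 2 -> mdist y z < e / 2 -> mdist x y < e.
Proof. by move=> h1 h2; have := metric_triangle x z y; rewrite (metric_sym z); lra. Qed.

Lemma mdist_lt_third {R : realType} {X : metricType R} (x x' y y' : X) (e : R) :
  mdist x x' < e / 3 -> mdist y y' < e / 3 -> mdist x' y' < e / 3 -> mdist x y < e.
Proof.
move=> h1 h2 h3; have := metric_triangle x x' y; have := metric_triangle x' y' y.
by rewrite (metric_sym y'); lra.
Qed.

Lemma cvg_near {I : Type} {X : topologicalType} (G : set_system I) (f : I -> X) (l : X) (A : set X) :
  f @ G --> l -> nbhs l A -> \forall i \near G, A (f i).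
Proof. by move=> h /h. Qed.

(** * Chart solutions: uniqueness, uniform bounds and limits *)

Section Paths.
Context {R : realType} {p d : nat} {M Z : metricType R} (F : foliated_space p M Z).
Variable al : R.
Hypothesis al_gt : 3^-1 < al.
Hypothesis al_lt : al < 2^-1.
Notation E := 'rV[R]_p.
Implicit Types (s t u : R) (a : fol_index F) (w : two_param R d) (x : R -> M) (T W S : R).

Definition path_continuous T x := forall t : R, 0 <= t -> t <= T -> forall e : R, 0 < e ->
  exists2 delta : R, 0 < delta &
    forall u : R, 0 <= u -> u <= T -> `|u - t| < delta -> mdist (x t) (x u) < e.

Lemma path_continuous_within T x : {within `[0, T], continuous x} -> path_continuous T x.
Proof.
move=> /subspace_continuousP cx t t0 tT e e0.
have : nbhs (x t) [set y | mdist (x t) y < e] by apply/nbhs_mdistP; exists e.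
move=> /(cx t); rewrite /= in_itv /= t0 tT => /(_ isT).
rewrite /nbhs /= /within /= => /nbhs_ballP[delta /= d0 sub]; exists delta => // u u0 uT ut.
by apply: sub; rewrite /= ?in_itv /= ?u0 ?uT// /ball /= distrC.
Qed.

Lemma path_continuous_reverse T S x : 0 <= S <= T -> path_continuous T x ->
  path_continuous S (fun u => x (S - u)).
Proof.
move=> /andP[S0 ST] cx t t0 tS e e0; have [||delta d0 hd] := cx (S - t) _ _ e e0; [lra|lra|].
exists delta => // u u0 uS ut; apply: hd; [lra|lra|].
have -> : S - u - (S - t) = - (u - t) by ring.
by rewrite normrN.
Qed.

Lemma path_stays T x (N : set M) t : path_continuous T x -> 0 <= t -> t <= T ->
  open N -> N (x t) -> exists2 delta : R, 0 < delta &
    forall u, 0 <= u -> u <= T -> `|u - t| < delta -> N (x u).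
Proof.
move=> cx t0 tT oN Nt.
have /nbhs_mdistP[e e0 he] : nbhs (x t) N by exact: open_nbhs_nbhs.
by have [delta d0 hd] := cx t t0 tT e e0; exists delta => // u u0 uT ut; apply/he/hd.
Qed.

Lemma open_chart_preimage a (O : set (E * Z)) : open O ->
  open [set m | fdom a m /\ O (fmap_ a m)].
Proof. by move=> oO; apply: open_preimage_in => //; [exact: open_fdom|exact: fmap_continuous]. Qed.

Lemma chart_stays T x a (O : set (E * Z)) t : path_continuous T x -> 0 <= t -> t <= T ->
  open O -> fdom a (x t) -> O (fmap_ a (x t)) -> exists2 delta : R, 0 < delta &
    forall u, 0 <= u -> u <= T -> `|u - t| < delta -> fdom a (x u) /\ O (fmap_ a (x u)).
Proof.
by move=> cx t0 tT oO at_ Ot; apply: (path_stays cx t0 tT (open_chart_preimage a oO)).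
Qed.

Variables (V : 'I_d -> vfield F) (V0 : vfield F).
Hypothesis hV : forall i, leafwise_vfield 3 (V i).
Hypothesis hV0 : leafwise_vfield 3 V0.

Definition window (U0 : vfield F) w x a (t0 t1 K : R) :=
  (forall u, t0 <= u -> u <= t1 ->
     fdom a (x u) /\ (fmap_ a (x u)).2 = (fmap_ a (x t0)).2) /\
  forall s t, t0 <= s -> s <= t -> t <= t1 ->
    `|davie_defect (local_A a V (fmap_ a (x t0)).2 w) (local_B a V U0 (fmap_ a (x t0)).2 w)
        (fun u => (fmap_ a (x u)).1) s t| <= K * (t - s) `^ al ^+ 3.

(* Windows to the right of each time suffice for uniqueness and, unlike
   [RDE_solution], this notion is stable under pointwise limits. *)
Definition chart_solution (U0 : vfield F) T w x := path_continuous T x /\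
  forall t0 a, 0 <= t0 -> t0 < T -> fdom a (x t0) ->
    exists t1 K, [/\ t0 < t1, t1 <= T & window U0 w x a t0 t1 K].

Lemma open_norm_ball (y0 : E) (r : R) : open [set q : E * Z | `|q.1 - y0| < r].
Proof.
rewrite (_ : [set q | _] = fst @^-1` ((fun y : E => `|y - y0|) @^-1` [set s : R | s < r]))//.
apply: open_comp; first by move=> q _; exact: cvg_fst.
apply: open_comp; last exact: open_lt.
move=> y _; apply: (@continuous_comp _ _ _ (fun y : E => y - y0) Num.norm); last exact: norm_continuous.
by apply: (@cvgD _ _ _ (nbhs y) _ id (fun=> - y0)); [exact: cvg_id|exact: cvg_cst].
Qed.

Lemma closed_region (q0 : E * Z) (r sig : R) : closed (region q0 r sig).
Proof.
rewrite (_ : region q0 r sig = (fst @^-1` [set y : E | `|y - q0.1| <= r]) `&`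
   (snd @^-1` [set z : Z | mdist z q0.2 <= sig])); last by apply/seteqP; split => q.
apply: closedI; apply: preimage_closed.
- by move=> q _; exact: cvg_fst.
- exact: closed_norm_ball.
- by move=> q _; exact: cvg_snd.
- exact: closed_mdist_ball.
Qed.

Lemma davie_smallness (A : R) : exists2 h : R, 0 < h & h <= 1 /\
  forall t, 0 <= t -> t <= h -> A * t `^ al <= 1.
Proof.
have B0 : 0 < (`|A| + 1)^-1 by rewrite invr_gt0 ltr_wpDl.
have [h h0 hh] := powR_al_small al_gt B0.
exists (Num.min 1 h); first by rewrite lt_min ltr01.
have := lexx (Num.min 1 h); rewrite le_min => /andP[l1 l2]; split=> // t t0 tm.
have := hh t t0 (le_trans tm l2); have o0 := powR_ge0 t al.
rewrite -[leRHS]mul1r ler_pdivlMr; last by rewrite ltr_wpDl.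
have := ler_norm A; nra.
Qed.

Lemma davie_smallness2 (A B r : R) : 0 < r -> exists2 h : R, 0 < h & h <= 1 /\
  forall t, 0 <= t -> t <= h -> A * t `^ al <= 1 /\ B * t `^ al <= r.
Proof.
move=> r0; have [h h0 [h1 hA]] := davie_smallness A; have [h' h0' [_ hB]] := davie_smallness (B / r).
exists (Num.min h h'); first by rewrite lt_min h0 h0'.
have := lexx (Num.min h h'); rewrite le_min => /andP[l1 l2].
split=> [|t t0 th]; first exact: le_trans l1 h1.
split; first exact: hA t0 (le_trans th l1).
by have := hB t t0 (le_trans th l2); rewrite mulrAC ler_pdivrMr// mul1r.
Qed.

(** Equality of the paths propagates by real induction: to limits by continuity, and to the right by
    [davie_unique] in a chart around the last common point. There the defect constants of the two
    paths may be arbitrary, since the step may depend on them. *)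
Lemma chart_solution_unique T W w x x' : 0 <= W -> driver al T W w ->
  chart_solution V0 T w x -> chart_solution V0 T w x' -> x 0 = x' 0 ->
  forall t, 0 <= t -> t <= T -> x t = x' t.
Proof.
move=> W0 hw [cx hx] [cx' hx'] x0; apply: real_induction => //; last first.
  move=> t t0 tT h; apply: mdist_positivity; apply/eqP; rewrite eq_le mdist_ge0 andbT.
  apply/ler_addgt0Pl => e e0; rewrite addr0.
  have e2 : 0 < e / 2 by rewrite divr_gt0.
  have [||delta d0 hd] := cx t _ _ _ e2 => //; first exact: ltW.
  have [||delta' d0' hd'] := cx' t _ _ _ e2 => //; first exact: ltW.
  have [eta [eta0 et ed ed']] : exists eta : R, [/\ 0 < eta, eta <= t, eta < delta & eta < delta'].
    exists (Num.min t (Num.min delta delta') / 2).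
    have m0 : 0 < Num.min t (Num.min delta delta') by rewrite !lt_min t0 d0 d0'.
    have := lexx (Num.min t (Num.min delta delta')).
    by rewrite !le_min => /andP[l1 /andP[l2 l3]]; split; lra.
  have ut : `|t - eta - t| = eta.
    by rewrite addrAC subrr add0r normrN ger0_norm//; lra.
  have u0 : 0 <= t - eta by lra.
  have uT : t - eta <= T by lra.
  have u1 : t - eta < t by lra.
  have h1 : mdist (x' t) (x' (t - eta)) < e / 2 by apply: hd'; rewrite ?ut.
  have h2 : mdist (x t) (x' (t - eta)) < e / 2 by rewrite -h//; apply: hd; rewrite ?ut.
  have := metric_triangle (x t) (x' (t - eta)) (x' t).
  by rewrite (metric_sym (x' (t - eta))); lra.
move=> t0 t00 t0T h; have xx : x t0 = x' t0 by exact: h.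
have t0T' := ltW t0T.
pose a := chart_at F (x t0).
have adom : fdom a (x t0) := projT2 (cid (fol_cover F (x t0))).
have adom' : fdom a (x' t0) by rewrite -xx.
have [r [sig [ O [[r0 sig0 oO Oa reg] [creg _]]]]] := local_extension (fmap_box adom).
have [L hL] := local_davie_system al_lt (ltW r0) creg (subset_trans reg Oa) hV hV0.
have [t1 [K [t01 t1T [win1 win2]]]] := hx t0 a t00 t0T adom.
have [t1' [K' [t01' t1T' [win1' win2']]]] := hx' t0 a t00 t0T adom'.
set q0 := fmap_ a (x t0) in reg creg hL win1 win2.
have q0' : fmap_ a (x' t0) = q0 by rewrite -xx.
rewrite q0' in win1' win2'.
have Oq0 : [set q : E * Z | `|q.1 - q0.1| < r] q0 by rewrite /= subrr normr0.
have [delta d0 hd] := chart_stays cx t00 t0T' (@open_norm_ball q0.1 r) adom Oq0.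
have Oq0' : [set q : E * Z | `|q.1 - q0.1| < r] (fmap_ a (x' t0)) by rewrite q0'.
have [delta' d0' hd'] := chart_stays cx' t00 t0T' (@open_norm_ball q0.1 r) adom' Oq0'.
have q1 := halving_ratio_lt1 al_gt.
have [h1 h10 [h11 hh1]] := davie_smallness (`|K| + `|K'|).
have [h2 h20 [h21 hh2]] := davie_smallness (120 * L W ^+ 3 / (1 - halving_ratio al)).
(* Both paths remain in their windows and in the ball of radius [r], and the two smallness
   conditions of [davie_unique] hold with |K| + |K'|. *)
pose eta := Num.min (t1 - t0) (Num.min (t1' - t0) (Num.min delta (Num.min delta' (Num.min h1 h2)))).
have := lexx eta; rewrite {2}/eta !le_min => /andP[l1 /andP[l2 /andP[l3 /andP[l4 /andP[l5 l6]]]]].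
exists eta; first by rewrite /eta !lt_min !subr_gt0 t01 t01' d0 d0' h10 h20.
move=> u t0u ut uT.
have u_le c : eta <= c - t0 -> u <= c.
  by move=> /(lerD (lexx t0)); rewrite [t0 + (c - t0)]addrC subrK => /(lt_le_trans ut)/ltW.
have ult : u - t0 < eta by rewrite ltrBlDl.
have u0 : 0 <= u - t0 by rewrite subr_ge0 ltW.
have sys : davie_system al (L W) t0 u [set y | `|y - q0.1| <= r]
    (local_A a V q0.2 w) (local_B a V V0 q0.2 w) (local_G a V q0.2 w).
  apply: (hL T W) => //; first by rewrite mdistxx ltW.
  exact: le_trans (ltW ult) (le_trans l5 h11).
have dist_u s : t0 <= s -> s <= u -> `|s - t0| < delta /\ `|s - t0| < delta'.
  move=> h3 h4; rewrite ger0_norm ?subr_ge0//.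
  have h5 := le_lt_trans (lerB h4 (lexx t0)) ult.
  by split; [exact: lt_le_trans h5 l3|exact: lt_le_trans h5 l4].
have yD s : t0 <= s -> s <= u -> [set y | `|y - q0.1| <= r] (fmap_ a (x s)).1.
  move=> h3 h4; have [h5 _] := dist_u s h3 h4.
  by have [_ /ltW] := hd s (le_trans t00 h3) (le_trans h4 uT) h5.
have yD' s : t0 <= s -> s <= u -> [set y | `|y - q0.1| <= r] (fmap_ a (x' s)).1.
  move=> h3 h4; have [_ h5] := dist_u s h3 h4.
  by have [_ /ltW] := hd' s (le_trans t00 h3) (le_trans h4 uT) h5.
have o3 (s : R) : 0 <= s `^ al ^+ 3 by rewrite exprn_ge0 ?powR_ge0.
have KK : K <= `|K| + `|K'| by apply: le_trans (ler_norm K) _; rewrite lerDl.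
have KK' : K' <= `|K| + `|K'| by apply: le_trans (ler_norm K') _; rewrite lerDr.
have yy : (fmap_ a (x u)).1 = (fmap_ a (x' u)).1.
  apply: (davie_unique al_gt sys yD yD' (ltW t0u) (P := `|K| + `|K'|)).
  - exact: addr_ge0.
  - move=> s t t0s st tu; apply: le_trans (win2 s t t0s st (le_trans tu (u_le _ l1))) _.
    by rewrite ler_wpM2r.
  - move=> s t t0s st tu; apply: le_trans (win2' s t t0s st (le_trans tu (u_le _ l2))) _.
    by rewrite ler_wpM2r.
  - exact: hh1 u0 (le_trans (ltW ult) l5).
  - have := hh2 (u - t0) u0 (le_trans (ltW ult) l6); rewrite mulrAC.
    by rewrite ler_pdivrMr ?subr_gt0// mul1r.
  - by rewrite xx.
  - exact: ltW.
  - exact: lexx.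
have [au zu] := win1 u (ltW t0u) (u_le _ l1).
have [au' zu'] := win1' u (ltW t0u) (u_le _ l2).
rewrite -(fmapK au) -(fmapK au') (surjective_pairing (fmap_ a (x u))) (surjective_pairing (fmap_ a (x' u))).
by rewrite yy zu zu'.
Qed.

(** Here windows reach to both sides of t, as is needed when time is reversed and when the leaf is
    followed up to a limit time. *)
Lemma local_solution_window T w m x a t : RDE_solution al 0 T V V0 w m x ->
  0 <= t -> t <= T -> fdom a (x t) -> exists2 delta : R, 0 < delta &
  forall s1 s2 : R, 0 <= s1 -> s1 <= s2 -> s2 <= T -> t - delta < s1 -> s2 < t + delta ->
    exists K, window V0 w x a s1 s2 K.
Proof.
move=> sol t0 tT adom; have cx : path_continuous T x by apply: path_continuous_within; case: sol.
have [r [sig [ O [[r0 sig0 oO Oa reg] [_ hext]]]]] := local_extension (fmap_box adom).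
have Ot : O (fmap_ a (x t)).
  by apply: reg; split; rewrite /= ?subrr ?normr0 ?mdistxx ltW.
have [delta d0 hd] := chart_stays cx t0 tT oO adom Ot; exists delta => // s1 s2 s10 s12 s2T h1 h2.
have hx u : s1 <= u -> u <= s2 -> fdom a (x u) /\ O (fmap_ a (x u)).
  by move=> h3 h4; apply: hd; rewrite ?ltr_norml; [lra|lra|apply/andP; split; lra].
have [hz [K hK]] := RDE_local_equation al_gt hV hV0 oO Oa hext sol s10 s12 s2T hx.
exists K; split=> // u h3 h4; split; last exact: hz.
by have [] := hx u h3 h4.
Qed.

Lemma RDE_chart_solution T S w m x : S <= T -> RDE_solution al 0 T V V0 w m x ->
  chart_solution V0 S w x.
Proof.
move=> ST sol; have cx : path_continuous T x by apply: path_continuous_within; case: sol.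
split.
  move=> t t0 tS e e0; have tT : t <= T by lra.
  have [delta d0 hd] := cx t t0 tT e e0.
  by exists delta => // u u0 uS; apply: hd => //; lra.
move=> t0 a t00 t0S adom; have t0T : t0 <= T by lra.
have [delta d0 hd] := local_solution_window sol t00 t0T adom.
pose t1 := Num.min S (t0 + delta / 2).
have := lexx t1; rewrite {2}/t1 le_min => /andP[l1 l2].
have lt1 : t0 < t1 by rewrite /t1 lt_min t0S ltrDl divr_gt0.
have [|||||K hK] := hd t0 t1; [lra|lra|lra|lra|lra|].
by exists t1, K.
Qed.

Lemma small_region (q0 : E * Z) (N : set (E * Z)) (r sig : R) : 0 < r -> 0 < sig ->
  open N -> N q0 -> exists r' sig' : R, [/\ 0 < r', r' <= r, 0 < sig', sig' <= sig &
    region q0 r' sig' `<=` N].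
Proof.
move=> r0 sig0 oN Nq; have : nbhs q0 N by exact: open_nbhs_nbhs.
case=> -[A B] /= [nA nB] AB.
have [e e0 he] : exists2 e : R, 0 < e & forall y, `|y - q0.1| <= e -> A y.
  have /nbhs_ballP[e /= e0 sub] := nA; exists (e / 2); first by rewrite divr_gt0.
  move=> y hy; apply: sub; rewrite mx_norm_ball /ball_ /= distrC.
  by apply: le_lt_trans hy _; rewrite ltr_pdivrMr// ltr_pMr// ltr1n.
have /nbhs_mdistP[e' e0' he'] := nB.
exists (Num.min r e), (Num.min sig (e' / 2)); have e2 : 0 < e' / 2 by rewrite divr_gt0.
split; rewrite ?lt_min ?ge_min ?r0 ?sig0 ?e0 ?e2 ?lexx//.
move=> [y z] [/= hy hz]; apply: AB; split=> /=.
  by apply: he; apply: le_trans hy _; rewrite ge_min lexx orbT.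
apply: he'; rewrite metric_sym; apply: (le_lt_trans hz).
rewrite gt_min; apply/orP; right; lra.
Qed.

Lemma closed_chart_image a (K : set (E * Z)) : compact K -> K `<=` fbox a ->
  closed (finv_ a @` K).
Proof.
move=> cK Ka; apply: compact_closed; first exact: metric_hausdorff.
apply: continuous_compact => //; apply: continuous_in_subspaceT => q.
by rewrite inE => /Ka; exact: finv_continuous.
Qed.

Lemma chart_imageP a (K : set (E * Z)) m : K `<=` fbox a ->
  (finv_ a @` K) m <-> fdom a m /\ K (fmap_ a m).
Proof.
move=> Ka; split=> [[q Kq <-]|[am Km]].
  by rewrite finvK ?finvK; [split=> //; apply: finv_dom; exact: Ka|exact: Ka].
by exists (fmap_ a m) => //; exact: fmapK.
Qed.

Lemma path_closed_limit T x (C : set M) s t : path_continuous T x -> closed C ->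
  0 <= s -> s < t -> t <= T -> (forall u, s <= u -> u < t -> C (x u)) -> C (x t).
Proof.
move=> cx clC s0 st tT hC; apply: contrapT => nC.
have t0 : 0 <= t by lra.
have [delta d0 hd] := path_stays cx t0 tT (closed_openC clC) nC.
have [u [su ut tu]] : exists u : R, [/\ s <= u, u < t & t - delta < u].
  exists (Num.max s (t - delta / 2)); rewrite le_max lexx gt_max st lt_max; split=> //=.
    by rewrite gtrBl divr_gt0.
  by apply/orP; right; lra.
have [||] := hd u _ _ _ (hC u su ut); [lra|lra|].
by rewrite ltr_norml; apply/andP; split; lra.
Qed.

(** The residence time [eta] and the constant [K] serve all solutions that start near [q0] and all
    drivers of size [W]. While a solution is in the region, the a priori bound limits its increment
    to r / 2; as it starts within r / 2 of the centre, it cannot reach the boundary. *)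
Lemma solutions_stay a q0 (N : set (E * Z)) W : fbox a q0 -> open N -> N q0 -> 0 <= W ->
  exists r sig eta K : R, [/\ 0 < r, 0 < sig, 0 < eta & 0 <= K] /\
  [/\ compact (region q0 r sig), region q0 r sig `<=` fbox a `&` N &
  forall T w m x s0 t1, driver al T W w -> RDE_solution al 0 T V V0 w m x ->
    0 <= s0 -> s0 <= t1 -> t1 <= T -> t1 <= s0 + eta -> fdom a (x s0) ->
    `|(fmap_ a (x s0)).1 - q0.1| < r / 2 -> mdist (fmap_ a (x s0)).2 q0.2 < sig ->
    (forall u, s0 <= u -> u <= t1 -> fdom a (x u) /\ region q0 r sig (fmap_ a (x u))) /\
    window V0 w x a s0 t1 K].
Proof.
move=> aq0 oN Nq0 W0.
have [r1 [sig1 [ O [[r10 sig10 oO Oa reg1] [creg1 hext]]]]] := local_extension aq0.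
have [r [sig [r0 rr sig0 ss regN]]] := small_region r10 sig10 oN Nq0.
have regs : region q0 r sig `<=` region q0 r1 sig1.
  by move=> q [h1 h2]; split; [exact: le_trans h1 rr|exact: le_trans h2 ss].
have creg : compact (region q0 r sig).
  by apply: (subclosed_compact _ creg1 regs); exact: closed_region.
have rega : region q0 r sig `<=` fbox a by move=> q /regs /reg1 /Oa.
have [L hL] := local_davie_system al_lt (ltW r0) creg rega hV hV0.
pose K := davie_constant al (L W).
have r2 : 0 < r / 2 by rewrite divr_gt0.
(* The first condition is that of [davie_apriori]; the second bounds the increment by r / 2. The
   absolute value is taken because [K] is known to be nonnegative only once a Davie system is
   given. *)
have [h h0 [h1 hh]] := davie_smallness2 `|K| (2 * L W + `|K|) r2.
have K0 : 0 <= `|K| by [].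
exists r, sig, h, `|K|; split=> //; split=> //; first by move=> q hq; split; [exact: rega|exact: regN].
move=> T w m x s0 t1 hw sol s00 s01 t1T t1h adom yr zsig.
have cx : path_continuous T x by apply: path_continuous_within; case: sol.
pose P u := fdom a (x u) /\ region q0 r sig (fmap_ a (x u)).
have Ps0 : P s0 by split=> //; split => /=; [lra|exact: ltW].
have apriori t : s0 <= t -> t <= t1 -> (forall u, s0 <= u -> u <= t -> P u) ->
    window V0 w x a s0 t `|K| /\ `|(fmap_ a (x t)).1 - q0.1| < r.
  move=> s0t tt1 hP; have tT : t <= T by lra.
  have hx u : s0 <= u -> u <= t -> fdom a (x u) /\ O (fmap_ a (x u)).
    by move=> h3 h4; have [h5 h6] := hP u h3 h4; split=> //; apply/reg1/regs.
  have [hz [C hC]] := RDE_local_equation al_gt hV hV0 oO Oa hext sol s00 s0t tT hx.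
  set z := (fmap_ a (x s0)).2 in hz hC zsig *.
  have ts0 : 0 <= t - s0 by rewrite subr_ge0.
  have ts0h : t - s0 <= h by rewrite lerBlDl; exact: le_trans tt1 t1h.
  have sys : davie_system al (L W) s0 t [set y | `|y - q0.1| <= r]
     (local_A a V z w) (local_B a V V0 z w) (local_G a V z w).
    by apply: (hL T W) => //; [exact: ltW|exact: le_trans ts0h h1].
  have L1 := ds_L sys.
  have yD s : s0 <= s -> s <= t -> [set y | `|y - q0.1| <= r] (fmap_ a (x s)).1.
    by move=> h3 h4; have [_ []] := hP s h3 h4.
  have Kn : `|K| = K by rewrite ger0_norm//; exact: (davie_constant_ge0 al_gt sys).
  rewrite Kn in hh K0 *.
  have [sm1 _] := hh h (ltW h0) (lexx h).
  have hK s u : s0 <= s -> s <= u -> u <= t -> `|davie_defect (local_A a V z w) (local_B a V V0 z w)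
        (fun u => (fmap_ a (x u)).1) s u| <= K * (u - s) `^ al ^+ 3.
    move=> h3 h4 h5; apply: (davie_apriori al_gt sys yD hC sm1) => //.
    exact: le_trans (lerB h5 h3) ts0h.
  split.
    by split=> // u h3 h4; have [h5 _] := hP u h3 h4; split=> //; exact: hz.
  have [_ sm2] := hh (t - s0) ts0 ts0h.
  have := davie_increment al_gt sys (y := fun u => (fmap_ a (x u)).1) (N := K) (lexx s0) s0t (lexx t) (yD _ (lexx _) s0t).
  have o0 := powR_ge0 (t - s0) al.
  have o1 : (t - s0) `^ al <= 1 := powR_al_le1 al_gt ts0 (le_trans ts0h h1).
  have o3 : (t - s0) `^ al ^+ 3 <= (t - s0) `^ al by rewrite exprS ler_piMr// exprn_ile1.
  move=> /(_ (le_trans (hK _ _ (lexx _) s0t (lexx _)) (ler_wpM2l K0 o3))) inc.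
  have -> : (fmap_ a (x t)).1 - q0.1 = ((fmap_ a (x t)).1 - (fmap_ a (x s0)).1) + ((fmap_ a (x s0)).1 - q0.1).
    by rewrite addrA subrK.
  apply: le_lt_trans (ler_normD _ _) _; rewrite [r]splitr.
  exact: ler_ltD (le_trans inc sm2) yr.
(* The strict bound and the constant transverse coordinate allow the path to continue in the region;
   limits remain in it since the image of a compact region is closed in [M]. *)
have hP : forall u, s0 <= u -> u <= t1 -> P u.
  apply: real_induction => // [t s0t tt1 hP|t s0t tt1 hP].
    have [[win _] yt] := apriori t s0t (ltW tt1) hP.
    have [at_ zt] := win t s0t (lexx t).
    pose O' := [set q : E * Z | `|q.1 - q0.1| < r] `&` (snd @^-1` [set z : Z | mdist z q0.2 < sig]).
    have oO' : open O'.
      apply: openI; first exact: open_norm_ball.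
      by apply: open_comp; [move=> q _; exact: cvg_snd|exact: open_mdist_ball].
    have t0 : 0 <= t := le_trans s00 s0t.
    have tT : t <= T := le_trans (ltW tt1) t1T.
    have zt' : mdist (fmap_ a (x t)).2 q0.2 < sig by rewrite zt.
    have [delta d0 hd] := chart_stays cx t0 tT oO' at_ (conj yt zt').
    exists delta => // u tu ud ut1.
    have ut : `|u - t| < delta by rewrite gtr0_norm ?subr_gt0// ltrBlDl.
    have [au [h3 h4]] := hd u (le_trans t0 (ltW tu)) (le_trans ut1 t1T) ut.
    by split=> //; split; exact: ltW.
  have [h3 h4] := chart_imageP (x t) rega.
  apply: h3; apply: (path_closed_limit cx (closed_chart_image creg rega) s00 s0t (le_trans tt1 t1T)).
  by move=> u h5 h6; apply/(chart_imageP _ rega); exact: hP.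
by split=> //; have [] := apriori t1 s01 (lexx t1) hP.
Qed.

Hypothesis cM : compact [set: M].

(** Near each point of [M], [solutions_stay] gives a time during which solutions remain in a set of
    diameter at most e; compactness of [M] makes this time uniform. *)
Lemma equicontinuity W (e : R) : 0 <= W -> 0 < e -> exists2 eta : R, 0 < eta &
  forall T w m x s t, driver al T W w -> RDE_solution al 0 T V V0 w m x ->
    0 <= s -> s <= t -> t <= T -> t <= s + eta -> mdist (x s) (x t) < e.
Proof.
move=> W0 e0.
pose P (eta : R) (m0 : M) := forall T w m x s t, driver al T W w ->
  RDE_solution al 0 T V V0 w m x ->
  0 <= s -> s <= t -> t <= T -> t <= s + eta -> x s = m0 -> mdist (x s) (x t) < e.
have near_P : \forall eta \near 0^'+, [set: M] `<=` P eta.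
  apply: ((compact_near_coveringP [set: M]).1 cM R (0^'+) P) => m0 _.
  pose a := chart_at F m0.
  have am : fdom a m0 := projT2 (cid (fol_cover F m0)).
  pose N := [set q | fbox a q /\ mdist (finv_ a q) m0 < e / 2].
  have oN : open N.
    apply: (open_preimage_in (B := [set y | mdist y m0 < e / 2])); last exact: finv_continuous.
      exact: open_fbox.
    exact: open_mdist_ball.
  have Nq : N (fmap_ a m0) by split; [exact: fmap_box|rewrite fmapK// mdistxx divr_gt0].
  have [r [sig [eta [K [[r0 sig0 eta0 K0] [creg regN stay]]]]]] := solutions_stay (fmap_box am) oN Nq W0.
  pose O' := [set q : E * Z | `|q.1 - (fmap_ a m0).1| < r / 2] `&` (snd @^-1` [set z : Z | mdist z (fmap_ a m0).2 < sig]).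
  have oO' : open O'.
    apply: openI; first exact: open_norm_ball.
    by apply: open_comp; [move=> q _; exact: cvg_snd|exact: open_mdist_ball].
  exists ([set m | fdom a m /\ O' (fmap_ a m)], [set eta' : R | eta' <= eta]) => /=.
    split; last exact: nbhs_right_le.
    apply: open_nbhs_nbhs; split; first exact: open_chart_preimage.
    by split=> //; split; rewrite /= ?subrr ?normr0 ?mdistxx ?divr_gt0.
  move=> [m1 eta1] [/= [am1 [y1 z1]] eta1le] T w m x s t hw sol s0 st tT ts xs.
  have ts' : t <= s + eta by lra.
  rewrite -xs in am1 y1 z1.
  have [inreg _] := stay T w m x s t hw sol s0 st tT ts' am1 y1 z1.
  have near_m0 u : s <= u -> u <= t -> mdist (x u) m0 < e / 2.
    move=> h1 h2; have [au /regN[_ [_]]] := inreg u h1 h2.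
    by rewrite fmapK.
  exact: mdist_lt_half (near_m0 s (lexx s) st) (near_m0 t st (lexx t)).
near (0 : R)^'+ => eta; exists eta => [//|T w m x s t hw sol s0 st tT ts].
have hP : [set: M] `<=` P eta by near: eta.
exact: (hP (x s) I T w m x s t).
Unshelve. all: by end_near. Qed.

Section FieldLimits.
Variables (I : Type) (G : set_system I).
Context {FG : Filter G}.
Variables (a : fol_index F) (qs : I -> E * Z) (q : E * Z).
Hypothesis cq : qs @ G --> q.
Hypothesis aq : fbox a q.

Lemma cvg_field k U : leafwise_vfield k U -> field_in a U (qs i) @[i --> G] --> field_in a U q.
Proof.
move=> [_ cU]; apply: (cvg_comp _ _ cq).
exact: (CL_continuous (@open_fbox _ _ _ _ _ a) (CL_le (leq0n k) (cU a)) aq).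
Qed.

Lemma cvg_second_field U U' : leafwise_vfield 1 U -> leafwise_vfield 1 U' ->
  second_field a U U' (qs i) @[i --> G] --> second_field a U U' q.
Proof.
move=> [_ cU] [_ cU']; have oa := @open_fbox _ _ _ _ _ a; apply: (cvg_comp _ _ cq).
apply: cvg_fin_sum => l; apply: cvgZ.
  exact: (CL_continuous oa (CL_entry l oa (CL_pred (cU a))) aq).
exact: (CL_continuous oa (CL_pder l (cU' a)) aq).
Qed.

Lemma cvg_local_A (ws : I -> two_param R d) w s t :
  (forall j, rp1 (ws i) s t 0 j @[i --> G] --> rp1 w s t 0 j) ->
  local_A a V (qs i).2 (ws i) s t (qs i).1 @[i --> G] --> local_A a V q.2 w s t q.1.
Proof.
move=> cw; apply: cvg_fin_sum => j; apply: cvgZ; first exact: cw.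
rewrite -surjective_pairing; under eq_fun do rewrite -surjective_pairing.
exact: cvg_field.
Qed.

Lemma cvg_local_B (ws : I -> two_param R d) w s t :
  (forall j k, rp2 (ws i) s t j k @[i --> G] --> rp2 w s t j k) ->
  local_B a V V0 (qs i).2 (ws i) s t (qs i).1 @[i --> G] --> local_B a V V0 q.2 w s t q.1.
Proof.
have hV1 j : leafwise_vfield 1 (V j).
  by have [tV cV] := hV j; split=> // b; exact: CL_le (cV b).
move=> cw; rewrite /local_B -surjective_pairing; under eq_fun do rewrite -surjective_pairing.
apply: cvgD; last by apply: cvgZ; [exact: cvg_cst|exact: (cvg_field hV0)].
apply: cvg_fin_sum => j; apply: cvg_fin_sum => k; apply: cvgZ; first exact: cw.
exact: cvg_second_field.
Qed.

End FieldLimits.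

(** * Pointwise limits of solutions *)

Section Limit.
Variables (I : Type) (G : set_system I).
Context {FG : ProperFilter G}.
Variables (T W : R) (ws : I -> two_param R d) (w : two_param R d).
Variables (ms : I -> M) (xs : I -> R -> M) (x : R -> M).
Hypothesis W0 : 0 <= W.
Hypothesis hws : \forall i \near G, driver al T W (ws i).
Hypothesis cws : forall e : R, 0 < e -> \forall i \near G, rough_close al T e w (ws i).
Hypothesis sols : \forall i \near G, RDE_solution al 0 T V V0 (ws i) (ms i) (xs i).
Hypothesis cxs : forall t, 0 <= t -> t <= T -> xs ^~ t @ G --> x t.

Lemma limit_path_continuous : path_continuous T x.
Proof.
move=> t t0 tT e e0; have e3 : 0 < e / 3 by rewrite divr_gt0.
have [eta eta0 heta] := equicontinuity W0 e3; exists eta => // u u0 uT ut.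
have near_x (v : R) : 0 <= v -> v <= T -> \forall i \near G, mdist (x v) (xs i v) < e / 3.
  by move=> v0 vT; apply: (cvg_near (A := [set y | mdist (x v) y < e / 3]) (cxs v0 vT)); apply/nbhs_mdistP; exists (e / 3).
near G => i.
have h1 : mdist (x t) (xs i t) < e / 3 by near: i; exact: near_x.
have h2 : mdist (x u) (xs i u) < e / 3 by near: i; exact: near_x.
have h3 : driver al T W (ws i) by near: i; exact: hws.
have h4 : RDE_solution al 0 T V V0 (ws i) (ms i) (xs i) by near: i; exact: sols.
have h5 : mdist (xs i t) (xs i u) < e / 3.
  move: ut; rewrite ltr_norml => /andP[ut1 ut2].
  have [tu|ut'] := leP t u; first by apply: (heta _ _ _ _ _ _ h3 h4) => //; lra.
  by rewrite metric_sym; apply: (heta _ _ _ _ _ _ h3 h4) => //; lra.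
exact: mdist_lt_third h1 h2 h5.
Unshelve. all: by end_near. Qed.

Let cvg_rp1 s t j : 0 <= s -> s <= t -> t <= T -> rp1 (ws i) s t 0 j @[i --> G] --> rp1 w s t 0 j.
Proof.
move=> s0 st tT; apply/cvgrPdist_le => e e0; have o0 := powR_ge0 (t - s) al.
have A0 : 0 < (t - s) `^ al + 1 by lra.
apply: filterS (cws (divr_gt0 e0 A0)) => i /(_ s t s0 st tT)[h _].
have := coord_le_norm (rp1 w s t - rp1 (ws i) s t) 0 j; rewrite !mxE => /le_trans; apply.
apply: le_trans h _; rewrite mulrAC ler_pdivrMr//; nra.
Qed.

Let cvg_rp2 s t j k : 0 <= s -> s <= t -> t <= T -> rp2 (ws i) s t j k @[i --> G] --> rp2 w s t j k.
Proof.
move=> s0 st tT; apply/cvgrPdist_le => e e0; have o0 := exprn_ge0 2 (powR_ge0 (t - s) al).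
have A0 : 0 < (t - s) `^ al ^+ 2 + 1 by lra.
apply: filterS (cws (divr_gt0 e0 A0)) => i /(_ s t s0 st tT)[_ h].
have := coord_le_norm (rp2 w s t - rp2 (ws i) s t) j k; rewrite !mxE => /le_trans; apply.
apply: le_trans h _; rewrite mulrAC ler_pdivrMr//; nra.
Qed.

(** The approximating solutions have windows with a common end [t1] and constant [K], and they lie
    in a compact region, so the limit stays in the chart and its defect satisfies the same closed
    bound. *)
Lemma limit_window t0 a : 0 <= t0 -> t0 < T -> fdom a (x t0) ->
  exists t1 K, [/\ t0 < t1, t1 <= T & window V0 w x a t0 t1 K].
Proof.
move=> t00 t0T adom; have t0T' := ltW t0T.
have [r [sig [eta [K [[r0 sig0 eta0 K0] [creg regN stay]]]]]] := solutions_stay (fmap_box adom) openT Logic.I W0.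
set q0 := fmap_ a (x t0) in creg regN stay.
have rega : region q0 r sig `<=` fbox a by move=> q /regN[].
pose t1 := Num.min T (t0 + eta).
have t01 : t0 < t1 by rewrite /t1 lt_min t0T ltrDl.
have [t1T t1e] : t1 <= T /\ t1 <= t0 + eta.
  by have := lexx t1; rewrite {2}/t1 le_min => /andP.
clearbody t1.
exists t1, K; split=> //.
pose O' := [set q : E * Z | `|q.1 - q0.1| < r / 2] `&` (snd @^-1` [set z : Z | mdist z q0.2 < sig]).
have oO' : open O'.
  apply: openI; first exact: open_norm_ball.
  by apply: open_comp; [move=> q _; exact: cvg_snd|exact: open_mdist_ball].
have near_stay : \forall i \near G,
    (forall u, t0 <= u -> u <= t1 -> fdom a (xs i u) /\ region q0 r sig (fmap_ a (xs i u))) /\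
    window V0 (ws i) (xs i) a t0 t1 K.
  have nO : \forall i \near G, fdom a (xs i t0) /\ O' (fmap_ a (xs i t0)).
    apply: (cvg_near (A := [set m | fdom a m /\ O' (fmap_ a m)]) (cxs t00 t0T')); apply: open_nbhs_nbhs; split; first exact: (open_chart_preimage a oO').
    by split=> //; split; rewrite /= ?subrr ?normr0 ?mdistxx ?divr_gt0.
  apply: filterS3 nO hws sols => i [am [y1 z1]] hw sol.
  by apply: (stay T _ _ _ t0 t1 hw sol) => //; exact: ltW.
have in_reg u : t0 <= u -> u <= t1 -> fdom a (x u) /\ region q0 r sig (fmap_ a (x u)).
  move=> h1 h2; apply/(chart_imageP _ rega).
  have [u0 uT] : 0 <= u /\ u <= T by split; lra.
  have hn : \forall i \near G, (finv_ a @` region q0 r sig) (xs i u).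
    by apply: filterS near_stay => i [h3 _]; apply/(chart_imageP _ rega); exact: h3.
  exact: (closed_cvg _ (closed_chart_image creg rega) hn _ (cxs u0 uT)).
have cvg_q u : t0 <= u -> u <= t1 -> fmap_ a (xs i u) @[i --> G] --> fmap_ a (x u).
  move=> h1 h2; have [au _] := in_reg u h1 h2.
  have [u0 uT] : 0 <= u /\ u <= T by split; lra.
  exact: (cvg_comp _ _ (cxs u0 uT) (fmap_continuous au)).
have cvg_y u : t0 <= u -> u <= t1 -> (fmap_ a (xs i u)).1 @[i --> G] --> (fmap_ a (x u)).1.
  by move=> h1 h2; apply: (cvg_comp _ _ (cvg_q u h1 h2)); exact: cvg_fst.
have cvg_z u : t0 <= u -> u <= t1 -> (fmap_ a (xs i u)).2 @[i --> G] --> (fmap_ a (x u)).2.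
  by move=> h1 h2; apply: (cvg_comp _ _ (cvg_q u h1 h2)); exact: cvg_snd.
have zc u : t0 <= u -> u <= t1 -> (fmap_ a (x u)).2 = (fmap_ a (x t0)).2.
  move=> h1 h2; apply: (cvg_unique (@metric_hausdorff R Z) (cvg_z u h1 h2)).
  apply: cvg_trans (cvg_z t0 (lexx _) (ltW t01)); apply: near_eq_cvg.
  by apply: filterS near_stay => i [_ [h3 _]]; have [_ ->] := h3 u h1 h2.
split=> [u h1 h2|s t t0s st tt1]; first by split; [have [] := in_reg u h1 h2|exact: zc].
have st0 : s <= t1 by lra.
have t0t : t0 <= t by lra.
have s0 : 0 <= s by lra.
have tT : t <= T by lra.
have [as_ rs] := in_reg s t0s st0.
(* The transverse coordinate is taken at time s instead of t0, so that both arguments of the fields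
   come from the single convergent family [fmap_ a (xs i s)]; within a window the two choices
   agree. *)
pose D i := davie_defect (local_A a V (fmap_ a (xs i s)).2 (ws i)) (local_B a V V0 (fmap_ a (xs i s)).2 (ws i))
        (fun u => (fmap_ a (xs i u)).1) s t.
have Dle : \forall i \near G, `|D i| <= K * (t - s) `^ al ^+ 3.
  apply: filterS near_stay => i [_ [h1 h2]]; rewrite /D.
  by have [_ ->] := h1 s t0s st0; exact: h2.
have cD : D i @[i --> G] --> davie_defect (local_A a V (fmap_ a (x s)).2 w) (local_B a V V0 (fmap_ a (x s)).2 w)
        (fun u => (fmap_ a (x u)).1) s t.
  apply: cvgB; last first.
    by apply: cvg_local_B; [exact: cvg_q|exact/rega|move=> j k; exact: cvg_rp2].
  apply: cvgB; last first.
    by apply: cvg_local_A; [exact: cvg_q|exact/rega|move=> j; exact: cvg_rp1].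
  by apply: cvgB; apply: cvg_y.
rewrite (zc s t0s st0) in cD.
have cl : closed ((fun v : E => `|v|) @^-1` [set r : R | r <= K * (t - s) `^ al ^+ 3]).
  by apply: preimage_closed; [move=> v _; exact: norm_continuous|exact: closed_le].
exact: (closed_cvg _ cl Dle _ cD).
Qed.

Lemma limit_chart_solution : chart_solution V0 T w x.
Proof. by split; [exact: limit_path_continuous|exact: limit_window]. Qed.

End Limit.

End Paths.

(** * The flow *)

Lemma ultra_fmap {I U : Type} (f : I -> U) (G : set_system I) : UltraFilter G -> UltraFilter (f @ G).
Proof.
move=> UG; split=> [|H PH sub]; first exact: fmap_proper_filter.
rewrite predeqE => A; split; last exact: sub.
move=> HA; have [//|GnA] := in_ultra_setVsetC (f @^-1` A) UG.
have HnA : H (~` A) by apply: sub; exact: GnA.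
by have /filter_ex[u [Au nAu]] : H (A `&` ~` A) by exact: filterI.
Qed.

(** One ultrafilter gives limits at all times simultaneously, so no subsequence has to be
    extracted. *)
Lemma compact_ultra_limit {I : Type} {X : topologicalType} (G : set_system I) (f : I -> X) (K : set X) :
  UltraFilter G -> compact K -> (forall i, K (f i)) -> exists2 l, K l & f @ G --> l.
Proof.
move=> UG; rewrite compact_ultra => cK fK.
have [|l [Kl fl]] := cK (f @ G) (ultra_fmap f UG); last by exists l.
by apply: (@filterE _ _ _ (f @^-1` K)).
Qed.

Lemma cvg_dist_lt {I : Type} {R : realType} (G : set_system I) {FG : Filter G} (f : I -> R) (l e : R) :
  f @ G --> l -> 0 < e -> \forall i \near G, `|l - f i| < e.
Proof. by move=> /cvgrPdist_lt; exact. Qed.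

Lemma vanishing_ultrafilter (R : realType) : exists2 G : set_system nat, UltraFilter G &
  forall e : R, 0 < e -> \forall n \near G, n.+1%:R^-1 < e.
Proof.
have [G [UG sub]] := ultraFilterLemma (eventually_filter : ProperFilter \oo); exists G => // e e0.
by apply: sub; exact: near_infty_natSinv_lt (PosNum e0).
Qed.

(** * Plaque chains and leaves *)

Section Leaves.
Context {R : realType} {p d : nat} {M Z : metricType R} (F : foliated_space p M Z).

Lemma common_plaque (a : fol_index F) m m' : fdom a m -> fdom a m' ->
  (fmap_ a m).2 = (fmap_ a m').2 -> exists P, [/\ plaque F P, P m & P m'].
Proof.
move=> am am' mm'.
have [b1 b2] := fmap_box am; have [b1' b2'] := fmap_box am'.
exists (chart_inv (fol_chart a) @` (chart_base (fol_chart a) `*` [set (fmap_ a m).2])); split.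
- by exists a, (fmap_ a m).2.
- by exists (fmap_ a m); [split|exact: fmapK].
- by exists (fmap_ a m'); [split|exact: fmapK].
Qed.

Lemma leaf_refl m : leaf F m m.
Proof.
have [a am] := fol_cover F m; have [P [hP Pm _]] := @common_plaque a m m am am erefl.
by exists 0%N, (fun=> P); split.
Qed.

Lemma leaf_step m x y (P : set M) : leaf F m x -> plaque F P -> P x -> P y -> leaf F m y.
Proof.
move=> [n [Q [hQ Qm Qx hc]]] hP Px Py.
exists n.+1, (fun i => if (i <= n)%N then Q i else P); split.
- by move=> i _; case: ifP => [/hQ|].
- by [].
- by rewrite ltnn.
- move=> i; rewrite ltnS => ile; rewrite ile; case: ifP => [h|h]; first exact: hc.
  by have -> : i = n; [apply/eqP; rewrite eqn_leq ile leqNgt h|exists x].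
Qed.

Lemma leaf_trans m x y : leaf F m x -> leaf F x y -> leaf F m y.
Proof.
move=> mx [n [Q [hQ Qx Qy hc]]].
suff H i : (i <= n)%N -> forall u, Q i u -> leaf F m u by exact: (H n (leqnn n)).
elim: i => [_|i ih lin] u Qu; first exact: (leaf_step mx (hQ 0%N _) Qx Qu).
have [v [v1 v2]] := hc i lin.
exact: (leaf_step (ih (ltnW lin) v v1) (hQ _ lin) v2 Qu).
Qed.

Lemma leaf_preserving_foliation (f : M -> M) : leaf_preserving F f -> foliation_preserving F f.
Proof. by move=> hf m; exists m => _ [x mx <-]; exact: leaf_trans mx (hf x). Qed.

Lemma leafwise_vf_opp k (U : vfield F) : leafwise_vfield k U -> leafwise_vfield k (vf_opp U).
Proof.
move=> [tU cU]; split=> [a b m am bm|a]; last exact: (CL_opp (@open_fbox _ _ _ _ _ a) (cU a)).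
rewrite /vf_opp (tU a b m am bm) -sumrN; apply: eq_bigr => i _.
by rewrite mxE scaleNr.
Qed.

Lemma vf_oppK (U : vfield F) : vf_opp (vf_opp U) = U.
Proof. by apply/funext => a; apply/funext => m; rewrite /vf_opp opprK. Qed.

End Leaves.

(** * Solutions stay in leaves, and solve the reversed equation backwards *)

Section Solutions.
Context {R : realType} {p d : nat} {M Z : metricType R} (F : foliated_space p M Z).
Variable al : R.
Hypothesis al_gt : 3^-1 < al.
Hypothesis al_lt : al < 2^-1.
Notation E := 'rV[R]_p.
Implicit Types (s t u v T W S : R) (a : fol_index F) (w : two_param R d) (x : R -> M).
Variables (V : 'I_d -> vfield F) (V0 : vfield F).
Hypothesis hV : forall i, leafwise_vfield 3 (V i).
Hypothesis hV0 : leafwise_vfield 3 V0.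

(** The transverse coordinate is constant in a window, so its two ends lie in one plaque; real
    induction chains such plaques. *)
Lemma solution_leaf T w m x : RDE_solution al 0 T V V0 w m x ->
  forall t, 0 <= t -> t <= T -> leaf F m (x t).
Proof.
move=> sol; have [_ x0 _] := sol.
have step s t a K : s <= t -> window al V V0 w x a s t K -> exists P, [/\ plaque F P, P (x s) & P (x t)].
  move=> st [h _]; have [as_ zs] := h s (lexx s) st; have [at_ zt] := h t st (lexx t).
  by apply: (common_plaque as_ at_); rewrite zt.
apply: real_induction => [|t t0 tT hl|t t0 tT hl]; first by rewrite x0; exact: leaf_refl.
  have [a at_] := fol_cover F (x t); have tT' := ltW tT.
  have [delta d0 hd] := local_solution_window al_gt hV hV0 sol t0 tT' at_.
  exists delta => // u tu ud uT.
  have [|||||K hK] := hd t u; [lra|lra|lra|lra|lra|].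
  have [P [hP Pt Pu]] := step _ _ _ _ (ltW tu) hK.
  exact: (leaf_step (hl t t0 (lexx t)) hP Pt Pu).
have [a at_] := fol_cover F (x t); have t0' := ltW t0.
have [delta d0 hd] := local_solution_window al_gt hV hV0 sol t0' tT at_.
have [u [u0 ut tu]] : exists u : R, [/\ 0 <= u, u < t & t - delta < u].
  exists (Num.max 0 (t - delta / 2)); rewrite le_max lexx gt_max t0 lt_max; split=> //=.
    by rewrite gtrBl divr_gt0.
  by apply/orP; right; lra.
have [|||||K hK] := hd u t; [lra|lra|lra|lra|lra|].
have [P [hP Pu Pt]] := step _ _ _ _ (ltW ut) hK.
exact: (leaf_step (hl u u0 ut) hP Pu Pt).
Qed.

Lemma local_A_reversal a (z : Z) w S s t (y : E) :
  local_A a V z (time_reversal S w) s t y = - local_A a V z w (S - t) (S - s) y.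
Proof. by rewrite /local_A -sumrN; apply: eq_bigr => i _; rewrite mxE scaleNr. Qed.

(** The transposed second level is the tensor square of the first minus the second level, by
    [driver_symmetric]; the tensor square is [cG (cA)] by [local_G_A]. This matches the backward
    expansion of [davie_reverse]. *)
Lemma local_B_reversal a (z : Z) T W w S s t (y : E) : driver al T W w ->
  0 <= S - t -> S - t <= S - s -> S - s <= T ->
  local_B a V (vf_opp V0) z (time_reversal S w) s t y =
  local_G a V z w (S - t) (S - s) y (local_A a V z w (S - t) (S - s) y)
    - local_B a V V0 z w (S - t) (S - s) y.
Proof.
move=> hw h1 h2 h3; rewrite local_G_A /local_B opprD addrA; congr (_ + _).
  rewrite -sumrB; apply: eq_bigr => j _; rewrite -sumrB; apply: eq_bigr => k _.
  rewrite -scalerBl; congr (_ *: _).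
  have /matrixP/(_ j k) := driver_symmetric hw h1 h2 h3.
  by rewrite !mxE big_ord1 !mxE => <-; ring.
rewrite /field_in /vf_opp scalerN; congr (- (_ *: _)); ring.
Qed.

Lemma reversed_chart_solution T S W w m x : 0 <= W -> 0 <= S <= T -> driver al T W w ->
  RDE_solution al 0 T V V0 w m x ->
  chart_solution al V (vf_opp V0) S (time_reversal S w) (fun u => x (S - u)).
Proof.
move=> W0 ST hw sol; have cx : path_continuous T x by apply: path_continuous_within; case: sol.
split; first exact: (path_continuous_reverse ST).
move=> t0 a t00 t0S adom; have /andP[S0 S1] := ST.
pose b := S - t0; rewrite -/b in adom *.
have [b0 bT] : 0 <= b /\ b <= T by rewrite /b; split; lra.
have [r [sig [ O [[r0 sig0 oO Oa reg] [creg _]]]]] := local_extension (fmap_box adom).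
have [L hL] := local_davie_system al_lt (ltW r0) creg (subset_trans reg Oa) hV hV0.
set q0 := fmap_ a (x b) in reg creg hL.
have Oq0 : [set q : E * Z | `|q.1 - q0.1| < r] q0 by rewrite /= subrr normr0.
have [delta d0 hd] := chart_stays cx b0 bT (@open_norm_ball R p Z q0.1 r) adom Oq0.
have [delta' d0' hd'] := local_solution_window al_gt hV hV0 sol b0 bT adom.
(* A window to the right of t0 in reversed time is a window [c, b] to the left of b = S - t0. *)
have [c [c0 cb c1 cd cd']] : exists c, [/\ 0 <= c, c < b, b - c <= 1, b - delta < c & b - delta' < c].
  pose eta := Num.min b (Num.min 1 (Num.min delta delta')).
  have eta0 : 0 < eta by rewrite /eta !lt_min ltr01 d0 d0' /b subr_gt0 t0S.
  have := lexx eta; rewrite {2}/eta !le_min => /andP[l1 /andP[l2 /andP[l3 l4]]].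
  by exists (b - eta / 2); split; lra.
have [|||||K [win1 win2]] := hd' c b; [lra|lra|lra|lra|lra|].
have [_ zb] := win1 b (ltW cb) (lexx b).
rewrite -zb in win1 win2.
have sys : davie_system al (L W) c b [set y | `|y - q0.1| <= r]
    (local_A a V q0.2 w) (local_B a V V0 q0.2 w) (local_G a V q0.2 w).
  by apply: (hL T W) => //; rewrite mdistxx ltW.
have yD s : c <= s -> s <= b -> [set y | `|y - q0.1| <= r] (fmap_ a (x s)).1.
  move=> h3 h4; have [|||_ /ltW] := hd s; [lra|lra| |by []].
  by rewrite ltr_norml; apply/andP; split; lra.
have [C hC] := davie_reverse al_gt sys (y := fun u => (fmap_ a (x u)).1) yD win2.
exists (S - c), C; split; [rewrite /b in cb; lra|lra|split=> [u h1 h2|s t h1 h2 h3]].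
  by apply: win1; rewrite /b; lra.
have [ct tb] : c <= S - t /\ S - s <= b by rewrite /b; split; lra.
have ts : S - t <= S - s by lra.
have := hC (S - t) (S - s) ct ts tb.
rewrite /davie_defect local_A_reversal opprK -/q0 (local_B_reversal a q0.2 (fmap_ a (x (S - s))).1 hw).
- by have -> : S - s - (S - t) = t - s by ring.
- lra.
- exact: ts.
- lra.
Qed.

End Solutions.

(** * Joint continuity and uniform injectivity of the flow *)

Section Flow.
Context {R : realType} {p d : nat} {M Z : metricType R} (F : foliated_space p M Z).
Variables (al T : R).
Hypothesis al_gt : 3^-1 < al.
Hypothesis al_lt : al < 2^-1.
Hypothesis cM : compact [set: M].
Variables (V : 'I_d -> vfield F) (V0 : vfield F).
Hypothesis hV : forall i, leafwise_vfield 3 (V i).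
Hypothesis hV0 : leafwise_vfield 3 V0.
Variable Phi : M -> two_param R d -> R -> M.
Hypothesis hPhi : lyons_ito_map al T V V0 Phi.
Implicit Types (s t : R) (w : two_param R d) (m : M).

Lemma rough_close_refl e w : 0 <= e -> rough_close al T e w w.
Proof. by move=> e0 s t _ _ _; rewrite !subrr !normr0 !mulr_ge0 ?exprn_ge0 ?powR_ge0. Qed.

Lemma driver_of_close W e w w' : driver al T W w -> rough_close al T e w w' ->
  geometric_rough_path al T w' -> driver al T (W + e) w'.
Proof.
move=> hw hc gw'; have [W' _ [h1 h2 _ h4]] := geometric_driver al_gt al_lt gw'.
by split=> //; exact: driver_close (driver_bounds hw) hc.
Qed.

(** The limit path along the ultrafilter is a chart solution for [w] from [m], hence is [Phi m w] by
    uniqueness. The convergence of the times is then absorbed by equicontinuity. *)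
Lemma flow_cvg (I : Type) (G : set_system I) (ws : I -> two_param R d) (ms : I -> M) (ts : I -> R) w m t :
  UltraFilter G -> geometric_rough_path al T w -> (forall i, geometric_rough_path al T (ws i)) ->
  (forall e : R, 0 < e -> \forall i \near G, rough_close al T e w (ws i)) ->
  ms @ G --> m -> ts @ G --> t -> 0 <= t -> t <= T -> (forall i, 0 <= ts i /\ ts i <= T) ->
  Phi (ms i) (ws i) (ts i) @[i --> G] --> Phi m w t.
Proof.
move=> UG gw gws cws cms cts t0 tT tsT.
have [W W0 hw] := geometric_driver al_gt al_lt gw.
have /choice[x hx] (s : R) : exists y : M, Phi (ms i) (ws i) s @[i --> G] --> y.
  by have [//|l _ hl] := compact_ultra_limit UG cM (f := fun i => Phi (ms i) (ws i) s); exists l.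
have W1 : 0 <= W + 1 by lra.
have hw1 : driver al T (W + 1) w by apply: (driver_of_close hw) => //; exact: rough_close_refl.
have hws : \forall i \near G, driver al T (W + 1) (ws i).
  by apply: filterS (cws 1 ltr01) => i hc; exact: driver_of_close hw hc (gws i).
have sols : \forall i \near G, RDE_solution al 0 T V V0 (ws i) (ms i) (Phi (ms i) (ws i)).
  by apply: filterE => i; exact: hPhi.
have lim := limit_chart_solution al_gt al_lt hV hV0 cM W1 hws cws sols (fun s _ _ => hx s).
have sol := RDE_chart_solution al_gt hV hV0 (lexx T) (hPhi m gw).
have x0 : x 0 = Phi m w 0.
  have [_ -> _] := hPhi m gw.
  apply: (cvg_unique (@metric_hausdorff R M) (hx 0)).
  apply: cvg_trans cms; apply: near_eq_cvg; apply: filterE => i.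
  by have [_ -> _] := hPhi (ms i) (gws i).
have PG : ProperFilter G by apply: ultra_proper.
have xt := chart_solution_unique al_gt al_lt hV hV0 W1 hw1 (lim PG) sol x0.
apply: cvg_trans (_ : Phi (ms i) (ws i) (ts i) @[i --> G] --> x t) _; last by rewrite xt.
apply/cvg_ballP => e e0; have e2 : 0 < e / 2 by rewrite divr_gt0.
have [eta eta0 heta] := equicontinuity al_gt al_lt hV hV0 cM W1 e2.
have nt : \forall i \near G, mdist (x t) (Phi (ms i) (ws i) t) < e / 2.
  by apply: (cvg_near (A := [set y | mdist (x t) y < e / 2]) (hx t)); apply/nbhs_mdistP; exists (e / 2).
have nts : \forall i \near G, `|t - ts i| < eta by exact: cvg_dist_lt cts eta0.
apply: filterS3 nt nts hws => i h1 h2 h3; rewrite ballEmdist /=.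
apply: mdist_lt_half h1 _; move: h2; rewrite ltr_norml => /andP[h4 h5].
have [ts0 tsT'] := tsT i.
have [le|lt] := leP t (ts i).
  by rewrite metric_sym; apply: (heta _ _ _ _ _ _ h3 (hPhi (ms i) (gws i))) => //; lra.
by apply: (heta _ _ _ _ _ _ h3 (hPhi (ms i) (gws i))) => //; lra.
Qed.

(** The compactness argument shared by uniform continuity and uniform injectivity. Counterexamples
    at the scales 1 / (n + 1) would have limits along an ultrafilter, where [Q] is assumed to hold
    eventually. The first argument of [Q] is the scale. *)
Lemma flow_uniform w (Q : R -> two_param R d -> R -> R -> M -> M -> Prop) :
  geometric_rough_path al T w ->
  (forall (G : set_system nat) ws (ts ts' : nat -> R) (ms ms' : nat -> M) t m m',
     UltraFilter G -> (forall e : R, 0 < e -> \forall n \near G, n.+1%:R^-1 < e) ->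
     ms @ G --> m -> ms' @ G --> m' ->
     Phi (ms n) w (ts n) @[n --> G] --> Phi m w t ->
     Phi (ms' n) (ws n) (ts' n) @[n --> G] --> Phi m' w t ->
     0 <= t <= T ->
     \forall n \near G, Q n.+1%:R^-1 (ws n) (ts n) (ts' n) (ms n) (ms' n)) ->
  exists2 delta : R, 0 < delta & forall w' t t' m m', geometric_rough_path al T w' ->
    rough_close al T delta w w' -> 0 <= t <= T -> 0 <= t' <= T -> `|t - t'| < delta ->
    Q delta w' t t' m m'.
Proof.
move=> gw hQ; apply: contrapT => nQ.
have /choice[X hX] (n : nat) : exists X : two_param R d * (R * R) * (M * M),
    [/\ geometric_rough_path al T X.1.1, rough_close al T n.+1%:R^-1 w X.1.1,
      0 <= X.1.2.1 <= T, 0 <= X.1.2.2 <= T & `|X.1.2.1 - X.1.2.2| < n.+1%:R^-1] /\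
    ~ Q n.+1%:R^-1 X.1.1 X.1.2.1 X.1.2.2 X.2.1 X.2.2.
  apply: contrapT => nX; apply: nQ; exists n.+1%:R^-1; first by rewrite invr_gt0.
  move=> w' t t' m m' h1 h2 h3 h4 h5; apply: contrapT => nq; apply: nX.
  by exists (w', (t, t'), (m, m')).
have [G UG vG] := vanishing_ultrafilter R.
have [m _ cm] := compact_ultra_limit UG cM (f := fun n => (X n).2.1) (fun=> I).
have [m' _ cm'] := compact_ultra_limit UG cM (f := fun n => (X n).2.2) (fun=> I).
have [t t0T ct] : exists2 t : R, 0 <= t <= T & (X n).1.2.1 @[n --> G] --> t.
  have [n|t ht ct] := compact_ultra_limit UG (@segment_compact R 0 T) (f := fun n => (X n).1.2.1).
    by have [[_ _ h _ _] _] := hX n; rewrite /= in_itv.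
  by exists t => //; move: ht; rewrite /= in_itv.
have ct' : (X n).1.2.2 @[n --> G] --> t.
  apply/cvgrPdist_lt => e e0; have e2 : 0 < e / 2 by rewrite divr_gt0.
  have ct2 : \forall n \near G, `|t - (X n).1.2.1| < e / 2 by exact: cvg_dist_lt ct e2.
  apply: filterS2 (vG _ e2) ct2 => n h1 h2.
  have [[_ _ _ _ h3] _] := hX n.
  have -> : t - (X n).1.2.2 = (t - (X n).1.2.1) + ((X n).1.2.1 - (X n).1.2.2) by ring.
  rewrite [e]splitr; apply: le_lt_trans (ler_normD _ _) _; exact: ltrD h2 (lt_trans h3 h1).
have cw (e : R) : 0 < e -> \forall n \near G, rough_close al T e w (X n).1.1.
  move=> e0; apply: filterS (vG e e0) => n h1 s s' s0 ss' s'T.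
  have [[_ h2 _ _ _] _] := hX n; have [h3 h4] := h2 s s' s0 ss' s'T.
  split; [apply: le_trans h3 _|apply: le_trans h4 _].
    by rewrite ler_wpM2r ?powR_ge0// ltW.
  by rewrite ler_wpM2r ?exprn_ge0 ?powR_ge0// ltW.
have /andP[t0 tT] := t0T.
have c1 : Phi (X n).2.1 w (X n).1.2.1 @[n --> G] --> Phi m w t.
  apply: (flow_cvg (ws := fun=> w)) => //.
  - by move=> e e0; apply: filterE => n; apply: rough_close_refl; exact: ltW.
  - by move=> n; have [[_ _ /andP h _ _] _] := hX n.
have c2 : Phi (X n).2.2 (X n).1.1 (X n).1.2.2 @[n --> G] --> Phi m' w t.
  apply: flow_cvg => //.
  - by move=> n; have [[h _ _ _ _] _] := hX n.
  - by move=> n; have [[_ _ _ /andP h _] _] := hX n.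
have := hQ G (fun n => (X n).1.1) (fun n => (X n).1.2.1) (fun n => (X n).1.2.2)
  (fun n => (X n).2.1) (fun n => (X n).2.2) t m m' UG vG cm cm' c1 c2 t0T.
by move=> /filter_ex[n qn]; have [_] := hX n.
Qed.

Lemma mdist_cvg_lt (G : set_system nat) (f g : nat -> M) (l : M) (e : R) : UltraFilter G ->
  f @ G --> l -> g @ G --> l -> 0 < e -> \forall n \near G, mdist (f n) (g n) < e.
Proof.
move=> UG cf cg e0; have e2 : 0 < e / 2 by rewrite divr_gt0.
have h (u : nat -> M) : u @ G --> l -> \forall n \near G, mdist (u n) l < e / 2.
  move=> cu; apply: (cvg_near (A := [set y | mdist y l < e / 2]) cu).
  by apply/nbhs_mdistP; exists (e / 2) => // y; rewrite metric_sym.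
by apply: filterS2 (h f cf) (h g cg) => n; exact: mdist_lt_half.
Qed.

Lemma mdist_cvg_neq (G : set_system nat) (f g : nat -> M) (l l' : M) : UltraFilter G ->
  (forall e : R, 0 < e -> \forall n \near G, n.+1%:R^-1 < e) ->
  f @ G --> l -> g @ G --> l' -> l <> l' -> \forall n \near G, ~ (mdist (f n) (g n) < n.+1%:R^-1).
Proof.
move=> UG vG cf cg ll; have d0 : 0 < mdist l l'.
  rewrite lt_neqAle mdist_ge0 andbT; apply/negP => /eqP d0.
  by apply: ll; exact: mdist_positivity.
have d3 : 0 < mdist l l' / 3 by rewrite divr_gt0.
have h (u : nat -> M) a : u @ G --> a -> \forall n \near G, mdist a (u n) < mdist l l' / 3.
  move=> cu; apply: (cvg_near (A := [set y | mdist a y < mdist l l' / 3]) cu).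
  by apply/nbhs_mdistP; exists (mdist l l' / 3).
apply: filterS3 (vG _ d3) (h f l cf) (h g l' cg) => n h3 h4 h5 h6.
by have := mdist_lt_third h4 h5 (lt_trans h6 h3); rewrite ltxx.
Qed.

Lemma flow_uniformly_continuous w (e : R) : geometric_rough_path al T w -> 0 < e ->
  exists2 delta : R, 0 < delta & forall w' t t' m m', geometric_rough_path al T w' ->
    rough_close al T delta w w' -> 0 <= t <= T -> 0 <= t' <= T -> `|t - t'| < delta ->
    mdist m m' < delta -> mdist (Phi m w t) (Phi m' w' t') < e.
Proof.
move=> gw e0; apply: (flow_uniform (Q := fun delta w' t t' m m' =>
  mdist m m' < delta -> mdist (Phi m w t) (Phi m' w' t') < e) gw).
move=> G ws ts ts' ms ms' t m m' UG vG cm cm' c1 c2 t0T.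
have [mm|mm] := pselect (m = m').
  by rewrite -mm in c2; apply: filterS (mdist_cvg_lt UG c1 c2 e0).
by apply: filterS (mdist_cvg_neq UG vG cm cm' mm).
Qed.

(** A modulus of continuity of the inverse flow, jointly in time and driver. If the two limit points
    differ, so do their images, and the images are eventually farther apart than the scale. *)
Lemma flow_uniformly_injective w (e : R) : geometric_rough_path al T w -> 0 < e ->
  (forall t m m', 0 <= t <= T -> Phi m w t = Phi m' w t -> m = m') ->
  exists2 delta : R, 0 < delta & forall w' t t' m m', geometric_rough_path al T w' ->
    rough_close al T delta w w' -> 0 <= t <= T -> 0 <= t' <= T -> `|t - t'| < delta ->
    mdist (Phi m w t) (Phi m' w' t') < delta -> mdist m m' < e.
Proof.
move=> gw e0 inj; apply: (flow_uniform (Q := fun delta w' t t' m m' =>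
  mdist (Phi m w t) (Phi m' w' t') < delta -> mdist m m' < e) gw).
move=> G ws ts ts' ms ms' t m m' UG vG cm cm' c1 c2 t0T.
have [mm|mm] := pselect (m = m').
  by rewrite -mm in cm'; apply: filterS (mdist_cvg_lt UG cm cm' e0).
apply: filterS (mdist_cvg_neq UG vG c1 c2 _) => // /(inj t m m' t0T); exact: mm.
Qed.

End Flow.

Lemma continuous_mdistP {R : realType} {X Y : metricType R} (f : X -> Y) :
  (forall x (e : R), 0 < e -> exists2 delta : R, 0 < delta & forall y, mdist x y < delta -> mdist (f x) (f y) < e) ->
  continuous f.
Proof.
move=> h x; apply/cvg_ballP => e e0; have [delta d0 hd] := h x e e0.
by apply/nbhs_mdistP; exists delta => // y xy; rewrite ballEmdist /=; exact: hd.
Qed.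

(** * The flow as a path of homeomorphisms *)

Section FlowHomeomorphism.
Context {R : realType} {p d : nat} {M Z : metricType R} (F : foliated_space p M Z).

Lemma homeoL_dist_le (f g : homeoL F) (e : R) : 0 <= e ->
  (forall m, mdist (f m) (g m) <= e) ->
  (forall m, mdist (homeoL_inv f m) (homeoL_inv g m) <= e) -> homeoL_dist f g <= e + e.
Proof.
move=> e0 h1 h2.
(* [M] may be empty: the supremum of the empty set is [0]. *)
have h (D : M -> R) : (forall m, D m <= e) -> sup [set D m | m in [set: M]] <= e.
  move=> hD; have [->|ne] := eqVneq [set D m | m in [set: M]] set0; first by rewrite sup0.
  by apply: ge_sup; [exact/set0P|move=> _ [m _ <-]].
by apply: lerD; apply: h.
Qed.

(** The value given to the path of homeomorphisms at drivers that are not geometric and at times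
    outside [0, T]. *)
Lemma id_homeoL : exists h : homeoL F, forall m, h m = m.
Proof.
have hc : continuous (id : M -> M) by move=> x; exact: cvg_id.
have hf : foliation_preserving F id by move=> m; exists m => _ [x mx <-].
have K : cancel (id : M -> M) id by [].
by exists (HomeoL K K hc hc hf hf).
Qed.

Variables (al T : R).
Hypothesis al_gt : 3^-1 < al.
Hypothesis al_lt : al < 2^-1.
Hypothesis cM : compact [set: M].
Variables (V : 'I_d -> vfield F) (V0 : vfield F).
Hypothesis hV : forall i, leafwise_vfield 3 (V i).
Hypothesis hV0 : leafwise_vfield 3 V0.
Variables (Phi : M -> two_param R d -> R -> M) (Phic : R -> M -> two_param R d -> R -> M).
Hypothesis hPhi : lyons_ito_map al T V V0 Phi.
Hypothesis hPhic : forall S, 0 <= S <= T -> lyons_ito_map al S V (vf_opp V0) (Phic S).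
Implicit Types (s t S : R) (w : two_param R d) (m : M).

(** The path that solves the reversed equation from [Phi m w S] and the reversed path
    [u |-> Phi m w (S - u)] start at the same point, so they agree at S, where the latter is at
    [m]. *)
Lemma flowK S w : 0 <= S <= T -> geometric_rough_path al T w ->
  cancel (fun m => Phi m w S) (fun m => Phic S m (time_reversal S w) S).
Proof.
move=> ST gw m /=; have /andP[S0 S1] := ST.
have [W W0 hw] := geometric_driver al_gt al_lt gw.
have gr := geometric_reversal al_gt al_lt ST gw.
have hwr := driver_reversal ST hw.
have hV0' := leafwise_vf_opp hV0.
have rev := reversed_chart_solution al_gt al_lt hV hV0 W0 ST hw (hPhi m gw).
have solc := hPhic ST (Phi m w S) gr.
have sol := RDE_chart_solution al_gt hV hV0' (lexx S) solc.
have e0 : Phic S (Phi m w S) (time_reversal S w) 0 = Phi m w (S - 0).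
  by rewrite subr0; have [_ ->] := solc.
have -> := chart_solution_unique al_gt al_lt hV hV0' W0 hwr sol rev e0 S0 (lexx S).
by rewrite subrr; have [_ ->] := hPhi m gw.
Qed.

(** The same argument applied to the reversed equation: reversing the driver and the sign of the
    drift twice gives back the original equation, now on [0, S]. *)
Lemma flow_invK S w : 0 <= S <= T -> geometric_rough_path al T w ->
  cancel (fun m => Phic S m (time_reversal S w) S) (fun m => Phi m w S).
Proof.
move=> ST gw m /=; have /andP[S0 S1] := ST.
have [W W0 hw] := geometric_driver al_gt al_lt gw.
have gr := geometric_reversal al_gt al_lt ST gw.
have hwr := driver_reversal ST hw.
have hV0' := leafwise_vf_opp hV0.
have SS : 0 <= S <= S by rewrite S0 lexx.
have solc := hPhic ST m gr.
have := reversed_chart_solution al_gt al_lt hV hV0' W0 SS hwr solc.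
rewrite vf_oppK time_reversal_involutive => rev.
set n := Phic S m _ S.
have sol := RDE_chart_solution al_gt hV hV0 S1 (hPhi n gw).
have hwS := driver_restrict S1 hw.
have e0 : Phi n w 0 = Phic S m (time_reversal S w) (S - 0).
  by rewrite subr0; have [_ ->] := hPhi n gw.
have -> := chart_solution_unique al_gt al_lt hV hV0 W0 hwS sol rev e0 S0 (lexx S).
by rewrite subrr; have [_ ->] := solc.
Qed.

Lemma flow_inj w t m m' : geometric_rough_path al T w -> 0 <= t <= T ->
  Phi m w t = Phi m' w t -> m = m'.
Proof. by move=> gw tT /(congr1 (fun n => Phic t n (time_reversal t w) t)); rewrite !flowK. Qed.

Lemma flow_continuous S w : 0 <= S <= T -> geometric_rough_path al T w ->
  continuous (fun m => Phi m w S).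
Proof.
move=> ST gw; apply: continuous_mdistP => m e e0.
have [delta d0 hd] := flow_uniformly_continuous al_gt al_lt cM hV hV0 hPhi gw e0.
exists delta => // m' mm; apply: (hd w S S m m') => //.
  by apply: rough_close_refl; exact: ltW.
by rewrite subrr normr0.
Qed.

Lemma flow_inv_continuous S w : 0 <= S <= T -> geometric_rough_path al T w ->
  continuous (fun m => Phic S m (time_reversal S w) S).
Proof.
move=> ST gw; apply: continuous_mdistP => m e e0.
have inj t m1 m2 (tT : 0 <= t <= T) := @flow_inj w t m1 m2 gw tT.
have [delta d0 hd] := flow_uniformly_injective al_gt al_lt cM hV hV0 hPhi gw e0 inj.
exists delta => // m' mm; apply: (hd w S S) => //.
- by apply: rough_close_refl; exact: ltW.
- by rewrite subrr normr0.
(* The flow maps the two values of the inverse back to m and m', so uniform injectivity is a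
   continuity estimate for the inverse. *)
- by rewrite (flow_invK ST gw m) (flow_invK ST gw m').
Qed.

Lemma flow_leaf_preserving S w : 0 <= S <= T -> geometric_rough_path al T w ->
  leaf_preserving F (fun m => Phi m w S).
Proof.
by move=> /andP[S0 S1] gw m; apply: (solution_leaf al_gt hV hV0 (hPhi m gw)).
Qed.

Lemma flow_inv_leaf_preserving S w : 0 <= S <= T -> geometric_rough_path al T w ->
  leaf_preserving F (fun m => Phic S m (time_reversal S w) S).
Proof.
move=> ST gw m; have /andP[S0 S1] := ST.
have gr := geometric_reversal al_gt al_lt ST gw.
exact: (solution_leaf al_gt hV (leafwise_vf_opp hV0) (hPhic ST m gr)).
Qed.

Lemma flow_homeoL t w : 0 <= t <= T -> geometric_rough_path al T w ->
  exists h : homeoL F, forall m, h m = Phi m w t.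
Proof.
move=> tT gw.
by exists (@HomeoL R p M Z F (fun m => Phi m w t) (fun m => Phic t m (time_reversal t w) t)
  (flowK tT gw) (flow_invK tT gw) (flow_continuous tT gw) (flow_inv_continuous tT gw)
  (leaf_preserving_foliation (flow_leaf_preserving tT gw))
  (leaf_preserving_foliation (flow_inv_leaf_preserving tT gw))).
Qed.

Lemma flow_homeoL_dist w (e : R) : geometric_rough_path al T w -> 0 < e ->
  exists2 delta : R, 0 < delta & forall w' t t' (h h' : homeoL F),
    geometric_rough_path al T w' ->
    rough_close al T delta w w' -> 0 <= t <= T -> 0 <= t' <= T -> `|t - t'| < delta ->
    (forall m, h m = Phi m w t) -> (forall m, h' m = Phi m w' t') -> homeoL_dist h h' < e.
Proof.
move=> gw e0; have e3 : 0 < e / 3 by rewrite divr_gt0.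
have inj t m1 m2 (tT : 0 <= t <= T) := @flow_inj w t m1 m2 gw tT.
have [delta d0 hd] := flow_uniformly_continuous al_gt al_lt cM hV hV0 hPhi gw e3.
have [delta' d0' hd'] := flow_uniformly_injective al_gt al_lt cM hV hV0 hPhi gw e3 inj.
exists (Num.min delta delta'); first by rewrite lt_min d0 d0'.
move=> w' t t' h h' gw' cw tT tT' tt hE hE'.
have [l1 l2] : Num.min delta delta' <= delta /\ Num.min delta delta' <= delta'.
  by rewrite !ge_min !lexx orbT.
have cw_le e' : Num.min delta delta' <= e' -> rough_close al T e' w w'.
  move=> le s s' s0 ss' s'T; have [h1 h2] := cw s s' s0 ss' s'T.
  split; [apply: le_trans h1 _|apply: le_trans h2 _].
    by rewrite ler_wpM2r ?powR_ge0.
  by rewrite ler_wpM2r ?exprn_ge0 ?powR_ge0.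
(* One third for the maps and one for their inverses; the remaining third makes the inequality
   strict. *)
apply: (@le_lt_trans _ _ (e / 3 + e / 3)); last lra.
apply: homeoL_dist_le => [|m|m]; first exact: ltW.
  rewrite hE hE'; apply/ltW/(hd w' t t' m m) => //; [exact: cw_le|exact: lt_le_trans tt l1|].
  by rewrite mdistxx.
apply/ltW/(hd' w' t t') => //; [exact: cw_le|exact: lt_le_trans tt l2|].
by rewrite -hE -hE' !homeoL_invK mdistxx.
Qed.

End FlowHomeomorphism.

Theorem proposition4p9 (R : realType) (alpha T : R)
    (halpha : 3^-1 < alpha < 2^-1) (hT : 0 < T)
    (p d : nat) (M Z : metricType R) (F : foliated_space p M Z)
    (hM : compact [set: M])
    (V : 'I_d -> vfield F) (V0 : vfield F)
    (hV : forall i, leafwise_vfield 3 (V i)) (hV0 : leafwise_vfield 3 V0)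
    (Phi : M -> two_param R d -> R -> M)
    (hPhi : lyons_ito_map alpha T V V0 Phi)
    (Phic : R -> M -> two_param R d -> R -> M)
    (hPhic : forall S, 0 <= S <= T ->
       lyons_ito_map alpha S V (vf_opp V0) (Phic S)) :
  (forall (S : R) (w : two_param R d), 0 <= S <= T ->
     geometric_rough_path alpha T w ->
     let f := fun m => Phi m w S in
     let g := fun m => Phic S m (time_reversal S w) S in
     [/\ continuous f, continuous g, cancel f g, cancel g f &
         leaf_preserving F f])
  /\
  exists H : two_param R d -> R -> homeoL F,
    [/\ forall w t m, geometric_rough_path alpha T w -> 0 <= t <= T ->
          H w t m = Phi m w t,
        forall w t, geometric_rough_path alpha T w -> 0 <= t <= T ->
          forall eps : R, 0 < eps -> exists2 delta : R, 0 < delta &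
          forall s, 0 <= s <= T -> `|s - t| < delta ->
            homeoL_dist (H w s) (H w t) < eps &
        forall w, geometric_rough_path alpha T w ->
          forall eps : R, 0 < eps -> exists2 delta : R, 0 < delta &
          forall w', geometric_rough_path alpha T w' ->
            rough_dist alpha T w w' < delta ->
            forall t, 0 <= t <= T -> homeoL_dist (H w t) (H w' t) < eps].
Proof.
have /andP[al_gt al_lt] := halpha.
split=> [S w ST gw f g|].
  split; rewrite /f /g.
  - exact: (flow_continuous al_gt al_lt hM hV hV0 hPhi ST gw).
  - exact: (flow_inv_continuous al_gt al_lt hM hV hV0 hPhi hPhic ST gw).
  - exact: (flowK al_gt al_lt hV hV0 hPhi hPhic ST gw).
  - exact: (flow_invK al_gt al_lt hV hV0 hPhi hPhic ST gw).
  - exact: (flow_leaf_preserving al_gt hV hV0 hPhi ST gw).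
have /choice[H hH] (wt : two_param R d * R) : exists h : homeoL F,
    geometric_rough_path alpha T wt.1 -> 0 <= wt.2 <= T -> forall m, h m = Phi m wt.1 wt.2.
  have [gw|ngw] := pselect (geometric_rough_path alpha T wt.1); last first.
    by have [h _] := id_homeoL F; exists h.
  have [tT|ntT] := boolP (0 <= wt.2 <= T); last by have [h _] := id_homeoL F; exists h.
  have [h hh] := flow_homeoL al_gt al_lt hM hV hV0 hPhi hPhic tT gw.
  by exists h.
exists (fun w t => H (w, t)); split=> [w t m gw tT|w t gw tT eps e0|w gw eps e0].
- exact: (hH (w, t)).
- have [delta d0 hd] := flow_homeoL_dist al_gt al_lt hM hV hV0 hPhi hPhic gw e0.
  exists delta => // s sT st; apply: (hd w s t) => //.
  + by apply: rough_close_refl; exact: ltW.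
  + by move=> m; exact: (hH (w, s)).
  + by move=> m; exact: (hH (w, t)).
have [delta d0 hd] := flow_homeoL_dist al_gt al_lt hM hV hV0 hPhi hPhic gw e0.
exists delta => // w' gw' ww t tT; apply: (hd w' t t) => //.
- have [W _ hw] := geometric_driver al_gt al_lt gw; have [W' _ hw'] := geometric_driver al_gt al_lt gw'.
  exact: (rough_dist_close al_gt (driver_bounds hw) (driver_bounds hw') ww).
- by rewrite subrr normr0.
- by move=> m; exact: (hH (w, t)).
- by move=> m; exact: (hH (w', t)).
Qed.
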